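(* Let $m$ be a nonnegative integer, let $g$ be an entire function on $\mathbb{C}$, and let $0<p\leq\infty$. Let $V_g f(z)=\int_0^z f(w)g'(w)\,dw$ for entire $f$. Then: (i) (a) $V_g:\mathcal{F}_{\psi_m}^p\to\mathcal{F}_{\psi_m}^\infty$ is bounded if and only if $g(z)=az^2+bz+c$ for some $a,b,c\in\mathbb{C}$. (b) $V_g:\mathcal{F}_{\psi_m}^p\to\mathcal{F}_{\psi_m}^\infty$ is compact if and only if $g(z)=az+b$ for some $a,b\in\mathbb{C}$. (ii) If $0<p<\infty$, then the following statements are equivalent: (a) $V_g:\mathcal{F}_{\psi_m}^\infty\to\mathcal{F}_{\psi_m}^p$ is bounded; (b) $V_g:\mathcal{F}_{\psi_m}^\infty\to\mathcal{F}_{\psi_m}^p$ is compact; (c) in the case $p>2$: $g(z)=az+b$ for some $a,b\in\mathbb{C}$; in the case $p\le 2$: $g$ is constant. (iii) If $V_g:\mathcal{F}_{\psi_m}^\infty\to\mathcal{F}_{\psi_m}^\infty$ is a bounded operator, i.e. $g(z)=az^2+bz+c$ with $a,b,c\in\mathbb{C}$, then its spectrum satisfies $$\sigma(V_g)=\{\lambda\in\mathbb{C}:|\lambda|\leq 2|a|\}=\{0\}\cup\overline{\{\lambda\in\mathbb{C}\setminus\{0\}: e^{g(z)/\lambda}\notin\mathcal{F}_{\psi_m}^\infty\}}.$$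
   Context: For a nonnegative integer $m$ put $\psi_m(z)=\frac12|z|^2-m\log(1+|z|)$, $z\in\mathbb{C}$. For $0<p<\infty$, the Fock--Sobolev space $\mathcal{F}_{\psi_m}^p$ is the space of all entire functions $f$ with $$\|f\|_{(m,p)}^p\simeq\int_{\mathbb{C}}|f(z)|^p e^{-p\psi_m(z)}\,dA(z)<\infty,$$ where $dA$ is Lebesgue area measure on $\mathbb{C}$; $\mathcal{F}_{\psi_m}^\infty$ is the space of all entire functions $f$ with $$\|f\|_{(m,\infty)}\simeq\sup_{z\in\mathbb{C}}|f(z)|e^{-\psi_m(z)}<\infty.$$ Here $\simeq$ means two-sided comparability with constants independent of $f$; one may take the expressions on the right as defining the norms (quasi-norms if $p<1$). For entire $g$, the Volterra-type integral operator is $V_gf(z)=\int_0^z f(w)g'(w)\,dw$. ''$V_g:X\to Y$ is bounded'' means that $V_g$ maps $X$ into $Y$ with $\|V_gf\|_Y\le C\|f\|_X$ for all $f\in X$ and some constant $C$; ''compact'' means that it maps bounded sequences in $X$ to sequences in $Y$ having norm-convergent subsequences. The spectrum $\sigma(T)$ of a bounded operator $T$ on a Banach space is the set of all $\lambda\in\mathbb{C}$ for which $\lambda I-T$ is not invertible. *)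

(* Defs.v *)
From mathcomp Require Import all_boot all_order all_algebra.
From mathcomp Require Import complex.
From mathcomp Require Import all_classical all_reals all_analysis.

Set Implicit Arguments.
Unset Strict Implicit.
Unset Printing Implicit Defensive.
Import Order.TTheory GRing.Theory Num.Theory.
Import numFieldNormedType.Exports.
Import ComplexField.Normc.

Local Open Scope classical_set_scope.
Local Open Scope ring_scope.
Local Open Scope complex_scope.

Section FockSobolev.
Variable R : realType.
Local Notation C := R[i].

(* [C^o] is the complex plane as a normed module over itself: derivability in
   the direction 1 over the scalar field [C] is complex differentiability. *)
Definition entire (f : C -> C) : Prop :=
  forall z : C^o, derivable (f : C^o -> C^o) z 1.

Definition cderiv (f : C -> C) : C -> C := derive1 (f : C^o -> C^o).

Definition cexp (z : C) : C :=
  (expR (complex.Re z) * cos (complex.Im z)) +i* (expR (complex.Re z) * sin (complex.Im z)).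

(* Integral of [F] along the segment from 0 to [z], parametrized by [t * z]
   with [t] in [0, 1]. For entire [F] it is the path-independent integral. *)
Definition seg_integral (F : C -> C) (z : C) : C :=
  (\int[lebesgue_measure]_(t in `[0, 1]%classic) complex.Re (F (t%:C * z) * z))%R +i*
  (\int[lebesgue_measure]_(t in `[0, 1]%classic) complex.Im (F (t%:C * z) * z))%R.

Definition volterra (g f : C -> C) : C -> C :=
  seg_integral (fun w => f w * cderiv g w).

Definition psi (m : nat) (z : C) : R :=
  2^-1 * normc z ^+ 2 - m%:R * ln (1 + normc z).

(* Finite exponents [r] give [(int |f|^r exp(-r psi_m) dA)^(1/r)]; the value at
   [-oo] is junk, exponents being assumed positive. *)
Definition fock_norm (m : nat) (p : \bar R) (f : C -> C) : \bar R :=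
  match p with
  | r%:E => ((\int[lebesgue_measure \x lebesgue_measure]_u
               (normc (f (u.1 +i* u.2)) `^ r *
                expR (- (r * psi m (u.1 +i* u.2))))%:E) `^ r^-1)%E
  | +oo%E => ereal_sup
               (range (fun z : C => (normc (f z) * expR (- psi m z))%:E))
  | -oo%E => 0%E
  end.

Definition fock (m : nat) (p : \bar R) : set (C -> C) :=
  [set f | entire f /\ (fock_norm m p f < +oo)%E].

Definition bounded_op (m : nat) (p q : \bar R) (T : (C -> C) -> (C -> C)) :=
  exists K : R, forall f, fock m p f ->
    fock m q (T f) /\ (fock_norm m q (T f) <= K%:E * fock_norm m p f)%E.

Definition compact_op (m : nat) (p q : \bar R) (T : (C -> C) -> (C -> C)) :=
  (forall f, fock m p f -> fock m q (T f)) /\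
  forall (u : nat -> C -> C) (K : R),
    (forall n, fock m p (u n) /\ (fock_norm m p (u n) <= K%:E)%E) ->
    exists (s : nat -> nat) (h : C -> C),
      [/\ {homo s : i j / (i < j)%N}, fock m q h &
          fock_norm m q (T (u (s n)) \- h) @[n --> \oo] --> 0%E].

(* For a bounded linear [T] on the space this is invertibility in the algebra of
   bounded operators; linearity of the two-sided inverse [S] is automatic. *)
Definition invertible_op (m : nat) (p : \bar R) (T : (C -> C) -> (C -> C)) :=
  exists2 S, bounded_op m p p S &
    forall f, fock m p f -> S (T f) = f /\ T (S f) = f.

Definition spectrum (m : nat) (p : \bar R) (T : (C -> C) -> (C -> C)) :
    set C^o :=
  [set l | ~ invertible_op m p (fun f z => l * f z - T f z)].

End FockSobolev.

(* Main.v *)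
Require Import Defs.
From mathcomp Require Import all_boot all_order all_algebra.
From mathcomp Require Import complex ring lra.
From mathcomp Require Import all_classical all_reals all_analysis.
From mathcomp Require Import measurable_realfun simple_functions.

Set Implicit Arguments.
Unset Strict Implicit.
Unset Printing Implicit Defensive.
Import Order.TTheory GRing.Theory Num.Theory.
Import numFieldNormedType.Exports.
Import ComplexField.Normc.

Local Open Scope classical_set_scope.
Local Open Scope ring_scope.
Local Open Scope complex_scope.

#[local] Arguments normc : simpl never.

(* The normalised kernels k_w satisfy |k_w| e^(-psi_m) <= (1+|z-w|)^m e^(-|z-w|^2/2), with
   equality to 1 at w, and a weighted Cauchy estimate bounds |F'(w)| e^(-psi_m(w)) / (1+|w|)
   by local averages of |F|^p e^(-p psi_m).  With F = V_g k_w this gives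
   |g'(w)| = O(1+|w|), and o(1+|w|) in the compact case, so Liouville makes g a
   polynomial of degree at most 2 or 1.  With F = V_g f, f a sum of kernels over a
   finite lattice, it gives sum_w (|g'(w)|/(1+|w|))^p < oo over the whole lattice,
   which excludes g' <> 0 unless p > 2 and g' is constant.  Conversely a radial
   growth estimate gives |V_g f| e^(-psi_m) = O(sup_z |g'(z)|/(1+|z|)), with an
   extra decay 1/(1+|z|) when g' is bounded, and compactness follows from Montel's
   theorem.  Variation of constants, with integrating factor e^(g/l), gives the
   resolvent at l, which is bounded for |l| > 2|a|.  For 0 < |l| <= 2|a| the equation
   (l - V_g) f = e^(g/l), if e^(g/l) lies in the space, or else (l - V_g) f = 1,
   has no solution there. *)

(** Complex analysis enters through one quantitative tool, Cauchy's estimate for the first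
    derivative with the crude constant 16; the smoothness of derivatives, Liouville, Weierstrass and
    Montel are drawn from it, without power series. The gradient of [psi m] has size about [|z|], so
    differentiating costs a factor [1 + |z|] in the weighted norm and integrating along a ray
    regains it: hence the ratio [|g'| / (1 + |z|)] everywhere. An obstacle to local arguments is
    that [|F| e^(-psi_m)] is not the modulus of a holomorphic function; multiplying [F] by the
    character [e^(-conj(w) z)] makes it so, up to bounded factors, on the unit disc at [w]. From the
    sup space to the [p]-space one kernel sees one point only; a sum of kernels over a sparse
    lattice keeps a bounded sup norm while every lattice point contributes its own box of mass, so
    an [l^p] sum appears, uniformly in the size of the lattice. The threshold [p = 2] is that of
    [sum (1 + |w|)^(-p)] over a planar lattice. Plane integrals are bounded below by disjoint boxes
    and above by dyadic ones, so only step functions are integrated exactly. *)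

(** * Differentiation rules over a numeric field *)

Section Caratheodory.
Variable K : numFieldType.
Implicit Types (f g : K -> K) (x l : K).

(* Carathéodory's form of differentiability turns every differentiation rule
   into a continuity statement, and is uniform in the field [K]. *)
Definition hasder f x l :=
  exists2 q : K^o -> K^o, (forall y, f y - f x = q y * (y - x)) &
    {for (x : K^o), continuous q} /\ q x = l.

Lemma hasderP f x l :
  hasder f x l <-> is_derive (x : K^o) 1 (f : K^o -> K^o) l.
Proof.
split=> [[q fE [cq ql]]|df].
  have lim : h^-1 *: ((f \o shift (x : K^o)) (h *: (1 : K^o)) - f x)
      @[h --> (0 : K^o)^'] --> (l : K^o).
    have : (q \o shift (x : K^o)) y @[y --> (0 : K^o)^'] --> (l : K^o).
      by rewrite -ql; apply/continuous_withinNshiftx.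
    apply: cvg_trans; apply: near_eq_cvg; near=> y.
    rewrite /= fE addrK [y *: 1]mulr1 [RHS]mulrC mulfK //.
    by near: y; rewrite near_withinE /= near_simpl; near=> y1.
  have dE : 'D_1 (f : K^o -> K^o) (x : K^o) = l by exact: cvg_lim lim.
  by apply: DeriveDef => //; apply: cvgP lim.
exists (fun y => if y == x then l else (f y - f x) / (y - x)).
  move=> y; case: eqP => [->|/eqP]; first by rewrite !subrr mulr0.
  by rewrite -subr_eq0 => /divfK ->.
split; last by rewrite eqxx.
apply/continuous_withinNshiftx; rewrite eqxx /=.
have F1 : (fun h => h^-1 *: ((f \o shift (x : K^o)) (h *: (1 : K^o)) - f x))
    @ (0 : K^o)^' --> (l : K^o) by case: df => H1 <-.
apply: cvg_trans F1; apply: near_eq_cvg; near=> h.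
rewrite /= ifN; first by rewrite addrK [RHS]mulrC /= [h *: 1]mulr1.
rewrite -subr_eq0 addrK.
by near: h; rewrite near_withinE /= near_simpl; near=> h1.
Unshelve. all: by end_near. Qed.

Lemma hasder_unique f x l l' : hasder f x l -> hasder f x l' -> l = l'.
Proof.
move=> /hasderP d /hasderP d'.
by rewrite -(@derive_val _ _ _ _ _ _ _ d) -(@derive_val _ _ _ _ _ _ _ d').
Qed.

Lemma hasder_continuous f x l : hasder f x l ->
  {for (x : K^o), continuous (f : K^o -> K^o)}.
Proof.
move=> /hasderP d; apply: differentiable_continuous; apply/derivable1_diffP.
exact: ex_derive.
Qed.

Lemma hasder_cst c x : hasder (fun=> c) x 0.
Proof.
by exists (fun=> 0) => [y|]; rewrite ?subrr ?mul0r //; split=> //; exact: cst_continuous.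
Qed.

Lemma hasder_id x : hasder (fun y => y) x 1.
Proof. by exists (fun=> 1) => [y|]; rewrite ?mul1r //; split=> //; exact: cst_continuous. Qed.

Lemma hasderD f g x l l' : hasder f x l -> hasder g x l' ->
  hasder (fun y => f y + g y) x (l + l').
Proof.
move=> [q fE [cq <-]] [r gE [cr <-]]; exists (fun y => q y + r y).
  by move=> y; rewrite opprD addrACA fE gE mulrDl.
by split=> //; apply: (cvgD cq cr).
Qed.

Lemma hasderM f g x l l' : hasder f x l -> hasder g x l' ->
  hasder (fun y => f y * g y) x (l * g x + f x * l').
Proof.
move=> df dg; have cg := hasder_continuous dg.
move: df dg => [q fE [cq <-]] [r gE [cr <-]].
exists (fun y => q y * g y + f x * r y).
  by move=> y; rewrite mulrDl -(mulrA (f x)) -gE (mulrAC (q y)) -fE; ring.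
split=> //; apply: (cvgD (cvgM cq cg) (cvgM _ cr)); exact: cst_continuous.
Qed.

Lemma hasder_comp f g x l l' : hasder f (g x) l -> hasder g x l' ->
  hasder (fun y => f (g y)) x (l * l').
Proof.
move=> [q fE [cq <-]] dg; have cg := hasder_continuous dg.
move: dg => [r gE [cr <-]]; exists (fun y => q (g y) * r y).
  by move=> y; rewrite fE gE mulrA.
by split=> //; apply: (cvgM (@continuous_comp K^o K^o K^o g q x cg cq) cr).
Qed.

Lemma hasderV f x l : f x != 0 -> hasder f x l ->
  hasder (fun y => (f y)^-1) x (- (f x) ^- 2 * l).
Proof.
move=> fx0 /hasderP [df dE]; apply/hasderP; rewrite -dE.
apply: DeriveDef; first exact: (derivableV (f := f : K^o -> K^o)).
exact: (deriveV (f := f : K^o -> K^o)).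
Qed.

Lemma hasder_eq f g x l l' : (forall y, f y = g y) -> l = l' -> hasder f x l ->
  hasder g x l'.
Proof. by move=> /funext -> ->. Qed.

Lemma hasderN f x l : hasder f x l -> hasder (fun y => - f y) x (- l).
Proof.
move=> [q fE [cq <-]]; exists (fun y => - q y).
  by move=> y; rewrite mulNr -fE opprD.
by split=> //; apply: (cvgN cq).
Qed.

Lemma hasderB f g x l l' : hasder f x l -> hasder g x l' ->
  hasder (fun y => f y - g y) x (l - l').
Proof. by move=> df dg; apply: hasderD df (hasderN dg). Qed.

Lemma hasderZ c f x l : hasder f x l -> hasder (fun y => c * f y) x (c * l).
Proof.
move=> df; apply: hasder_eq (hasderM (hasder_cst c x) df) => //.
by rewrite mul0r add0r.
Qed.

End Caratheodory.

(** * The modulus, and complex derivatives along real lines *)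

Section ComplexNorm.
Variable R : realType.
Local Notation C := R[i].
Local Notation Re := (@complex.Re R).
Local Notation Im := (@complex.Im R).
Implicit Types (z w : C) (x y : R).

Lemma normcB z w : normc (z - w) <= normc z + normc w.
Proof. by rewrite (le_trans (le_normcD _ _))// normcN. Qed.

Lemma normc_ge0 z : 0 <= normc z.
Proof. by rewrite /normc; case: z => a b; exact: sqrtr_ge0. Qed.

Lemma normc_eq0 z : (normc z == 0) = (z == 0).
Proof. by apply/eqP/eqP => [/eq0_normc|->] //; rewrite normc0. Qed.

Lemma normc_gt0 z : (0 < normc z) = (z != 0).
Proof. by rewrite lt_def normc_ge0 andbT normc_eq0. Qed.

Lemma norm_normc z : `|z| = (normc z)%:C.
Proof. by rewrite normc_def; case: z. Qed.

Lemma normc_real x : normc x%:C = `|x|.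
Proof. by rewrite /normc /= expr0n /= addr0 sqrtr_sqr. Qed.

Lemma normc_distC z w : normc (z - w) = normc (w - z).
Proof. by rewrite -opprB normcN. Qed.

Lemma normcX z n : normc (z ^+ n) = normc z ^+ n.
Proof. by elim: n => [|n IH]; rewrite ?normc1 // !exprS normcM IH. Qed.

Lemma normc_sqr z : normc z ^+ 2 = Re z ^+ 2 + Im z ^+ 2.
Proof. by case: z => a b; rewrite /normc sqr_sqrtr // addr_ge0 // sqr_ge0. Qed.

Lemma Re_le_normc z : `|Re z| <= normc z.
Proof.
by rewrite -(ler_pXn2r (n := 2)) ?nnegrE ?normc_ge0 // normc_sqr
  real_normK ?num_real // lerDl sqr_ge0.
Qed.

Lemma Im_le_normc z : `|Im z| <= normc z.
Proof.
by rewrite -(ler_pXn2r (n := 2)) ?nnegrE ?normc_ge0 // normc_sqr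
  real_normK ?num_real // lerDr sqr_ge0.
Qed.

Lemma normc_le_ReIm z : normc z <= `|Re z| + `|Im z|.
Proof.
rewrite -(ler_pXn2r (n := 2)) ?nnegrE ?normc_ge0 ?addr_ge0 // normc_sqr.
rewrite sqrrD !real_normK ?num_real // addrAC lerDl.
by rewrite mulrn_wge0 // mulr_ge0.
Qed.

Lemma normc_triangle u z w : normc (z - w) <= normc (z - u) + normc (u - w).
Proof. by rewrite -(subrKA u) le_normcD. Qed.

Lemma normc_dist_le z w : `|normc z - normc w| <= normc (z - w).
Proof.
rewrite ler_norml; apply/andP; split.
  by have := le_normcD (w - z) z; rewrite subrK normc_distC; lra.
by have := le_normcD (z - w) w; rewrite subrK; lra.
Qed.

Lemma ReD z w : Re (z + w) = Re z + Re w. Proof. by case: z; case: w. Qed.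
Lemma ImD z w : Im (z + w) = Im z + Im w. Proof. by case: z; case: w. Qed.
Lemma ReN z : Re (- z) = - Re z. Proof. by case: z. Qed.
Lemma ImN z : Im (- z) = - Im z. Proof. by case: z. Qed.
Lemma ReM z w : Re (z * w) = Re z * Re w - Im z * Im w.
Proof. by case: z; case: w. Qed.
Lemma ImM z w : Im (z * w) = Re z * Im w + Im z * Re w.
Proof. by case: z => a b; case: w => c d /=; rewrite /= addrC (mulrC b). Qed.
Lemma ReMl x z : Re (x%:C * z) = x * Re z.
Proof. by rewrite ReM /= mul0r subr0. Qed.
Lemma ImMl x z : Im (x%:C * z) = x * Im z.
Proof. by rewrite ImM /= mul0r addr0. Qed.

Lemma complex_eq z w : Re z = Re w -> Im z = Im w -> z = w.
Proof. by case: z => a b; case: w => c d /= -> ->. Qed.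

(** Balls of [C^o] have their radius in [C]; a positive element of [R[i]] is real, so real radii
    describe the same topology. *)
Lemma continuous_normcP (q : C -> C) z :
  {for (z : C^o), continuous (q : C^o -> C^o)} <->
  (forall e : R, 0 < e -> exists2 d : R, 0 < d &
     forall w, normc (w - z) < d -> normc (q w - q z) < e).
Proof.
split=> [/cvgrPdist_lt cq e e0|H].
  have e0' : 0 < e%:C by rewrite ltcR.
  have /nbhs_ballP[d /= d0 dP] := cq _ e0'.
  exists (complex.Re d); first by move: d0; rewrite ltcE => /andP[].
  move=> w wz; have := dP w; rewrite /ball /= distrC !norm_normc.
  have -> : d = (complex.Re d)%:C.
    by move: d0; rewrite ltcE => /andP[/eqP /= d0 _]; case: (d) d0 => a b /= ->.
  by rewrite !ltcR normc_distC => ->.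
apply/(@cvgrPdist_lt C C^o C^o (nbhs (z : C^o)) (nbhs_filter (z : C^o))) => e e0.
have eE : e = (complex.Re e)%:C.
  by move: e0; rewrite ltcE => /andP[/eqP /= e0 _]; case: (e) e0 => a b /= ->.
have [|d d0 dP] := H (complex.Re e); first by move: e0; rewrite eE ltcR.
apply/nbhs_ballP; exists d%:C => /=; first by rewrite ltcR.
move=> w; rewrite /ball /= !norm_normc ltcR => wz.
by rewrite eE ltcR normc_distC dP // normc_distC.
Qed.

Lemma hasder_normcP (f : C -> C) z l :
  hasder f z l <->
  (forall e : R, 0 < e -> exists2 d : R, 0 < d &
     forall w, normc (w - z) < d ->
       normc (f w - f z - l * (w - z)) <= e * normc (w - z)).
Proof.
split=> [[q fE [/continuous_normcP cq <-]] e e0|H].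
  have [d d0 dP] := cq _ e0; exists d => // w wz.
  by rewrite fE -mulrBl normcM ler_wpM2r ?normc_ge0 // ltW // dP.
exists (fun w : C => if w == z then l else (f w - f z) / (w - z)).
  move=> w; case: eqP => [->|/eqP]; first by rewrite !subrr mulr0.
  by rewrite -subr_eq0 => /divfK ->.
split; last by rewrite eqxx.
apply/continuous_normcP => e e0; rewrite eqxx.
have [|d d0 dP] := H (e / 2); first by rewrite divr_gt0.
exists d => // w wz; case: eqP => [|/eqP wz0]; first by rewrite subrr normc0.
have wz1 : w - z != 0 by rewrite subr_eq0.
have -> : (f w - f z) / (w - z) - l = (f w - f z - l * (w - z)) / (w - z).
  by rewrite [RHS]mulrBl mulfK.
rewrite normcM normcV; apply: (@le_lt_trans _ _ (e / 2)); last by lra.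
by rewrite ler_pdivrMr ?normc_gt0 // dP.
Qed.

Lemma entireP (f : C -> C) : entire f <-> forall z, hasder f z (cderiv f z).
Proof.
have E (h : C -> C) z : derive1 (h : C^o -> C^o) z = 'D_1 (h : C^o -> C^o) z.
  by rewrite derive1E.
split=> H z.
  by apply/hasderP; rewrite /cderiv E; apply: DeriveDef.
by have /hasderP [] := H z.
Qed.

Lemma hasder_entire (f df : C -> C) : (forall z, hasder f z (df z)) ->
  entire f /\ cderiv f = df.
Proof.
move=> H; have ef : entire f by move=> z; have /hasderP [] := H z.
by split=> //; apply/funext => z; exact: hasder_unique ((entireP f).1 ef z) (H z).
Qed.

Lemma hasder_Re_path (f : C -> C) p v x l : hasder f (p + x%:C * v) l ->
  hasder (fun t : R => Re (f (p + t%:C * v))) x (Re (l * v)).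
Proof.
move=> [q fE [/continuous_normcP cq <-]].
exists (fun t => Re (q (p + t%:C * v) * v)).
  move=> t; rewrite -ReN -ReD fE opprD addrACA subrr add0r -mulrBl.
  by rewrite -rmorphB /= mulrCA ReMl mulrC.
split=> //; apply/cvgrPdist_lt => e e0.
(* Dividing by [normc v + 1] instead of [normc v] covers the direction [v = 0]. *)
have e1 : 0 < e / (normc v + 1) by rewrite divr_gt0 // ltr_wpDl ?normc_ge0.
have [d d0 dP] := cq _ e1.
have d1 : 0 < d / (normc v + 1) by rewrite divr_gt0 // ltr_wpDl ?normc_ge0.
apply/nbhs_ballP; exists (d / (normc v + 1)) => // t /=.
rewrite /ball /= distrC => xt.
rewrite distrC -ReN -ReD -mulrBl (le_lt_trans (Re_le_normc _)) // normcM.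
have v1 : 0 < normc v + 1 by rewrite ltr_wpDl ?normc_ge0.
have qt : normc (q (p + t%:C * v) - q (p + x%:C * v)) < e / (normc v + 1).
  apply: dP; rewrite opprD addrACA subrr add0r -mulrBl -rmorphB normcM normc_real.
  move: xt; rewrite ltr_pdivlMr // => xt; apply: le_lt_trans xt.
  by rewrite ler_wpM2l // lerDl.
move: qt; rewrite ltr_pdivlMr // => qt; apply: le_lt_trans qt.
by rewrite ler_wpM2l ?normc_ge0 // lerDl.
Qed.

Lemma Im_Re z : Im z = Re (- 'i * z).
Proof. by case: z => a b /=; rewrite oppr0 mul0r sub0r mulN1r opprK. Qed.

Lemma hasder_Im_path (f : C -> C) p v x l : hasder f (p + x%:C * v) l ->
  hasder (fun t : R => Im (f (p + t%:C * v))) x (Im (l * v)).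
Proof.
move=> df; have := @hasder_Re_path (fun z => - 'i * f z) p v x (- 'i * l) (hasderZ _ df).
by apply: hasder_eq => [y|]; rewrite ?Im_Re ?mulrA.
Qed.

Lemma real_mvt_bound (u du : R -> R) a b M : a <= b ->
  (forall x, hasder u x (du x)) -> (forall x, a <= x <= b -> `|du x| <= M) ->
  `|u b - u a| <= M * (b - a).
Proof.
move=> ab Hu HM.
have [||c cab ->] := @MVT_segment R u du a b ab.
- by move=> x _; apply/hasderP.
- apply: continuous_subspaceT => x; exact: hasder_continuous (Hu x).
rewrite normrM (ger0_norm (_ : 0 <= b - a)) ?subr_ge0 // ler_wpM2r ?subr_ge0 //.
by apply: HM; move: cab; rewrite in_itv.
Qed.

(* The factor 2 comes from treating real and imaginary parts separately. *)
Lemma normc_mvt (f df : C -> C) z w M :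
  (forall u, hasder f u (df u)) ->
  (forall t : R, 0 <= t <= 1 -> normc (df (z + t%:C * (w - z))) <= M) ->
  normc (f w - f z) <= 2 * M * normc (w - z).
Proof.
move=> Hf HM; set v := w - z.
have bd t : 0 <= t <= 1 -> normc (df (z + t%:C * v) * v) <= M * normc v.
  by move=> t01; rewrite normcM ler_wpM2r ?normc_ge0 // HM.
have pw : z + 1%:C * v = w by rewrite mul1r addrC subrK.
have pz : z + 0%:C * v = z by rewrite mul0r addr0.
rewrite (le_trans (normc_le_ReIm _)) // -mulrA mulr_natl mulr2n lerD //.
  have := @real_mvt_bound (fun t => Re (f (z + t%:C * v)))
    (fun t => Re (df (z + t%:C * v) * v)) 0 1 (M * normc v) ler01.
  rewrite pw pz subr0 mulr1 -ReN -ReD; apply=> [t|t t01].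
    exact: hasder_Re_path.
  by rewrite (le_trans (Re_le_normc _)) // bd.
have := @real_mvt_bound (fun t => Im (f (z + t%:C * v)))
  (fun t => Im (df (z + t%:C * v) * v)) 0 1 (M * normc v) ler01.
rewrite pw pz subr0 mulr1 -ImN -ImD; apply=> [t|t t01].
  exact: hasder_Im_path.
by rewrite (le_trans (Im_le_normc _)) // bd.
Qed.

Lemma hasder0_cst (f : C -> C) : (forall z, hasder f z 0) -> forall z, f z = f 0.
Proof.
move=> Hf z; apply/eqP; rewrite -subr_eq0 -normc_eq0 eq_le normc_ge0 andbT.
have := @normc_mvt f (fun=> 0) 0 z 0 Hf; rewrite mulr0 mul0r; apply=> t _.
by rewrite normc0.
Qed.

End ComplexNorm.

(** * Integrals of continuous real functions over a segment *)

Section RealIntegral.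
Variable R : realType.
Implicit Types (u v U : R -> R) (a b c : R).

Lemma continuous_mull k v : continuous v -> continuous (fun t => k * v t).
Proof. by move=> cv x; exact: (continuousM (@cst_continuous _ _ k _) (cv x)). Qed.

Definition rint v a b := \int[lebesgue_measure]_(t in `[a, b]%classic) v t.

Lemma rint_integrable v a b : continuous v ->
  lebesgue_measure.-integrable `[a, b]%classic (EFin \o v).
Proof.
move=> cv; apply: continuous_compact_integrable; first exact: segment_compact.
exact: continuous_subspaceT.
Qed.

Lemma rintD u v a b : continuous u -> continuous v ->
  rint (fun t => u t + v t) a b = rint u a b + rint v a b.
Proof. by move=> cu cv; rewrite /rint RintegralD //; exact: rint_integrable. Qed.

Lemma rintZ k v a b : continuous v -> rint (fun t => k * v t) a b = k * rint v a b.
Proof. by move=> cv; rewrite /rint RintegralZl //; exact: rint_integrable. Qed.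

Lemma rint_eq u v a b : (forall t, a <= t <= b -> u t = v t) -> rint u a b = rint v a b.
Proof. by move=> E; apply: eq_Rintegral => t; rewrite inE /= in_itv; exact: E. Qed.

Lemma rint_cst k a b : a <= b -> rint (fun=> k) a b = k * (b - a).
Proof.
move=> ab; rewrite /rint Rintegral_cst; last exact: measurable_itv.
have e : lebesgue_measure `[a, b]%classic = (b - a)%:E :> \bar R.
  rewrite lebesgue_measure_itv /= lte_fin.
  by case: ltgtP ab => // -> _; rewrite subrr.
congr (_ * _); exact: (congr1 fine e).
Qed.

Lemma rint_le u v a b : continuous u -> continuous v ->
  (forall t, a <= t <= b -> u t <= v t) -> rint u a b <= rint v a b.
Proof.
move=> cu cv H; apply: le_Rintegral; [exact: measurable_itv|exact: rint_integrable..|].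
by move=> t; rewrite /= in_itv; exact: H.
Qed.

Lemma rint_bound v a b M : continuous v -> a <= b ->
  (forall t, a <= t <= b -> `|v t| <= M) -> `|rint v a b| <= M * (b - a).
Proof.
move=> cv ab H; rewrite ler_norml -mulNr -!rint_cst //; apply/andP; split.
  apply: rint_le => // [|t /H]; first exact: cst_continuous.
  by rewrite ler_norml => /andP[].
apply: rint_le => // [|t /H]; first exact: cst_continuous.
by rewrite ler_norml => /andP[].
Qed.

Lemma rint_cat v a b c : continuous v -> a <= b -> b <= c ->
  rint v a c = rint v a b + rint v b c.
Proof.
move=> cv ab bc; rewrite /rint.
have iac := rint_integrable a c cv.
have ibc : lebesgue_measure.-integrable `]b, c]%classic (EFin \o v).
  apply: (integrableS _ _ _ iac); [exact: measurable_itv..|].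
  by move=> x /=; rewrite !in_itv /= => /andP[bx ->]; rewrite (le_trans ab (ltW bx)).
(* The two closed segments share [b]; it is dropped from the second one, being a null set. *)
rewrite -(Rintegral_itv_obnd_cbnd ibc) -(Rintegral_itvB iac) ?bnd_simp //.
by rewrite addrC subrK.
Qed.

Lemma rint_FTC U v a b : a <= b -> continuous v -> (forall t, hasder U t (v t)) ->
  rint v a b = U b - U a.
Proof.
rewrite le_eqVlt => /orP[/eqP <-|ab] cv dU.
  by rewrite /rint set_itv1 Rintegral_set1 subrr.
have cU : continuous U by move=> t; exact: hasder_continuous (dU t).
rewrite /rint /Rintegral (@continuous_FTC2 _ v U) ?fine_EFin //.
- exact: continuous_subspaceT.
- split=> [t _||]; first by have /hasderP [] := dU t.
  + by apply: cvg_at_right_filter; exact: cU.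
  + by apply: cvg_at_left_filter; exact: cU.
- move=> t _; rewrite derive1E; have /hasderP d := dU t.
  exact: derive_val.
Qed.

End RealIntegral.

(** * Componentwise integrals of complex functions of a real variable *)

Section ComplexIntegral.
Variable R : realType.
Local Notation C := R[i].
Local Notation Re := (@complex.Re R).
Local Notation Im := (@complex.Im R).
Implicit Types (u v : R -> C) (a b c : R).

(** Continuity is asked of the components because [cint] is a pair of real integrals; [ccont_path]
    derives it from continuity on the plane. *)
Definition ccont u := continuous (Re \o u) /\ continuous (Im \o u).

Definition cint u a b : C := rint (Re \o u) a b +i* rint (Im \o u) a b.

Definition pcontinuous (h : C -> C) := forall z : C^o, {for z, continuous (h : C^o -> C^o)}.

Lemma ccont_path (h : C -> C) (p v : C) : pcontinuous h -> ccont (fun t => h (p + t%:C * v)).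
Proof.
move=> ch; suff H (e x : R) : 0 < e -> \forall t \near x,
    normc (h (p + t%:C * v) - h (p + x%:C * v)) < e.
  split=> x; apply/cvgrPdist_lt => e /H he; near=> t; rewrite distrC /=.
    rewrite -ReN -ReD (le_lt_trans (Re_le_normc _)) //; near: t; exact: he.
  rewrite -ImN -ImD (le_lt_trans (Im_le_normc _)) //; near: t; exact: he.
move=> e0; have /continuous_normcP /(_ _ e0)[d d0 dP] := ch (p + x%:C * v).
have v1 : 0 < normc v + 1 by rewrite ltr_wpDl ?normc_ge0.
apply/nbhs_ballP; exists (d / (normc v + 1)) => /=; first by rewrite divr_gt0.
move=> t; rewrite /ball /= distrC => xt.
apply: dP; rewrite opprD addrACA subrr add0r -mulrBl -rmorphB normcM normc_real.
move: xt; rewrite ltr_pdivlMr // => xt; apply: le_lt_trans xt.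
by rewrite ler_wpM2l // lerDl.
Unshelve. all: by end_near. Qed.

Lemma ccont_cst k : ccont (fun=> k).
Proof. by split; exact: cst_continuous. Qed.

Lemma ccontD u v : ccont u -> ccont v -> ccont (fun t => u t + v t).
Proof.
move=> [cu du] [cv dv]; split=> x.
  have -> : Re \o (fun t => u t + v t) = (Re \o u) \+ (Re \o v).
    by apply/funext => t /=; rewrite ReD.
  by apply: continuousD; [exact: cu|exact: cv].
have -> : Im \o (fun t => u t + v t) = (Im \o u) \+ (Im \o v).
  by apply/funext => t /=; rewrite ImD.
by apply: continuousD; [exact: du|exact: dv].
Qed.

Lemma ccontM u v : ccont u -> ccont v -> ccont (fun t => u t * v t).
Proof.
move=> [cu du] [cv dv]; split=> x.
  have -> : Re \o (fun t => u t * v t) =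
      (Re \o u) \* (Re \o v) \- (Im \o u) \* (Im \o v).
    by apply/funext => t /=; rewrite ReM.
  apply: continuousB; apply: continuousM;
    [exact: cu|exact: cv|exact: du|exact: dv].
have -> : Im \o (fun t => u t * v t) =
    (Re \o u) \* (Im \o v) \+ (Im \o u) \* (Re \o v).
  by apply/funext => t /=; rewrite ImM.
apply: continuousD; apply: continuousM;
  [exact: cu|exact: dv|exact: du|exact: cv].
Qed.

Lemma ccont_real (r : R -> R) : continuous r -> ccont (fun t => (r t)%:C).
Proof. by move=> cr; split; [exact: cr|exact: cst_continuous]. Qed.

Lemma cint_eq u v a b : (forall t, a <= t <= b -> u t = v t) -> cint u a b = cint v a b.
Proof. by move=> E; rewrite /cint; congr (_ +i* _); apply: rint_eq => t /E /= ->. Qed.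

Lemma cintD u v a b : ccont u -> ccont v ->
  cint (fun t => u t + v t) a b = cint u a b + cint v a b.
Proof.
move=> [cu du] [cv dv]; rewrite /cint; apply: complex_eq => /=; rewrite -rintD //.
  by apply: rint_eq => t _ /=; rewrite ReD.
by apply: rint_eq => t _ /=; rewrite ImD.
Qed.

Lemma cintZ k u a b : ccont u -> cint (fun t => k * u t) a b = k * cint u a b.
Proof.
move=> [cu du]; rewrite /cint; apply: complex_eq; rewrite ?ReM ?ImM /=.
  rewrite -mulNr -!rintZ // -rintD.
  - by apply: rint_eq => t _ /=; rewrite ReM mulNr.
  - exact: continuous_mull cu.
  - exact: continuous_mull du.
rewrite -!rintZ // -rintD.
- by apply: rint_eq => t _ /=; rewrite ImM.
- exact: continuous_mull du.
- exact: continuous_mull cu.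
Qed.

Lemma cintB u v a b : ccont u -> ccont v ->
  cint (fun t => u t - v t) a b = cint u a b - cint v a b.
Proof.
move=> cu cv; rewrite -[- cint v a b]mulN1r -cintZ // -cintD //.
  by apply: cint_eq => t _; rewrite mulN1r.
by apply: ccontM => //; exact: ccont_cst.
Qed.

Lemma cint_bound u a b M : ccont u -> a <= b ->
  (forall t, a <= t <= b -> normc (u t) <= M) -> normc (cint u a b) <= 2 * M * (b - a).
Proof.
move=> [cu du] ab H; rewrite (le_trans (normc_le_ReIm _)) // -mulrA mulr_natl mulr2n.
rewrite lerD //= rint_bound // => t /H; apply: le_trans; first exact: Re_le_normc.
exact: Im_le_normc.
Qed.

Lemma cint_cat u a b c : ccont u -> a <= b -> b <= c ->
  cint u a c = cint u a b + cint u b c.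
Proof.
move=> [cu du] ab bc; apply: complex_eq; rewrite ?ReD ?ImD /=; exact: rint_cat.
Qed.

Lemma cint_FTC (F f : C -> C) (p v : C) a b : a <= b -> pcontinuous f ->
  (forall z, hasder F z (f z)) ->
  cint (fun t => f (p + t%:C * v) * v) a b = F (p + b%:C * v) - F (p + a%:C * v).
Proof.
move=> ab cf dF.
have [cu du] := ccontM (ccont_path p v cf) (ccont_cst v).
apply: complex_eq; rewrite ?ReD ?ImD ?ReN ?ImN /=.
  by apply: (@rint_FTC _ (fun t => Re (F (p + t%:C * v)))) => // t; exact: hasder_Re_path.
by apply: (@rint_FTC _ (fun t => Im (F (p + t%:C * v)))) => // t; exact: hasder_Im_path.
Qed.

Lemma seg_integral_cint (F : C -> C) z :
  seg_integral F z = cint (fun t => F (t%:C * z) * z) 0 1.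
Proof. by []. Qed.

End ComplexIntegral.

(** * Rectangles and bisection *)

Section RectangleInduction.
Variable R : realType.

Record rect := Rect { rl : R; rr : R; rb : R; rt : R }.

Definition wf_rect r := (rl r <= rr r) && (rb r <= rt r).

Definition subrect r r' :=
  [&& rl r <= rl r', rr r' <= rr r, rb r <= rb r' & rt r' <= rt r].

Definition rsize r := rr r - rl r + (rt r - rb r).

Definition in_rect r (z : R[i]) := (rl r <= complex.Re z <= rr r) && (rb r <= complex.Im z <= rt r).

Definition quarters r : seq rect :=
  let x := (rl r + rr r) / 2 in let y := (rb r + rt r) / 2 in
  [:: Rect (rl r) x (rb r) y; Rect x (rr r) (rb r) y;
      Rect (rl r) x y (rt r); Rect x (rr r) y (rt r)].

Lemma nested_intervals (a b : nat -> R) :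
  (forall n, a n <= b n) -> (forall n, a n <= a n.+1) -> (forall n, b n.+1 <= b n) ->
  exists x, forall n, a n <= x <= b n.
Proof.
move=> ab am bm.
have am' : {homo a : i j / (i <= j)%N >-> i <= j} by apply: homo_leq => // ? ? ?; exact: le_trans.
have bm' : {homo b : i j / (i <= j)%N >-> j <= i}.
  by apply: homo_leq => // y x z xy yz; exact: le_trans yz xy.
have abmn i j : a i <= b j.
  rewrite (le_trans (am' _ _ (leq_maxl i j))) // (le_trans (ab _)) //.
  by rewrite bm' // leq_maxr.
exists (sup (range a)) => n; apply/andP; split.
  by apply: sup_upper_bound; [split; [exists (a 0%N); exists 0%N|exists (b 0%N) => _ [i _ <-]]|exists n].
by apply: ge_sup; [exists (a 0%N); exists 0%N|move=> _ [i _ <-]].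
Qed.

Lemma halving_lt (L d : R) : 0 < d -> exists n, L / 2 ^+ n < d.
Proof.
move=> d0; have [n Ln] : exists n : nat, `|L| / d < n%:R.
  by exists (Num.bound (`|L| / d)); apply: archi_boundP; rewrite divr_ge0 // ltW.
exists n; rewrite ltr_pdivrMr ?exprn_gt0 // mulrC -ltr_pdivrMr //.
apply: (@le_lt_trans _ _ (`|L| / d)); first by rewrite ler_pM2r ?invr_gt0 ?ler_norm.
by rewrite (lt_le_trans Ln) // -natrX ler_nat ltnW // ltn_expl.
Qed.

(* Bisection: a property that passes from the quarters of a rectangle to the
   rectangle holds as soon as it holds for small rectangles around each point. *)
Lemma rect_bisection (P : rect -> Prop) r0 : wf_rect r0 ->
  (forall r, wf_rect r -> (forall r', List.In r' (quarters r) -> P r') -> P r) ->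
  (forall p, in_rect r0 p -> exists2 d : R, 0 < d &
     forall r, wf_rect r -> subrect r0 r -> in_rect r p -> rsize r < d -> P r) ->
  P r0.
Proof.
move=> wf0 Pq Ploc; apply: contrapT => nP0.
have step r : wf_rect r -> ~ P r -> exists r', List.In r' (quarters r) /\ ~ P r'.
  move=> wfr nPr; apply: contrapT => nex; apply: nPr; apply: Pq => // r' r'q.
  by apply: contrapT => nPr'; apply: nex; exists r'.
have /choice[F FP] : forall r, exists r', wf_rect r -> ~ P r ->
    List.In r' (quarters r) /\ ~ P r'.
  move=> r; have [[wfr nPr]|/not_andP nP] := pselect (wf_rect r /\ ~ P r).
    by have [r' ?] := step _ wfr nPr; exists r'.
  by exists r => wfr nPr; case: nP.
pose s n := iter n F r0.
have quarterP r r' : wf_rect r -> List.In r' (quarters r) ->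
    [/\ wf_rect r', subrect r r' & rsize r' = rsize r / 2].
  case: r => a b c d; rewrite /wf_rect /subrect /rsize /= => /andP[ab cd].
  by move=> [<-|[<-|[<-|[<-|//]]]] /=; split; lra.
have sP n : wf_rect (s n) /\ ~ P (s n).
  elim: n => [//|n [wfn nPn]].
  have [qn nPF] := FP _ wfn nPn.
  by split=> //; have [] := quarterP _ _ wfn qn.
have sS n : subrect (s n) (s n.+1) /\ rsize (s n.+1) = rsize (s n) / 2.
  have [wfn nPn] := sP n.
  have [qn _] := FP _ wfn nPn.
  by have [] := quarterP _ _ wfn qn.
have [x xP] : exists x, forall n, rl (s n) <= x <= rr (s n).
  apply: nested_intervals => n; first by have [/andP[]] := sP n.
    by have [/and4P[]] := sS n.
  by have [/and4P[]] := sS n.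
have [y yP] : exists y, forall n, rb (s n) <= y <= rt (s n).
  apply: nested_intervals => n; first by have [/andP[]] := sP n.
    by have [/and4P[]] := sS n.
  by have [/and4P[]] := sS n.
have inn n : in_rect (s n) (x +i* y) by rewrite /in_rect /= xP yP.
have sub0 n : subrect r0 (s n).
  elim: n => [|n]; first by rewrite /subrect !lexx.
  have [/and4P[a b c d] _] := sS n; move=> /and4P[a' b' c' d'].
  by apply/and4P; split; [exact: le_trans a' a|exact: le_trans b b'|exact: le_trans c' c|exact: le_trans d d'].
have szn n : rsize (s n) = rsize r0 / 2 ^+ n.
  elim: n => [|n IH]; first by rewrite expr0 divr1.
  by rewrite (sS n).2 IH exprSr invfM mulrA.
have [d d0 dP] := Ploc _ (inn 0%N).
have [n nd] := halving_lt (rsize r0) d0.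
by have [wfn] := sP n; apply; apply: dP => //; rewrite szn.
Qed.

End RectangleInduction.

(** * Contour integrals over rectangles and Goursat's theorem *)

Section Goursat.
Variable R : realType.
Local Notation C := R[i].
Local Notation Re := (@complex.Re R).
Local Notation Im := (@complex.Im R).

(** Both lines have the shape [p + t%:C * v], with [v] equal to [1] or ['i], to which [ccont_path]
    and [cint_FTC] apply. *)
Definition hline (y t : R) : C := y%:C * 'i + t%:C * 1.
Definition vline (x t : R) : C := x%:C * 1 + t%:C * 'i.

Lemma Re_hline y t : Re (hline y t) = t.
Proof. by rewrite /hline /=; ring. Qed.
Lemma Im_hline y t : Im (hline y t) = y.
Proof. by rewrite /hline /=; ring. Qed.
Lemma Re_vline x t : Re (vline x t) = x.
Proof. by rewrite /vline /=; ring. Qed.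
Lemma Im_vline x t : Im (vline x t) = t.
Proof. by rewrite /vline /=; ring. Qed.
Lemma hline_vline x y : hline y x = vline x y.
Proof. by rewrite /hline addrC. Qed.

(** The contour runs counterclockwise; the factor [* 1] keeps the horizontal sides in the form
    [f (p + t v) * v]. *)
Definition rectint (f : C -> C) (r : rect R) : C :=
  cint (fun t => f (hline (rb r) t) * 1) (rl r) (rr r) -
  cint (fun t => f (hline (rt r) t) * 1) (rl r) (rr r) +
  (cint (fun t => f (vline (rr r) t) * 'i) (rb r) (rt r) -
   cint (fun t => f (vline (rl r) t) * 'i) (rb r) (rt r)).

Lemma ccont_hline f y : pcontinuous f -> ccont (fun t => f (hline y t) * 1).
Proof. by move=> cf; apply: ccontM; [exact: ccont_path|exact: ccont_cst]. Qed.

Lemma ccont_vline f x : pcontinuous f -> ccont (fun t => f (vline x t) * 'i).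
Proof. by move=> cf; apply: ccontM; [exact: ccont_path|exact: ccont_cst]. Qed.

Lemma rectint_primitive F f r : wf_rect r -> pcontinuous f ->
  (forall z, hasder F z (f z)) -> rectint f r = 0.
Proof.
move=> /andP[lr bt] cf dF; rewrite /rectint.
rewrite !(cint_FTC _ _ _ cf dF) // -!/(hline _ _) -!/(vline _ _) !hline_vline.
ring.
Qed.

#[local] Opaque hline vline.
#[local] Arguments rectint : simpl never.

Ltac ring_cint := repeat match goal with |- context [cint ?u ?a ?b] =>
  generalize (cint u a b); intro end; ring.

(** Only boundary values enter, so a singular integrand may be replaced by a continuous one that
    agrees with it on the sides. *)
Lemma rectint_eq f g r :
  (forall z, in_rect r z -> (Re z == rl r) || (Re z == rr r) ||
     ((Im z == rb r) || (Im z == rt r)) -> f z = g z) ->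
  wf_rect r -> rectint f r = rectint g r.
Proof.
move=> E /andP[lr bt]; congr (_ - _ + (_ - _)); apply: cint_eq => t tP;
  rewrite E // /in_rect ?Re_hline ?Im_hline ?Re_vline ?Im_vline ?tP ?lexx ?eqxx
    ?lr ?bt ?orbT //.
Qed.

Lemma rectintD f g r : pcontinuous f -> pcontinuous g ->
  rectint (fun z => f z + g z) r = rectint f r + rectint g r.
Proof.
move=> cf cg; rewrite /rectint; cbv beta.
have hD y : cint (fun t => (f (hline y t) + g (hline y t)) * 1) (rl r) (rr r) =
    cint (fun t => f (hline y t) * 1) (rl r) (rr r) +
    cint (fun t => g (hline y t) * 1) (rl r) (rr r).
  rewrite -(cintD _ _ (ccont_hline y cf) (ccont_hline y cg)).
  by apply: cint_eq => t _; rewrite mulrDl.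
have vD x : cint (fun t => (f (vline x t) + g (vline x t)) * 'i) (rb r) (rt r) =
    cint (fun t => f (vline x t) * 'i) (rb r) (rt r) +
    cint (fun t => g (vline x t) * 'i) (rb r) (rt r).
  rewrite -(cintD _ _ (ccont_vline x cf) (ccont_vline x cg)).
  by apply: cint_eq => t _; rewrite mulrDl.
rewrite 2!hD 2!vD; ring_cint.
Qed.

Lemma rectintZ k f r : pcontinuous f ->
  rectint (fun z => k * f z) r = k * rectint f r.
Proof.
move=> cf; rewrite /rectint; cbv beta.
have hZ y : cint (fun t => k * f (hline y t) * 1) (rl r) (rr r) =
    k * cint (fun t => f (hline y t) * 1) (rl r) (rr r).
  rewrite -(cintZ k _ _ (ccont_hline y cf)).
  by apply: cint_eq => t _; rewrite mulrA.
have vZ x : cint (fun t => k * f (vline x t) * 'i) (rb r) (rt r) =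
    k * cint (fun t => f (vline x t) * 'i) (rb r) (rt r).
  rewrite -(cintZ k _ _ (ccont_vline x cf)).
  by apply: cint_eq => t _; rewrite mulrA.
rewrite 2!hZ 2!vZ; ring_cint.
Qed.

Lemma normc_i : normc ('i : C) = 1.
Proof. by rewrite /normc /= expr0n expr1n /= add0r sqrtr1. Qed.

(* [2 M] on each of the four sides. *)
Lemma rectint_bound f r M : pcontinuous f -> wf_rect r ->
  (forall z, in_rect r z -> (Re z == rl r) || (Re z == rr r) ||
     ((Im z == rb r) || (Im z == rt r)) -> normc (f z) <= M) ->
  normc (rectint f r) <= 4 * M * rsize r.
Proof.
move=> cf /andP[lr bt] H.
have hb y : (y == rb r) || (y == rt r) -> rb r <= y <= rt r ->
    normc (cint (fun t => f (hline y t) * 1) (rl r) (rr r)) <= 2 * M * (rr r - rl r).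
  move=> yP yr; apply: cint_bound => // [|t tP]; first exact: ccont_hline.
  by rewrite mulr1 H // /in_rect ?Re_hline ?Im_hline ?tP ?yr ?yP ?orbT.
have vb x : (x == rl r) || (x == rr r) -> rl r <= x <= rr r ->
    normc (cint (fun t => f (vline x t) * 'i) (rb r) (rt r)) <= 2 * M * (rt r - rb r).
  move=> xP xr; apply: cint_bound => // [|t tP]; first exact: ccont_vline.
  rewrite normcM normc_i mulr1.
  by rewrite H // /in_rect ?Re_vline ?Im_vline ?tP ?xr ?xP ?orbT.
apply: le_trans (le_normcD _ _) _.
apply: (@le_trans _ _ (2 * M * (rr r - rl r) + 2 * M * (rr r - rl r) +
   (2 * M * (rt r - rb r) + 2 * M * (rt r - rb r)))); last by rewrite /rsize; lra.
rewrite lerD // (le_trans (normcB _ _)) // lerD //.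
- by rewrite hb ?eqxx ?lexx ?bt.
- by rewrite hb ?eqxx ?lexx ?bt ?orbT.
- by rewrite vb ?eqxx ?lexx ?lr ?orbT.
- by rewrite vb ?eqxx ?lexx ?lr.
Qed.

Lemma rectint_catx f a b e c d : pcontinuous f -> a <= e <= b ->
  rectint f (Rect a b c d) = rectint f (Rect a e c d) + rectint f (Rect e b c d).
Proof.
move=> cf /andP[ae eb]; rewrite /rectint /=.
rewrite (@cint_cat _ _ a e b) // ?(@cint_cat _ (fun t => f (hline d t) * 1) a e b) //;
  try exact: ccont_hline.
ring_cint.
Qed.

Lemma rectint_caty f a b e c d : pcontinuous f -> c <= e <= d ->
  rectint f (Rect a b c d) = rectint f (Rect a b c e) + rectint f (Rect a b e d).
Proof.
move=> cf /andP[ce ed]; rewrite /rectint /=.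
rewrite (@cint_cat _ (fun t => f (vline b t) * 'i) c e d) //
  ?(@cint_cat _ (fun t => f (vline a t) * 'i) c e d) //;
  try exact: ccont_vline.
ring_cint.
Qed.

Lemma hasder_pcontinuous (f df : C -> C) : (forall z, hasder f z (df z)) -> pcontinuous f.
Proof. by move=> H z; exact: hasder_continuous (H z). Qed.

(** An affine function has a quadratic primitive. This removes the first-order part of [f] in
    Goursat's theorem. *)
Lemma rectint_affine k l p r : wf_rect r -> rectint (fun z => k + l * (z - p)) r = 0.
Proof.
move=> wfr; have dA z : hasder (fun z => k + l * (z - p)) z l.
  apply: hasder_eq (hasderD (hasder_cst k z) (hasderZ l (hasderB (hasder_id z) (hasder_cst p z)))) => //.
  by rewrite add0r subr0 mulr1.
apply: (@rectint_primitive (fun z => k * z + l * 2^-1 * ((z - p) * (z - p)))) => //.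
  exact: hasder_pcontinuous dA.
move=> z; have dB := hasderB (hasder_id z) (hasder_cst p z).
apply: hasder_eq (hasderD (hasderZ k (hasder_id z)) (hasderZ (l * 2^-1) (hasderM dB dB))) => //.
by field.
Qed.

Lemma in_rect_dist (r : rect R) z w : in_rect r z -> in_rect r w -> normc (z - w) <= rsize r.
Proof.
move=> /andP[/andP[a b] /andP[c d]] /andP[/andP[a' b'] /andP[c' d']].
rewrite (le_trans (normc_le_ReIm _)) // ReD ImD ReN ImN lerD // ler_norml; lra.
Qed.

Lemma in_subrect (r r' : rect R) z : subrect r r' -> in_rect r' z -> in_rect r z.
Proof.
move=> /and4P[h1 h2 h3 h4] /andP[/andP[a b] /andP[c d]].
by rewrite /in_rect (le_trans h1 a) (le_trans b h2) (le_trans h3 c) (le_trans d h4).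
Qed.

(* Differentiability is only required relative to the rectangle. *)
Theorem goursat f r0 : pcontinuous f -> wf_rect r0 ->
  (forall p, in_rect r0 p -> exists l, forall e, 0 < e -> exists2 d, 0 < d &
     forall z, in_rect r0 z -> normc (z - p) < d ->
       normc (f z - f p - l * (z - p)) <= e * normc (z - p)) ->
  rectint f r0 = 0.
Proof.
move=> cf wf0 H.
suff K (e : R) : 0 < e -> normc (rectint f r0) <= 4 * e * rsize r0 ^+ 2.
  apply: eq0_normc; apply/eqP; rewrite eq_le normc_ge0 andbT leNgt; apply/negP => n0.
  set N := normc _ in n0; set L := rsize r0 ^+ 2 + 1.
  have L0 : 0 < L by rewrite ltr_wpDl ?sqr_ge0.
  have e0 : 0 < N / (2 * (4 * L)) by rewrite divr_gt0 ?mulr_gt0.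
  have := K _ e0; rewrite -/N.
  have -> : 4 * (N / (2 * (4 * L))) * rsize r0 ^+ 2 = N * (rsize r0 ^+ 2 / L) / 2.
    by field; lra.
  have : rsize r0 ^+ 2 / L <= 1 by rewrite ler_pdivrMr // mul1r lerDl.
  by move=> q1; have := ler_wpM2l (ltW n0) q1; lra.
(* The bound is stable under bisection: a quarter has half the size, so four quarters give
   [4 * (s / 2) ^+ 2 = s ^+ 2]. *)
move=> e0; apply: (@rect_bisection _ (fun r : rect R => normc (rectint f r) <= 4 * e * rsize r ^+ 2) r0) => //.
  move=> [a b c d] /andP[/= ab cd] Q; rewrite /rsize; cbn [rl rr rb rt].
  set x := (a + b) / 2; set y := (c + d) / 2.
  have mx : a <= x <= b by rewrite /x; lra.
  have my : c <= y <= d by rewrite /y; lra.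
  rewrite (rectint_catx c d cf mx) (rectint_caty a x cf my) (rectint_caty x b cf my).
  have q1 : normc (rectint f (Rect a x c y)) <= 4 * e * (x - a + (y - c)) ^+ 2.
    by apply: Q; left.
  have q2 : normc (rectint f (Rect x b c y)) <= 4 * e * (b - x + (y - c)) ^+ 2.
    by apply: Q; right; left.
  have q3 : normc (rectint f (Rect a x y d)) <= 4 * e * (x - a + (d - y)) ^+ 2.
    by apply: Q; right; right; left.
  have q4 : normc (rectint f (Rect x b y d)) <= 4 * e * (b - x + (d - y)) ^+ 2.
    by apply: Q; right; right; right; left.
  rewrite (le_trans (le_normcD _ _)) //.
  have n1 := le_normcD (rectint f (Rect a x c y)) (rectint f (Rect a x y d)).
  have n2 := le_normcD (rectint f (Rect x b c y)) (rectint f (Rect x b y d)).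
  rewrite (le_trans (lerD n1 n2)) //.
  have E1 : x - a = (b - a) / 2 by rewrite /x; field.
  have E2 : b - x = (b - a) / 2 by rewrite /x; field.
  have E3 : y - c = (d - c) / 2 by rewrite /y; field.
  have E4 : d - y = (d - c) / 2 by rewrite /y; field.
  rewrite E1 E2 E3 E4 in q1 q2 q3 q4.
  apply: le_trans (lerD (lerD q1 q3) (lerD q2 q4)) _.
  by rewrite le_eqVlt; apply/orP; left; apply/eqP; field.
(* On a small rectangle containing [p] the affine part integrates to 0, and the remainder is at most
   [e * rsize r] on a contour of length comparable to [rsize r]. *)
move=> p /H[l /(_ e e0)[d d0 dP]]; exists d => // r wfr sub pr rd.
have cl : pcontinuous (fun z => f p + l * (z - p)).
  apply: (@hasder_pcontinuous _ (fun=> l)) => z.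
  apply: hasder_eq (hasderD (hasder_cst _ z) (hasderZ l (hasderB (hasder_id z) (hasder_cst p z)))) => //.
  by rewrite add0r subr0 mulr1.
have cd : pcontinuous (fun z => f z - (f p + l * (z - p))).
  by move=> z; apply: (cvgB (cf z) (cl z)).
have -> : rectint f r = rectint (fun z => f z - (f p + l * (z - p))) r.
  have := rectintD r cd cl; rewrite (rectint_affine (f p) l p wfr) addr0 => <-.
  by apply: rectint_eq => // z _ _; rewrite subrK.
rewrite expr2 mulrA -(mulrA 4); apply: rectint_bound => // z zr _.
rewrite opprD addrA (le_trans (dP z (in_subrect sub zr) _)) //.
  by rewrite (le_lt_trans (in_rect_dist zr pr)).
by rewrite ler_wpM2l ?(ltW e0) // in_rect_dist.
Qed.

End Goursat.

(** * Cauchy's formula and estimate for the first derivative *)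

Section CauchyEstimate.
Variable R : realType.
Local Notation C := R[i].
Local Notation Re := (@complex.Re R).
Local Notation Im := (@complex.Im R).
Implicit Types (f g : C -> C) (z w : C) (s : R).

Lemma pcontD f g : pcontinuous f -> pcontinuous g -> pcontinuous (fun z => f z + g z).
Proof. by move=> cf cg z; exact: (cvgD (cf z) (cg z)). Qed.

Lemma pcontM f g : pcontinuous f -> pcontinuous g -> pcontinuous (fun z => f z * g z).
Proof. by move=> cf cg z; exact: (cvgM (cf z) (cg z)). Qed.

Lemma pcontV f : (forall z, f z != 0) -> pcontinuous f -> pcontinuous (fun z => (f z)^-1).
Proof. by move=> f0 cf z; exact: (cvgV (f0 z) (cf z)). Qed.

Lemma pcont_cst (k : C) : pcontinuous (fun=> k).
Proof. by move=> z; exact: cst_continuous. Qed.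

Lemma pcont_lip f : (forall z w, normc (f z - f w) <= normc (z - w)) -> pcontinuous f.
Proof.
move=> H z; apply/continuous_normcP => e e0; exists e => // w wz.
exact: le_lt_trans (H _ _) wz.
Qed.

Lemma entire_pcontinuous f : entire f -> pcontinuous f.
Proof. by move=> /entireP; exact: hasder_pcontinuous. Qed.

(* A continuous function on the plane that agrees with [z^-1] outside the open
   disc of radius [s]. *)
Definition kinv s z : C := conjc z * ((Num.max (normc z) s)%:C ^+ 2)^-1.

Lemma normc_conj z : normc (conjc z) = normc z.
Proof. by case: z => a b; rewrite /normc /= sqrrN. Qed.

Lemma mulc_conj z : z * conjc z = (normc z ^+ 2)%:C.
Proof. by rewrite normc_sqr; case: z => a b; apply: complex_eq => /=; ring. Qed.

Lemma kinv_pcont s : 0 < s -> pcontinuous (kinv s).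
Proof.
move=> s0; apply: pcontM.
  by apply: pcont_lip => z w; rewrite -rmorphB /= normc_conj.
have cm : pcontinuous (fun z => (Num.max (normc z) s)%:C).
  apply: pcont_lip => z w; rewrite -rmorphB /= normc_real.
  have := normc_dist_le z w; rewrite !ler_norml.
  by rewrite /Num.max; case: ltP => ?; case: ltP => ?; lra.
apply: pcontV => [z|]; last exact: pcontM.
by rewrite expf_neq0 // eq_complex /= negb_and gt_eqF // lt_max s0 orbT.
Qed.

Lemma kinvE s z : 0 < s -> s <= normc z -> kinv s z = z^-1.
Proof.
move=> s0 sz; have z0 : z != 0 by rewrite -normc_gt0 (lt_le_trans s0).
have cz0 : conjc z != 0 by rewrite -normc_gt0 normc_conj normc_gt0.
rewrite /kinv (max_idPl sz) -rmorphXn /= -mulc_conj invfM mulrCA mulfV //.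
by rewrite mulr1.
Qed.

Definition square s := Rect (- s) s (- s) s.

Lemma square_norm s z : 0 <= s -> in_rect (square s) z -> normc z <= 2 * s.
Proof.
move=> s0 /andP[/= /andP[a b] /andP[c d]]; rewrite (le_trans (normc_le_ReIm _)) //.
by rewrite mulr_natl mulr2n lerD // ler_norml; lra.
Qed.

Lemma side_norm s z : 0 <= s -> (Re z == - s) || (Re z == s) || ((Im z == - s) || (Im z == s)) ->
  s <= normc z.
Proof.
move=> s0 /orP[] /orP[] /eqP e; [have := Re_le_normc z|have := Re_le_normc z
  |have := Im_le_normc z|have := Im_le_normc z];
  by rewrite e ?normrN ger0_norm.
Qed.

Lemma wf_square s : 0 <= s -> wf_rect (square s).
Proof. by move=> s0; rewrite /wf_rect /=; lra. Qed.

(* The region between two concentric squares is a union of four rectangles. *)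
Lemma square_annulus (q h : C -> C) s S : 0 < s -> s <= S -> pcontinuous h ->
  (forall z, z != 0 -> exists l, hasder q z l) ->
  (forall z, s <= normc z -> h z = q z) ->
  rectint h (square S) = rectint h (square s).
Proof.
move=> s0 sS ch dq hq.
have G (r : rect R) : wf_rect r -> (forall z, in_rect r z -> s <= normc z) -> rectint h r = 0.
  move=> wfr rs; apply: goursat => // p pr.
  have p0 : p != 0 by rewrite -normc_gt0 (lt_le_trans s0) // rs.
  have [l /hasder_normcP dl] := dq p p0; exists l => e /dl[d d0 dP].
  by exists d => // z zr zp; rewrite !hq ?rs // dP.
have nRe (z : C) : normc z >= `|Re z| := Re_le_normc z.
have nIm (z : C) : normc z >= `|Im z| := Im_le_normc z.
rewrite /square (@rectint_catx _ h (- S) S (- s)) //; last by apply/andP; split; lra.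
rewrite (@rectint_catx _ h (- s) S s) //; last by apply/andP; split; lra.
rewrite (@rectint_caty _ h (- s) s (- s)) //; last by apply/andP; split; lra.
rewrite (@rectint_caty _ h (- s) s s (- s)) //; last by apply/andP; split; lra.
rewrite (G (Rect (- S) (- s) (- S) S)); first 1 last.
- by rewrite /wf_rect /=; lra.
- move=> z /andP[/= /andP[_ zs] _]; apply: le_trans (nRe z).
  by rewrite ler0_norm; lra.
rewrite (G (Rect s S (- S) S)); first 1 last.
- by rewrite /wf_rect /=; lra.
- move=> z /andP[/= /andP[zs _] _]; apply: le_trans (nRe z).
  by rewrite ger0_norm; lra.
rewrite (G (Rect (- s) s (- S) (- s))); first 1 last.
- by rewrite /wf_rect /=; lra.
- move=> z /andP[_ /= /andP[_ zs]]; apply: le_trans (nIm z).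
  by rewrite ler0_norm; lra.
rewrite (G (Rect (- s) s s S)); first 1 last.
- by rewrite /wf_rect /=; lra.
- move=> z /andP[_ /= /andP[zs _]]; apply: le_trans (nIm z).
  by rewrite ger0_norm; lra.
by rewrite add0r add0r !addr0.
Qed.

Lemma hasder_inv z : z != 0 -> hasder (fun w : C => w^-1) z (- z ^- 2).
Proof.
move=> z0; apply: hasder_eq (hasderV _ (hasder_id z)) => //.
by rewrite mulr1.
Qed.

(** Its value is [2 pi i]. Only the lower bound 4 for the modulus matters, so [pi] never enters. *)
Definition winding : C := rectint (kinv 1) (square 1).

Lemma winding_eq s : 0 < s -> rectint (kinv s) (square s) = winding.
Proof.
have dq z : z != 0 -> exists l, hasder (fun w : C => w^-1) z l.
  by move=> z0; exists (- z ^- 2); exact: hasder_inv.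
have H a b : 0 < a -> a <= b -> rectint (kinv b) (square b) = rectint (kinv a) (square a).
  move=> a0 ab; have b0 := lt_le_trans a0 ab.
  rewrite -(square_annulus a0 ab (kinv_pcont a0) dq); last by move=> z; exact: kinvE.
  apply: rectint_eq => [z _ /side_norm zb|]; last by rewrite wf_square // ltW.
  by rewrite !kinvE ?zb // ?(le_trans ab) ?zb // ltW.
by move=> s0; have [s1|/ltW s1] := leP s 1; rewrite /winding; [rewrite -(H s 1)|rewrite (H 1 s)].
Qed.

Lemma Im_rectint f (r : rect R) : Im (rectint f r) =
  rint (fun t => Im (f (hline (rb r) t) * 1)) (rl r) (rr r) -
  rint (fun t => Im (f (hline (rt r) t) * 1)) (rl r) (rr r) +
  (rint (fun t => Im (f (vline (rr r) t) * 'i)) (rb r) (rt r) -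
   rint (fun t => Im (f (vline (rl r) t) * 'i)) (rb r) (rt r)).
Proof. by rewrite /rectint !(ImD, ImN). Qed.

(* On each side of the unit square the integrand has imaginary part
   [1 / (1 + t ^ 2)], which is at least 1/2. *)
Lemma winding_ge4 : 4 <= normc winding.
Proof.
apply: le_trans (Im_le_normc _); apply: le_trans (ler_norm _).
rewrite /winding Im_rectint; cbn [square rl rr rb rt].
have ck : pcontinuous (kinv 1) by exact: kinv_pcont.
have N1 (u : R -> R) : continuous u -> (forall t, -1 <= t <= 1 -> 2^-1 <= u t) -> 1 <= rint u (-1) 1.
  move=> cu H; apply: le_trans (rint_le (u := fun=> 2^-1) _ cu H); last exact: cst_continuous.
  by rewrite rint_cst; lra.
have N2 (u : R -> R) : continuous u -> (forall t, -1 <= t <= 1 -> u t <= - 2^-1) -> rint u (-1) 1 <= -1.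
  move=> cu H; apply: le_trans (rint_le (v := fun=> - 2^-1) cu _ H) _; first exact: cst_continuous.
  by rewrite rint_cst; lra.
have val (x y : R) : 1 <= x ^+ 2 + y ^+ 2 -> kinv 1 (x +i* y) =
    (x / (x ^+ 2 + y ^+ 2)) +i* (- y / (x ^+ 2 + y ^+ 2)).
  move=> xy; have n2 : normc (x +i* y) ^+ 2 = x ^+ 2 + y ^+ 2 by rewrite normc_sqr.
  have n1 : 1 <= normc (x +i* y) by rewrite -(@ler_pXn2r _ 2) ?nnegrE ?normc_ge0 // n2 expr1n.
  rewrite /kinv (max_idPl n1) -rmorphXn /= n2 -[(_%:C)^-1]fmorphV.
  by apply: complex_eq => /=; field; rewrite -?n2; rewrite gt_eqF // n2; lra.
have hl y t : hline y t = t +i* y by apply: complex_eq; rewrite ?Re_hline ?Im_hline.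
have vl x t : vline x t = x +i* t by apply: complex_eq; rewrite ?Re_vline ?Im_vline.
have sq (t : R) : -1 <= t <= 1 -> 0 <= t ^+ 2 <= 1.
  by move=> t1; rewrite sqr_ge0 -[X in _ <= X](expr1n _ 2) -real_normK ?num_real // lerXn2r ?nnegrE // ler_norml.
have half (t : R) : 0 <= t <= 1 -> 2^-1 <= (1 + t)^-1.
  by move=> t1; rewrite lef_pV2 ?posrE; lra.
have b1 : 1 <= rint (fun t => Im (kinv 1 (hline (-1) t) * 1)) (-1) 1.
  apply: N1 => [|t /sq t1]; first exact: (ccont_hline _ ck).2.
  rewrite mulr1 hl val /=; last by rewrite sqrrN expr1n lerDr; case/andP: t1.
  by rewrite opprK mul1r sqrrN expr1n addrC half.
have b2 : rint (fun t => Im (kinv 1 (hline 1 t) * 1)) (-1) 1 <= -1.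
  apply: N2 => [|t /sq t1]; first exact: (ccont_hline _ ck).2.
  rewrite mulr1 hl val /=; last by rewrite expr1n lerDr; case/andP: t1.
  by rewrite mulN1r lerN2 expr1n addrC half.
have b3 : 1 <= rint (fun t => Im (kinv 1 (vline 1 t) * 'i)) (-1) 1.
  apply: N1 => [|t /sq t1]; first exact: (ccont_vline _ ck).2.
  rewrite vl val ?ImM /=; last by rewrite expr1n lerDl; case/andP: t1.
  by rewrite mulr1 mulr0 addr0 mul1r expr1n half.
have b4 : rint (fun t => Im (kinv 1 (vline (-1) t) * 'i)) (-1) 1 <= -1.
  apply: N2 => [|t /sq t1]; first exact: (ccont_vline _ ck).2.
  rewrite vl val ?ImM /=; last by rewrite sqrrN expr1n lerDl; case/andP: t1.
  by rewrite mulr1 mulr0 addr0 mulN1r sqrrN expr1n lerN2 half.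
move: b1 b2 b3 b4; set r1 := rint _ _ _; set r2 := rint _ _ _.
set r3 := rint _ _ _; set r4 := rint _ _ _; lra.
Qed.

Lemma hasder_shift (f : C -> C) w z l : hasder f (w + z) l -> hasder (fun u => f (w + u)) z l.
Proof.
move=> df; rewrite -[l]mulr1; apply: (@hasder_comp _ f (fun u => w + u)) df _.
by apply: hasder_eq (hasderD (hasder_cst w z) (hasder_id z)); rewrite ?add0r.
Qed.

(** The integral of [(f (w + z) - f w) / z ^+ 2] does not depend on the square, by [square_annulus].
    On small squares the integrand is close to [cderiv f w / z], whose integral is
    [winding * cderiv f w]; subtracting [f w] leaves only this simple pole. *)
Lemma cauchy_formula f w s : entire f -> 0 < s ->
  winding * cderiv f w =
  rectint (fun z => (f (w + z) - f w) * (kinv s z * kinv s z)) (square s).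
Proof.
move=> ef s0; set l := cderiv f w.
pose D z := f (w + z) - f w.
have dD z : hasder D z (cderiv f (w + z)).
  apply: hasder_eq (hasderB (hasder_shift ((entireP f).1 ef (w + z))) (hasder_cst (f w) z)) => //.
  by rewrite subr0.
have cD := hasder_pcontinuous dD.
have ck a : 0 < a -> pcontinuous (kinv a) := @kinv_pcont a.
have cDk a : 0 < a -> pcontinuous (fun z => D z * (kinv a z * kinv a z)).
  by move=> a0; exact: (pcontM cD (pcontM (ck _ a0) (ck _ a0))).
have dq z : z != 0 -> exists l', hasder (fun u => D u * (u^-1 * u^-1)) z l'.
  move=> z0; eexists; exact: (hasderM (dD z) (hasderM (hasder_inv z0) (hasder_inv z0))).
have J a b : 0 < a -> a <= b ->
    rectint (fun z => D z * (kinv b z * kinv b z)) (square b) =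
    rectint (fun z => D z * (kinv a z * kinv a z)) (square a).
  move=> a0 ab; have b0 := lt_le_trans a0 ab.
  rewrite -(square_annulus a0 ab (cDk _ a0) dq); last by move=> z az; rewrite !kinvE.
  apply: rectint_eq => [z _ /side_norm zb|]; last by rewrite wf_square // ltW.
  by rewrite !kinvE ?zb // ?(le_trans ab) ?zb // ltW.
apply/eqP; rewrite eq_sym -subr_eq0 -normc_eq0 eq_le normc_ge0 andbT.
apply/ler_addgt0Pl => e e0; rewrite addr0.
(* [rectint_bound] contributes a factor 4 and [rsize (square a) = 4 * a], together 16. *)
have e1 : 0 < e / 16 by rewrite divr_gt0.
have /hasder_normcP /(_ _ e1)[d d0 dP] := (entireP f).1 ef w.
(* A square of half-side [a] lies in the disc of radius [2 * a], which must stay below [d]. *)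
pose a := Num.min s (d / 4).
have a0 : 0 < a by rewrite lt_min s0 divr_gt0.
have as_ : a <= s by rewrite ge_min lexx.
have ad4 : a <= d / 4 by rewrite ge_min lexx orbT.
have ad : 2 * a < d by move: ad4; move: (a) => b; lra.
have E : - (winding * l) = rectint (fun z => -1 * (l * kinv a z)) (square a).
  rewrite (rectintZ (-1) _ (pcontM (pcont_cst (k := l)) (ck _ a0))) (rectintZ l _ (ck _ a0)).
  by rewrite winding_eq // mulN1r mulrC.
rewrite (J a s a0 as_) E.
have cl : pcontinuous (fun z => -1 * (l * kinv a z)).
  exact: (pcontM (pcont_cst (k := _)) (pcontM (pcont_cst (k := _)) (ck _ a0))).
rewrite -(rectintD _ (cDk _ a0) cl).
apply: (@le_trans _ _ (4 * (e / 16 / a) * rsize (square a))).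
  apply: rectint_bound; [exact: (pcontD (cDk _ a0) cl)|by rewrite wf_square // ltW|].
  move=> z zr /side_norm -/(_ (ltW a0)) az.
  have z0 : z != 0 by rewrite -normc_gt0 (lt_le_trans a0).
  have zd : normc (w + z - w) < d.
    by rewrite addrAC subrr add0r (le_lt_trans (square_norm (ltW a0) zr)).
  have := dP _ zd; rewrite -/l addrAC [w + z - w]addrAC subrr add0r => H.
  have -> : D z * (kinv a z * kinv a z) + -1 * (l * kinv a z) = (D z - l * z) / z / z.
    by rewrite !kinvE //; field.
  rewrite !normcM normcV; have nz : 0 < normc z by rewrite normc_gt0.
  rewrite ler_pdivrMr // (@le_trans _ _ (e / 16)) //; last first.
    rewrite mulrAC ler_pdivlMr // ler_pM2l //.
  by rewrite ler_pdivrMr // /D [f (w + z) - f w - _]addrAC.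
by rewrite /rsize /= le_eqVlt; apply/orP; left; apply/eqP; field; lra.
Qed.

(** The square of half-side [s = r / 2] fits in the disc of radius [r]. On its sides the integrand
    is at most [2 * M / s ^+ 2], so the contour integral is at most [32 * M / s = 64 * M / r];
    dividing by [winding], of modulus at least 4, leaves 16. *)
Lemma cauchy_estimate f w r M : entire f -> 0 < r ->
  (forall z, normc (z - w) <= r -> normc (f z) <= M) ->
  normc (cderiv f w) <= 16 * M / r.
Proof.
move=> ef r0 H; set s := r / 2; have s0 : 0 < s by rewrite divr_gt0.
have M0 : 0 <= M by apply: le_trans (normc_ge0 (f w)) (H w _); rewrite subrr normc0 ltW.
have cD : pcontinuous (fun z => f (w + z) - f w).
  apply: (@hasder_pcontinuous _ _ (fun z => cderiv f (w + z))) => z.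
  apply: hasder_eq (hasderB (hasder_shift ((entireP f).1 ef (w + z))) (hasder_cst (f w) z)) => //.
  by rewrite subr0.
have B : normc (winding * cderiv f w) <= 4 * (2 * M / s / s) * rsize (square s).
  rewrite (cauchy_formula w ef s0); apply: rectint_bound.
  - exact: (pcontM cD (pcontM (kinv_pcont s0) (kinv_pcont s0))).
  - by rewrite wf_square // ltW.
  - move=> z zr /side_norm -/(_ (ltW s0)) az.
    rewrite !kinvE // !normcM normcV mulrA; have nz : 0 < normc z by rewrite (lt_le_trans s0).
    have D2 : normc (f (w + z) - f w) <= 2 * M.
      rewrite (le_trans (normcB _ _)) // mulr_natl mulr2n lerD // H ?subrr ?normc0 ?(ltW r0) //.
      rewrite addrAC subrr add0r (le_trans (square_norm (ltW s0) zr)) // /s; lra.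
    have zs : (normc z)^-1 <= s^-1 by rewrite lef_pV2 ?posrE.
    by do 2! [apply: ler_pM => //; rewrite ?mulr_ge0 ?invr_ge0 ?normc_ge0 //].
have E : 4 * (2 * M / s / s) * rsize (square s) = 4 * (16 * M / r).
  by rewrite /rsize /s /=; field; lra.
rewrite -(ler_pM2l (x := 4)) //; apply: (le_trans _ (le_trans B _)); last by rewrite E.
by rewrite normcM ler_wpM2r ?normc_ge0 // winding_ge4.
Qed.

End CauchyEstimate.

(** * Smoothness of entire functions, primitives, Liouville *)

Section EntireFunctions.
Variable R : realType.
Local Notation C := R[i].
Local Notation Re := (@complex.Re R).
Local Notation Im := (@complex.Im R).
Implicit Types (f g F : C -> C) (z w h : C) (r s : R).

(** Compactness of a square in the form of bisection: local bounds come from continuity, and a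
    rectangle takes the maximum over its quarters. *)
Lemma pcont_bounded f r : pcontinuous f ->
  exists2 M, 0 <= M & forall z, normc z <= r -> normc (f z) <= M.
Proof.
move=> cf; have [r0|r0] := ltP r 0.
  by exists 0 => // z zr; have := le_lt_trans zr r0; rewrite ltNge normc_ge0.
have [M MP] : exists M, forall z, in_rect (square r) z -> normc (f z) <= M.
  apply: (@rect_bisection _ (fun q => exists M, forall z, in_rect q z -> normc (f z) <= M)).
  - exact: wf_square.
  - move=> q _ H.
    have [M1 H1] := H _ (or_introl erefl).
    have [M2 H2] := H _ (or_intror (or_introl erefl)).
    have [M3 H3] := H _ (or_intror (or_intror (or_introl erefl))).
    have [M4 H4] := H _ (or_intror (or_intror (or_intror (or_introl erefl)))).
    exists (Num.max (Num.max M1 M2) (Num.max M3 M4)) => z /andP[/andP[za zb] /andP[zc zd]].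
    rewrite !le_max; have [zx|zx] := leP (Re z) ((rl q + rr q) / 2);
      have [zy|zy] := leP (Im z) ((rb q + rt q) / 2).
    + by rewrite H1 // /in_rect /= za zx zc zy.
    + by rewrite H3 ?orbT // /in_rect /= za zx (ltW zy) zd.
    + by rewrite H2 ?orbT // /in_rect /= (ltW zx) zb zc zy.
    + by rewrite H4 ?orbT // /in_rect /= (ltW zx) zb (ltW zy) zd.
  - move=> p _; have /continuous_normcP /(_ 1 ltr01)[d d0 dP] := cf p.
    exists d => // q wfq _ pq qd; exists (normc (f p) + 1) => z zq.
    have := dP z (le_lt_trans (in_rect_dist zq pq) qd) => H.
    by have := le_normcD (f z - f p) (f p); rewrite subrK; lra.
exists (Num.max 0 M) => [|z zr]; first by rewrite le_max lexx.
rewrite le_max MP ?orbT // /in_rect /= -!ler_norml.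
by rewrite !(le_trans _ zr) ?Re_le_normc ?Im_le_normc.
Qed.

Lemma entire_hasder f z : entire f -> hasder f z (cderiv f z).
Proof. by move=> /entireP. Qed.

Lemma cderiv_bounded f r : entire f ->
  exists2 M, 0 <= M & forall z, normc z <= r -> normc (cderiv f z) <= M.
Proof.
move=> ef; have [M M0 MP] := pcont_bounded (r + 1) (entire_pcontinuous ef).
exists (16 * M / 1) => [|z zr]; first by rewrite divr1 mulr_ge0.
apply: (cauchy_estimate ef ltr01) => u uz; apply: MP.
by have := le_normcD (u - z) z; rewrite subrK; lra.
Qed.

Definition dquot f h z : C := h^-1 * (f (z + h) - f z).

Lemma hasder_dquot f h z : entire f ->
  hasder (dquot f h) z (dquot (cderiv f) h z).
Proof.
move=> ef; apply: hasderZ; apply: hasderB; last exact: entire_hasder.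
rewrite -[X in hasder _ _ X]mulr1; apply: (@hasder_comp _ f (fun u => u + h)).
  exact: entire_hasder.
by apply: hasder_eq (hasderD (hasder_id z) (hasder_cst h z)); rewrite ?addr0.
Qed.

Lemma entire_dquot f h : entire f -> entire (dquot f h).
Proof. by move=> ef; apply: (hasder_entire (fun z => hasder_dquot h z ef)).1. Qed.

Lemma cderiv_dquot f h : entire f -> cderiv (dquot f h) = dquot (cderiv f) h.
Proof. by move=> ef; apply: (hasder_entire (fun z => hasder_dquot h z ef)).2. Qed.

Lemma normc_segment r z h (t : R) : normc z <= r -> normc h <= 1 -> 0 <= t <= 1 ->
  normc (z + t%:C * h) <= r + 1.
Proof.
move=> zr h1 /andP[t0 t1]; rewrite (le_trans (le_normcD _ _)) // lerD //.
by rewrite normcM normc_real ger0_norm // mulr_ile1 ?normc_ge0.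
Qed.

Lemma dquot_bounded f r : entire f -> exists2 M, 0 <= M &
  forall z h, normc z <= r -> normc h <= 1 -> normc (dquot f h z) <= M.
Proof.
move=> ef; have [M M0 MP] := cderiv_bounded (r + 1) ef.
exists (2 * M) => [|z h zr h1]; first by rewrite mulr_ge0.
rewrite /dquot normcM normcV.
have H : normc (f (z + h) - f z) <= 2 * M * normc h.
  have := @normc_mvt _ f (cderiv f) z (z + h) M (fun u => entire_hasder u ef).
  rewrite addrAC subrr add0r; apply=> t t01.
  by apply: MP; exact: normc_segment.
(* For [h = 0] the quotient is 0, since [0^-1 = 0]. *)
have [->|h0] := eqVneq h 0; first by rewrite normc0 invr0 mul0r mulr_ge0.
by rewrite mulrC ler_pdivrMr ?normc_gt0.
Qed.

(** Obtained before [cderiv f] is known to be differentiable: [dquot f h] is entire and bounded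
    uniformly in [h], and Cauchy's estimate bounds its derivative, the difference quotient of
    [cderiv f]. *)
Lemma cderiv_lipschitz f r : entire f -> exists2 L, 0 <= L &
  forall z h, normc z <= r -> normc h <= 1 ->
    normc (cderiv f (z + h) - cderiv f z) <= L * normc h.
Proof.
move=> ef; have [M M0 MP] := dquot_bounded (r + 1) ef.
exists (16 * M / 1) => [|z h zr h1]; first by rewrite divr1 mulr_ge0.
have [->|h0] := eqVneq h 0; first by rewrite addr0 subrr normc0 mulr0.
have := @cauchy_estimate _ (dquot f h) z 1 M (entire_dquot (h := h) ef) ltr01.
rewrite cderiv_dquot // /dquot normcM normcV ler_pdivrMl ?normc_gt0 //.
rewrite [_ * normc h]mulrC; apply=> u uz; apply: MP => //.
by have := le_normcD (u - z) z; rewrite subrK; lra.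
Qed.

(** Mean value inequality for [f u - cderiv f z * u], whose derivative [cderiv f u - cderiv f z] is
    of order [h] by [cderiv_lipschitz]. *)
Lemma taylor2 f r : entire f -> exists2 L, 0 <= L &
  forall z h, normc z <= r -> normc h <= 1 ->
    normc (f (z + h) - f z - h * cderiv f z) <= L * normc h ^+ 2.
Proof.
move=> ef; have [L L0 LP] := cderiv_lipschitz r ef.
exists (2 * L) => [|z h zr h1]; first by rewrite mulr_ge0.
have dG u : hasder (fun u => f u - cderiv f z * u) u (cderiv f u - cderiv f z).
  apply: hasderB; first exact: entire_hasder.
  by rewrite -[X in hasder _ _ X]mulr1; apply: hasderZ; exact: hasder_id.
have := @normc_mvt _ _ _ z (z + h) (L * normc h) dG.
rewrite addrAC subrr add0r expr2 !mulrA.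
have -> : f (z + h) - cderiv f z * (z + h) - (f z - cderiv f z * z) =
  f (z + h) - f z - h * cderiv f z by ring.
apply=> t /andP[t0 t1]; have th : normc (t%:C * h) <= normc h.
  by rewrite normcM normc_real ger0_norm // ler_piMl ?normc_ge0.
by rewrite (le_trans (LP _ _ zr (le_trans th h1))) // ler_wpM2l.
Qed.

Lemma norm_le_sub (a b c d : R) : `|a - b| <= c + d -> a - c <= b + d.
Proof. by rewrite ler_norml; lra. Qed.

(** Completeness with an explicit error: the hypothesis says that the intervals
    [[q a - n a, q a + n a]] meet pairwise, and the supremum of the left ends lies in all of
    them. *)
Lemma squeeze_limit (T : Type) (D : set T) (q n : T -> R) : D !=set0 ->
  (forall a b, D a -> D b -> q a - n a <= q b + n b) ->
  exists l, forall a, D a -> `|q a - l| <= n a.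
Proof.
move=> [a0 Da0] H; pose A := (fun a => q a - n a) @` D.
exists (sup A) => a Da; rewrite ler_norml; apply/andP; split.
  suff : sup A <= q a + n a by lra.
  by apply: ge_sup; [exists (q a0 - n a0); exists a0|move=> _ [b Db <-]; exact: H].
suff : q a - n a <= sup A by lra.
apply: ub_le_sup; last by exists a.
by exists (q a0 + n a0) => _ [b Db <-]; exact: H.
Qed.

(* The difference quotients of [f] form a Cauchy family of entire functions,
   hence so do their derivatives, the difference quotients of [cderiv f]. *)
Theorem entire_cderiv f : entire f -> entire (cderiv f).
Proof.
move=> ef; suff H z : exists l, hasder (cderiv f) z l.
  by move=> z; have [l /hasderP []] := H z.
have [L L0 LP] := taylor2 (normc z + 1) ef.
have near h k u : h != 0 -> k != 0 -> normc h <= 1 -> normc k <= 1 -> normc (u - z) <= 1 ->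
    normc (dquot f h u - dquot f k u) <= L * (normc h + normc k).
  have one h' u' : h' != 0 -> normc h' <= 1 -> normc (u' - z) <= 1 ->
      normc (dquot f h' u' - cderiv f u') <= L * normc h'.
    move=> h0 h1 uz; have -> : dquot f h' u' - cderiv f u' =
        h'^-1 * (f (u' + h') - f u' - h' * cderiv f u').
      by rewrite mulrBr mulKf.
    rewrite normcM normcV ler_pdivrMl ?normc_gt0 // mulrCA -expr2.
    by apply: LP => //; have := le_normcD (u' - z) z; rewrite subrK; lra.
  move=> h0 k0 h1 k1 uz; rewrite (le_trans (normc_triangle (cderiv f u) _ _)) // mulrDr.
  by rewrite lerD ?one // normc_distC one.
have C2 h k : h != 0 /\ normc h <= 1 -> k != 0 /\ normc k <= 1 ->
    normc (dquot (cderiv f) h z - dquot (cderiv f) k z) <= 16 * L * (normc h + normc k).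
  move=> [h0 h1] [k0 k1].
  have [e E] := hasder_entire (fun u => hasderB (hasder_dquot h u ef) (hasder_dquot k u ef)).
  have := cauchy_estimate e ltr01 (fun u => near h k u h0 k0 h1 k1).
  by rewrite E divr1 mulrA.
pose D := [set h : C | h != 0 /\ normc h <= 1].
have D1 : D !=set0 by exists 1; split; rewrite ?oner_neq0 // normc1.
have [x xP] : exists x, forall h, D h -> `|Re (dquot (cderiv f) h z) - x| <= 16 * L * normc h.
  apply: squeeze_limit => // h k Dh Dk.
  apply: norm_le_sub; rewrite -mulrDr -ReN -ReD.
  exact: le_trans (Re_le_normc _) (C2 h k Dh Dk).
have [y yP] : exists y, forall h, D h -> `|Im (dquot (cderiv f) h z) - y| <= 16 * L * normc h.
  apply: squeeze_limit => // h k Dh Dk.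
  apply: norm_le_sub; rewrite -mulrDr -ImN -ImD.
  exact: le_trans (Im_le_normc _) (C2 h k Dh Dk).
exists (x +i* y); apply/hasder_normcP => e e0.
pose d := Num.min 1 (e / (32 * L + 1)).
have L1 : 0 < 32 * L + 1 by rewrite ltr_wpDl // mulr_ge0.
exists d; first by rewrite lt_min ltr01 divr_gt0.
move=> w; set h := w - z => hd.
have [h0|h0] := eqVneq h 0.
  have -> : w = z by apply/eqP; rewrite -subr_eq0 -/h h0.
  by rewrite h0 mulr0 !subrr normc0 mulr0.
have Dh : D h by split=> //; rewrite ltW // (lt_le_trans hd) // ge_min lexx.
have -> : cderiv f w - cderiv f z - (x +i* y) * h = (dquot (cderiv f) h z - (x +i* y)) * h.
  by rewrite /dquot mulrBl mulrAC mulVf // mul1r [z + h]addrC subrK.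
rewrite normcM ler_wpM2r ?normc_ge0 //.
apply: (@le_trans _ _ (32 * L * normc h)).
  rewrite (le_trans (normc_le_ReIm _)) // ReD ImD ReN ImN /=.
  apply: le_trans (lerD (xP h Dh) (yP h Dh)) _.
  by move: (normc h) => a; lra.
have he : normc h <= e / (32 * L + 1) by rewrite ltW // (lt_le_trans hd) // ge_min lexx orbT.
move: he; rewrite ler_pdivlMr // => he; apply: le_trans he.
by rewrite mulrC ler_wpM2l ?normc_ge0 // lerDl.
Qed.

Lemma entireM f g : entire f -> entire g -> entire (fun z => f z * g z).
Proof.
move=> ef eg.
by have [] := hasder_entire (fun z => hasderM (entire_hasder z ef) (entire_hasder z eg)).
Qed.

Lemma seg_integral0 F : seg_integral F 0 = 0.
Proof.
rewrite seg_integral_cint (@cint_eq _ _ (fun=> 0)) => [|t _]; last by rewrite mulr0.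
by apply: complex_eq; rewrite /cint /=; rewrite rint_cst ?ler01 // mul0r.
Qed.

(** Differentiation under the integral, done by hand: [taylor2] makes the remainder quadratic in [h]
    uniformly along the segment, and the linear part integrates to [F z * h]. *)
Lemma hasder_seg_integral F z : entire F -> hasder (seg_integral F) z (F z).
Proof.
move=> eF; have eF' := entire_cderiv eF.
have cF := entire_pcontinuous eF; have cF' := entire_pcontinuous eF'.
have [L L0 LP] := taylor2 (normc z) eF.
have [M M0 MP] := cderiv_bounded (normc z) eF.
pose K := 2 * ((normc z + 1) * L + M).
have path f v : pcontinuous f -> ccont (fun t : R => f (t%:C * v)).
  move=> cf; have := ccont_path 0 v cf.
  by congr (ccont _); apply/funext => t; rewrite add0r.
have cG v : ccont (fun t : R => F (t%:C * v) * v) by apply: ccontM; [exact: path|exact: ccont_cst].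
(* [T] is the derivative of [t * F (t z)], so its integral over [[0, 1]] is [F z]. *)
pose T (t : R) := F (t%:C * z) + t%:C * (cderiv F (t%:C * z) * z).
have cT : ccont T.
  apply: ccontD; first exact: path.
  apply: ccontM; first by apply: ccont_real => x; exact: cvg_id.
  by apply: ccontM; [exact: path|exact: ccont_cst].
have TF : cint T 0 1 = F z.
  have [cT1 cT2] := cT.
  have dF (t : R) : hasder F (0 + t%:C * z) (cderiv F (t%:C * z)).
    by rewrite add0r; exact: entire_hasder.
  apply: complex_eq; rewrite /cint /=.
    rewrite (@rint_FTC _ (fun t => t * Re (F (0 + t%:C * z))) _ 0 1 ler01 cT1).
      by rewrite mul0r subr0 mul1r add0r mul1r.
    move=> t; apply: hasder_eq (hasderM (hasder_id t) (hasder_Re_path (dF t))) => //.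
    by rewrite /T /= ReD ReMl mul1r add0r.
  rewrite (@rint_FTC _ (fun t => t * Im (F (0 + t%:C * z))) _ 0 1 ler01 cT2).
    by rewrite mul0r subr0 mul1r add0r mul1r.
  move=> t; apply: hasder_eq (hasderM (hasder_id t) (hasder_Im_path (dF t))) => //.
  by rewrite /T /= ImD ImMl mul1r add0r.
apply/hasder_normcP => e e0; pose d := Num.min 1 (e / (K + 1)).
have K0 : 0 <= K by rewrite mulr_ge0 // addr_ge0 // mulr_ge0 // addr_ge0 ?normc_ge0.
have K1 : 0 < K + 1 by rewrite ltr_wpDl.
exists d; first by rewrite lt_min ltr01 divr_gt0.
move=> w; set h := w - z => hd.
have h1 : normc h <= 1 by rewrite ltW // (lt_le_trans hd) // ge_min lexx.
have -> : seg_integral F w - seg_integral F z - F z * h =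
    cint (fun t : R => (F (t%:C * w) * w - F (t%:C * z) * z) - h * T t) 0 1.
  rewrite cintB; first last.
  - by apply: ccontM => //; exact: ccont_cst.
  - have := ccontD (cG w) (ccontM (ccont_cst (-1)) (cG z)).
    by congr (ccont _); apply/funext => t; rewrite mulN1r.
  by rewrite cintB // cintZ // TF !seg_integral_cint [h * _]mulrC.
apply: (@le_trans _ _ (K * normc h ^+ 2)); last first.
  rewrite expr2 mulrA ler_wpM2r ?normc_ge0 //.
  have he : normc h <= e / (K + 1) by rewrite ltW // (lt_le_trans hd) // ge_min lexx orbT.
  move: he; rewrite ler_pdivlMr // => he; apply: le_trans he.
  by rewrite mulrC ler_wpM2l ?normc_ge0 // lerDl.
have -> : K * normc h ^+ 2 = 2 * (((normc z + 1) * L + M) * normc h ^+ 2) * (1 - 0).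
  by rewrite /K; ring.
apply: cint_bound ler01 _.
  apply: (@eq_rect _ _ (@ccont R) (ccontD (ccontD (cG w) (ccontM (ccont_cst (-1)) (cG z)))
    (ccontM (ccont_cst (- h)) cT))).
  by apply/funext => t; rewrite mulN1r mulNr.
move=> t /andP[t0 t1].
have th : normc (t%:C * h) <= normc h.
  by rewrite normcM normc_real ger0_norm // ler_piMl ?normc_ge0.
have tz : normc (t%:C * z) <= normc z.
  by rewrite normcM normc_real ger0_norm // ler_piMl ?normc_ge0.
have wE : w = z + h by rewrite addrC subrK.
(* Both terms are quadratic in [h]: a Taylor remainder, with [normc w <= normc z + 1], and an
   explicit product. They produce the two summands of [K], and [cint_bound] its factor 2. *)
have -> : F (t%:C * w) * w - F (t%:C * z) * z - h * T t =
   w * (F (t%:C * z + t%:C * h) - F (t%:C * z) - t%:C * h * cderiv F (t%:C * z)) +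
   h * (t%:C * h) * cderiv F (t%:C * z).
  by rewrite -mulrDr -wE /T wE; ring.
apply: le_trans (le_normcD _ _) _; rewrite [leRHS]mulrDl; apply: lerD; rewrite normcM.
  rewrite -[leRHS]mulrA; apply: ler_pM; [exact: normc_ge0..| |].
    by apply: le_trans (lerD (lexx (normc z)) h1); rewrite {1}wE; exact: le_normcD.
  apply: le_trans (LP _ _ tz (le_trans th h1)) _; rewrite ler_wpM2l //.
  by rewrite lerXn2r // nnegrE normc_ge0.
rewrite mulrC ler_pM ?normc_ge0 // ?MP // normcM expr2.
by rewrite ler_wpM2l ?normc_ge0.
Qed.

Lemma hasder_volterra f g z : entire f -> entire g ->
  hasder (volterra g f) z (f z * cderiv g z).
Proof.
move=> ef eg; apply: (@hasder_seg_integral (fun w => f w * cderiv g w)).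
exact: (entireM ef (entire_cderiv eg)).
Qed.

Lemma volterra0 g f : volterra g f 0 = 0.
Proof. exact: seg_integral0. Qed.

Lemma entire_volterra g f : entire f -> entire g -> entire (volterra g f).
Proof. by move=> ef eg; have [] := hasder_entire (fun z => hasder_volterra z ef eg). Qed.

Lemma eq_primitive (A B dA : C -> C) : (forall z, hasder A z (dA z)) ->
  (forall z, hasder B z (dA z)) -> A 0 = B 0 -> A = B.
Proof.
move=> HA HB AB; apply/funext => z; apply/eqP; rewrite -subr_eq0.
have H u : hasder (fun u => A u - B u) u 0 by rewrite -(subrr (dA u)); exact: hasderB.
by rewrite (hasder0_cst H z) AB subrr.
Qed.

Lemma le_div_all_eq0 (x K : R) : 0 <= x -> (forall r, 1 <= r -> x <= K / r) -> x = 0.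
Proof.
move=> x0 H; apply/eqP; rewrite eq_le x0 andbT leNgt; apply/negP => xp.
pose r := `|K| / x + 1; have r1 : 1 <= r by rewrite lerDr divr_ge0.
have r0 : 0 < r by lra.
have := H r r1; rewrite ler_pdivlMr // mulrDr mulr1 mulrCA mulfV ?gt_eqF // mulr1.
by have := ler_norm K; lra.
Qed.

(** Cauchy's estimate on the disc of radius [1 + normc z] bounds the derivative globally; on discs
    of arbitrary radius it then annihilates the second derivative. The intended [f] is the
    derivative of the symbol. *)
Lemma liouville_affine f K : entire f -> (forall z, normc (f z) <= K * (1 + normc z)) ->
  exists a b, forall z, f z = a * z + b.
Proof.
move=> ef H; have ef' := entire_cderiv ef.
have K0 : 0 <= K by have := le_trans (normc_ge0 _) (H 0); rewrite normc0 addr0 mulr1.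
have bd z : normc (cderiv f z) <= 32 * K.
  have nz := normc_ge0 z; have r0 : 0 < 1 + normc z by lra.
  have := @cauchy_estimate _ f z (1 + normc z) (K * (2 * (1 + normc z))) ef r0.
  have -> : 16 * (K * (2 * (1 + normc z))) / (1 + normc z) = 32 * K.
    by field; rewrite gt_eqF.
  apply=> u uz; rewrite (le_trans (H u)) // ler_wpM2l //.
  by have := le_normcD (u - z) z; rewrite subrK; lra.
have d2 z : cderiv (cderiv f) z = 0.
  apply: eq0_normc; apply: (@le_div_all_eq0 _ (16 * (32 * K))) => [|r r1]; first exact: normc_ge0.
  by apply: (cauchy_estimate ef') => // ; rewrite (lt_le_trans ltr01).
exists (cderiv f 0), (f 0) => z.
have dc u : cderiv f u = cderiv f 0.
  by apply: hasder0_cst => {}u; rewrite -(d2 u); exact: entire_hasder.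
have dL u : hasder (fun u => cderiv f 0 * u + f 0) u (cderiv f u).
  apply: hasder_eq (hasderD (hasderZ _ (hasder_id u)) (hasder_cst (f 0) u)) => //.
  by rewrite addr0 mulr1 dc.
have E : f = (fun u => cderiv f 0 * u + f 0).
  by apply: (eq_primitive (fun u => entire_hasder u ef) dL); rewrite mulr0 add0r.
exact: (congr1 (@^~ z) E).
Qed.

Lemma hasder_quadratic a b c z : hasder (fun z : C => a * z ^+ 2 + b * z + c) z (2 * a * z + b).
Proof.
have dz := hasder_id z.
apply: hasder_eq (hasderD (hasderD (hasderZ a (hasderM dz dz)) (hasderZ b dz)) (hasder_cst c z)).
  by move=> y; rewrite expr2.
by ring.
Qed.

Lemma hasder_affine a b z : hasder (fun z : C => a * z + b) z a.
Proof.
by apply: hasder_eq (hasderD (hasderZ a (hasder_id z)) (hasder_cst b z)); rewrite ?addr0 ?mulr1.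
Qed.

Lemma cderiv_quadratic g a b c : (forall z, g z = a * z ^+ 2 + b * z + c) ->
  forall z, cderiv g z = 2 * a * z + b.
Proof.
move=> /funext ->.
by have [_ ->] := hasder_entire (fun z => hasder_quadratic a b c z).
Qed.

Lemma primitive_affine g a b : entire g -> (forall z, cderiv g z = 2 * a * z + b) ->
  forall z, g z = a * z ^+ 2 + b * z + g 0.
Proof.
move=> eg H z; have dg u : hasder g u (2 * a * u + b) by rewrite -H; exact: entire_hasder.
have E : g = (fun u => a * u ^+ 2 + b * u + g 0).
  apply: (eq_primitive dg (fun u => hasder_quadratic a b (g 0) u)).
  by rewrite expr2 !mulr0 !add0r.
exact: (congr1 (@^~ z) E).
Qed.

End EntireFunctions.

#[local] Opaque entire cderiv.

(** * The complex exponential *)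

Section ComplexExponential.
Variable R : realType.
Local Notation C := R[i].
Local Notation Re := (@complex.Re R).
Local Notation Im := (@complex.Im R).

Lemma cexpD (z w : C) : cexp (z + w) = cexp z * cexp w.
Proof.
rewrite /cexp ReD ImD; apply: complex_eq; rewrite ?ReM ?ImM /= expRD ?cosD ?sinD; ring.
Qed.

Lemma normc_cexp (z : C) : normc (cexp z) = expR (Re z).
Proof.
apply/eqP; rewrite -(@eqrXn2 _ 2) ?normc_ge0 ?expR_ge0 // normc_sqr /=.
by rewrite !exprMn -mulrDr cos2Dsin2 mulr1.
Qed.

Lemma cexp_neq0 (z : C) : cexp z != 0.
Proof. by rewrite -normc_gt0 normc_cexp expR_gt0. Qed.

Lemma cexp0 : cexp (0 : C) = 1.
Proof. by rewrite /cexp /= expR0 cos0 sin0 mulr0 mulr1. Qed.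

Lemma cexpN (z : C) : cexp (- z) = (cexp z)^-1.
Proof.
by apply: (mulfI (cexp_neq0 z)); rewrite -cexpD subrr cexp0 mulfV ?cexp_neq0.
Qed.

Lemma hasder_real_near (u : R -> R) x l e : hasder u x l -> 0 < e ->
  exists2 d, 0 < d & forall y, `|y - x| < d -> `|u y - u x - l * (y - x)| <= e * `|y - x|.
Proof.
move=> [q uE [/cvgrPdist_lt cq <-]] e0.
have /nbhs_ballP[d /= d0 dP] := cq _ e0.
exists d => // y yx.
rewrite uE -mulrBl normrM; apply: ler_wpM2r => //.
by rewrite distrC ltW //; apply: dP; rewrite /ball /= distrC.
Qed.

(** First-order expansions of [expR], [cos] and [sin] at 0 are combined; the addition formula
    transports the result to every point. *)
Lemma hasder_cexp0 : hasder (@cexp R) 0 1.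
Proof.
(* The four error terms below add up to [9 * k * n], which is less than [16 * k * n <= e * n]. *)
apply/hasder_normcP => e e0; pose k := Num.min 1 e / 16.
have k0 : 0 < k by rewrite divr_gt0 // lt_min ltr01.
have k1 : 16 * k <= 1 by rewrite /k mulrC divfK // ge_min lexx.
have ke : 16 * k <= e by rewrite /k mulrC divfK // ge_min lexx orbT.
have [d1 d10 D1] := hasder_real_near ((hasderP _ _ _).2 (is_derive_expR (0 : R))) k0.
have [d2 d20 D2] := hasder_real_near ((hasderP _ _ _).2 (is_derive_cos (0 : R))) k0.
have [d3 d30 D3] := hasder_real_near ((hasderP _ _ _).2 (is_derive_sin (0 : R))) k0.
exists (Num.min (Num.min d1 d2) (Num.min d3 k)); first by rewrite !lt_min d10 d20 d30 k0.
move=> w; rewrite subr0 !lt_min => /andP[/andP[w1 w2] /andP[w3 w4]].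
have bRe := Re_le_normc w; have bIm := Im_le_normc w.
rewrite cexp0 mul1r; have := D1 (Re w); have := D2 (Im w); have := D3 (Im w).
rewrite !subr0 expR0 cos0 sin0 !mul1r oppr0 mul0r ?subr0 !addr0.
move=> /(_ (le_lt_trans bIm w3)) E3 /(_ (le_lt_trans bIm w2)) E2 /(_ (le_lt_trans bRe w1)) E1.
apply: le_trans (normc_le_ReIm _) _; rewrite !(ReD, ImD, ReN, ImN) /= subr0.
move: (Re w) (Im w) (normc w) w4 bRe bIm E1 E2 E3 => a b n nk an bn E1 E2 E3.
clear D1 D2 D3; clearbody k.
have n0 : 0 <= n by apply: le_trans an.
have kan := ler_wpM2l (ltW k0) an; have kbn := ler_wpM2l (ltW k0) bn.
have knn : k * n <= n by rewrite ler_piMl //; lra.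
have X1 : `|expR a - 1| <= 2 * n.
  have -> : expR a - 1 = (expR a - 1 - a) + a by ring.
  by apply: le_trans (ler_normD _ _) _; lra.
have X2 : `|expR a| <= 3 by move: X1; rewrite !ler_norml; lra.
have P1 : `|expR a * (cos b - 1)| <= 3 * (k * n).
  by rewrite normrM ler_pM // (le_trans E2).
have P2 : `|expR a * (sin b - b)| <= 3 * (k * n).
  by rewrite normrM ler_pM // (le_trans E3).
have P3 : `|(expR a - 1) * b| <= 2 * (k * n).
  rewrite normrM (le_trans (ler_pM _ _ X1 bn)) // -mulrA ler_pM2l //.
  by rewrite ler_wpM2r // ltW.
have -> : expR a * cos b - 1 - a = (expR a - 1 - a) + expR a * (cos b - 1) by ring.
have -> : expR a * sin b - b = expR a * (sin b - b) + (expR a - 1) * b by ring.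
apply: le_trans (lerD (ler_normD _ _) (ler_normD _ _)) _.
have ken := ler_wpM2r n0 ke; have kn0 : 0 <= k * n by rewrite mulr_ge0 // ltW.
by lra.
Qed.

Lemma hasder_cexp (z : C) : hasder (@cexp R) z (cexp z).
Proof.
have /hasder_normcP d0 := hasder_cexp0; apply/hasder_normcP => e e0.
have nz : 0 < normc (cexp z) by rewrite normc_gt0 cexp_neq0.
have [d dd0 dP] := d0 (e / normc (cexp z)) (divr_gt0 e0 nz).
exists d => // w wz; have := dP (w - z); rewrite subr0 cexp0 mul1r => /(_ wz).
rewrite mulrAC ler_pdivlMr // mulrC -normcM; apply: le_trans.
have -> : cexp w = cexp z * cexp (w - z) by rewrite -cexpD addrC subrK.
by rewrite le_eqVlt; apply/orP; left; apply/eqP; congr normc; ring.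
Qed.

Lemma hasder_cexp_comp (f : C -> C) z l : hasder f z l ->
  hasder (fun u => cexp (f u)) z (cexp (f z) * l).
Proof. by move=> df; apply: hasder_comp df; exact: hasder_cexp. Qed.

End ComplexExponential.

(** * Growth of primitives along rays *)

Section RadialGrowth.
Variable R : realType.
Local Notation C := R[i].
Local Notation Re := (@complex.Re R).
Local Notation Im := (@complex.Im R).

(* [growth (1/2) 0 m] is the radial profile of [exp psi_m]. *)
Definition growth (G B n r : R) := expR (G * r ^+ 2 - B * r - n * ln (1 + r)).

Lemma growth_gt0 G B n r : 0 < growth G B n r.
Proof. exact: expR_gt0. Qed.

Lemma growth0 G B n : growth G B n 0 = 1.
Proof. by rewrite /growth expr2 addr0 ln1 !mulr0 !subr0 expR0. Qed.

Lemma growth_succ G B n r : 0 <= r -> growth G B (n + 1) r * (1 + r) = growth G B n r.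
Proof.
move=> r0; have r1 : 1 + r = expR (ln (1 + r)) by rewrite lnK // posrE; lra.
by rewrite [X in _ * X]r1 /growth -expRD; congr expR; ring.
Qed.

Lemma hasder_growth G B n r : 0 <= r ->
  hasder (growth G B n) r (growth G B n r * (2 * G * r - B - n / (1 + r))).
Proof.
move=> r0; have r1 : 0 < 1 + r by lra.
have dl : hasder (fun x : R => ln (1 + x)) r (1 + r)^-1.
  have d1 := (hasderP _ _ _).2 (is_derive1_ln r1).
  rewrite -[X in hasder _ _ X]mulr1; apply: (@hasder_comp _ (@ln R) (fun x => 1 + x)) d1 _.
  by apply: hasder_eq (hasderD (hasder_cst 1 r) (hasder_id r)); rewrite ?add0r.
have di := hasder_id r.
have dp := hasderB (hasderB (hasderZ G (hasderM di di)) (hasderZ B di)) (hasderZ n dl).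
apply: hasder_eq (hasder_comp (f := @expR R) ((hasderP _ _ _).2 (is_derive_expR _)) dp).
  by move=> y; rewrite /growth expr2.
by rewrite /growth expr2; congr (_ * _); ring.
Qed.

Lemma mul_le_norm (a b x y : R) : 0 <= x <= y -> `|a| <= b -> a * x <= b * y.
Proof.
move=> /andP[x0 xy] ab; apply: (@le_trans _ _ (`|a| * x)).
  by rewrite ler_wpM2r // ler_norm.
by rewrite ler_pM.
Qed.

Lemma ln1D_bounds (r : R) : 0 <= r -> 0 <= ln (1 + r) <= r.
Proof. by move=> r0; rewrite ln_ge0 ?lerDl // le_ln1Dx //; lra. Qed.

Lemma growth_le_exp G B n r r0 : 0 <= r <= r0 -> 0 <= G ->
  growth G B n r <= expR (G * r0 ^+ 2 + (`|B| + `|n|) * r0).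
Proof.
move=> /andP[r0' rr] G0; rewrite ler_expR.
have q : G * r ^+ 2 <= G * r0 ^+ 2.
  by rewrite ler_wpM2l // lerXn2r // nnegrE (le_trans r0').
have b1 : - B * r <= `|B| * r0 by rewrite mul_le_norm ?r0' ?normrN.
have n1 : - n * ln (1 + r) <= `|n| * r0.
  have /andP[l0 lr] := ln1D_bounds r0'.
  by rewrite mul_le_norm ?normrN // l0 (le_trans lr).
by lra.
Qed.

(** Completion of the square, after [r <= expR r] and [ln (1 + r) <= r]. It absorbs the linear term
    left by [growth_differential_bound]. *)
Lemma le_growth G B n r : 0 < G -> 0 <= r ->
  r <= expR ((`|B| + `|n| + 1) ^+ 2 / (4 * G)) * growth G B n r.
Proof.
move=> G0 r0; set b := `|B| + `|n| + 1.
have l0 := ln1D_bounds r0.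
rewrite /growth -expRD; apply: (@le_trans _ _ (expR r)).
  by apply: le_trans (expR_ge1Dx r); lra.
have b1 : B * r <= `|B| * r by rewrite mul_le_norm ?lexx ?r0.
have n1 : n * ln (1 + r) <= `|n| * r by rewrite mul_le_norm.
rewrite ler_expR.
have sq : 0 <= (2 * G * r - b) ^+ 2 / (4 * G) by rewrite divr_ge0 ?sqr_ge0 //; lra.
have E : (2 * G * r - b) ^+ 2 / (4 * G) = G * r ^+ 2 - b * r + b ^+ 2 / (4 * G).
  by field; rewrite gt_eqF.
move: sq; rewrite E /b; move: (_ / (4 * G)) => q.
rewrite !mulrDl mul1r.
by lra.
Qed.

(** The logarithmic derivative of [growth] is [2 * G * r + O(1)], so [growth * (1 + r)] is dominated
    by its derivative up to constants. This is where integration regains the factor [1 + r]. *)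
Lemma growth_differential_bound G B n : 0 < G -> exists2 K, 0 <= K &
  forall r, 0 <= r -> growth G B n r * (1 + r) <=
    growth G B n r * (2 * G * r - B - n / (1 + r)) / G + K.
Proof.
(* For [r >= r0] one has [G * r >= G + b], hence [2 * G * r - b >= G * (1 + r)]; below [r0]
   everything is bounded. *)
move=> G0; pose b := `|B| + `|n|; pose r0 := 1 + b / G.
have b0 : 0 <= b by rewrite addr_ge0.
have bG : 0 <= b / G by rewrite divr_ge0 // ltW.
have r0_ge1 : 1 <= r0 by rewrite lerDl.
pose K1 := expR (G * r0 ^+ 2 + b * r0).
have K10 : 0 < K1 by exact: expR_gt0.
have K2 : 0 <= 1 + r0 + b / G by rewrite addr_ge0 //; lra.
exists (K1 * (1 + r0 + b / G)); first by rewrite mulr_ge0 // ltW.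
move=> r rp; have E0 := growth_gt0 G B n r.
have slope : 2 * G * r - b <= 2 * G * r - B - n / (1 + r).
  have B1 := ler_norm B.
  have n1 : n / (1 + r) <= `|n|.
    rewrite ler_pdivrMr; last by lra.
    by apply: (le_trans (ler_norm n)); rewrite ler_peMr // lerDl.
  by rewrite /b; lra.
have [rr|rr] := leP r0 r.
  have : G * (1 + r) <= 2 * G * r - b.
    have : G * r0 <= G * r by rewrite ler_pM2l.
    by rewrite /r0 mulrDr mulrCA mulfV ?gt_eqF // !mulr1; lra.
  move=> /le_trans /(_ slope) s1; rewrite -[in leRHS]mulrA.
  apply: (@le_trans _ _ (growth G B n r * ((2 * G * r - B - n / (1 + r)) / G))).
    by rewrite ler_pM2l // ler_pdivlMr // mulrC.
  by rewrite lerDl mulr_ge0 // ltW.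
have EK : growth G B n r <= K1.
  by apply: growth_le_exp; [rewrite rp ltW|exact: ltW].
have s2 : - (b / G) <= (2 * G * r - B - n / (1 + r)) / G.
  rewrite -mulNr ler_pM2r ?invr_gt0 //; apply: le_trans slope.
  by rewrite lerBrDl subrr mulr_ge0 // mulr_ge0 // ltW.
rewrite -[in leRHS]mulrA -lerBlDl -mulrBr.
apply: (@le_trans _ _ (growth G B n r * (1 + r0 + b / G))).
  by rewrite ler_pM2l // lerBlDr -lerBlDl; move: s2; move: (_ / G) (b / G) => x y; lra.
by rewrite ler_wpM2r.
Qed.

(** The real and imaginary parts of [A] along the ray, with either sign, are subtracted from [Phi];
    the mean value theorem makes the differences nondecreasing in total. [Phi] is only
    differentiated at nonnegative radii, where [ln (1 + r)] is smooth. *)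
Lemma ray_comparison (A F : C -> C) z (Phi phi : R -> R) :
  (forall w, hasder A w (F w)) -> A 0 = 0 ->
  (forall r, 0 <= r -> hasder Phi r (phi r)) ->
  (forall t : R, 0 <= t <= 1 -> normc (F (t%:C * z)) <= phi (t * normc z)) ->
  normc (A z) <= 2 * (Phi (normc z) - Phi 0).
Proof.
move=> dA A0 dPhi H; set n := normc z.
have n0 : 0 <= n by exact: normc_ge0.
have aux (u du : R -> R) : u 0 = 0 -> (forall t, hasder u t (du t)) ->
    (forall t, 0 <= t <= 1 -> `|du t| <= phi (t * n) * n) -> `|u 1| <= Phi n - Phi 0.
  move=> u0 Hu Hb.
  have one (s : R) : `|s| = 1 -> s * u 1 <= Phi n - Phi 0.
    move=> s1; pose D t := Phi (t * n) - s * u t.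
    pose dD t := phi (t * n) * n - s * du t.
    have DP t : 0 <= t -> hasder D t (dD t).
      move=> t0; apply: hasderB; last by apply: hasderZ; exact: Hu.
      have t0' : 0 <= t * n by rewrite mulr_ge0.
      apply: (@hasder_comp _ Phi (fun t => t * n) t _ _ (dPhi _ t0')).
      apply: hasder_eq (hasderM (hasder_id t) (hasder_cst n t)) => //.
      by rewrite mul1r mulr0 addr0.
    have [||c] := @MVT_segment R D dD 0 1 ler01.
    - by move=> x; rewrite in_itv /= => /andP[x0 _]; apply/hasderP; apply: DP; exact: ltW.
    - apply: continuous_in_subspaceT => x; rewrite inE /= in_itv /= => /andP[x0 _].
      exact: hasder_continuous (DP _ x0).
    rewrite in_itv /= subr0 mulr1 => c01 E.
    have dc : 0 <= dD c.
      rewrite subr_ge0 (le_trans _ (Hb c c01)) // (le_trans (ler_norm _)) //.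
      by rewrite normrM s1 mul1r.
    by move: E dc; rewrite /D mul1r mul0r u0 mulr0 subr0; move: (dD c) (s * u 1) => x y; lra.
  have u1 : 1 * u 1 <= Phi n - Phi 0 by apply: one; rewrite normr1.
  have u2 : -1 * u 1 <= Phi n - Phi 0 by apply: one; rewrite normrN normr1.
  by rewrite ler_norml; move: u1 u2; lra.
have A00 : A (0 + 0%:C * z) = 0 by rewrite mul0r addr0.
have A11 : A (0 + 1%:C * z) = A z by rewrite mul1r add0r.
have Hn (t : R) : 0 <= t <= 1 -> normc (F (0 + t%:C * z) * z) <= phi (t * n) * n.
  by move=> t01; rewrite add0r normcM ler_wpM2r // H.
have := aux (fun t => Re (A (0 + t%:C * z))) (fun t => Re (F (0 + t%:C * z) * z)).
rewrite A00 A11 => a1.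
have := aux (fun t => Im (A (0 + t%:C * z))) (fun t => Im (F (0 + t%:C * z) * z)).
rewrite A00 A11 => a2.
apply: le_trans (normc_le_ReIm _) _; rewrite mulr_natl mulr2n; apply: lerD.
  apply: a1 => // [t|t t01]; first by apply: hasder_Re_path.
  exact: le_trans (Re_le_normc _) (Hn t t01).
apply: a2 => // [t|t t01]; first by apply: hasder_Im_path.
exact: le_trans (Im_le_normc _) (Hn t t01).
Qed.

(** The constant [K] is chosen before [z] and [M], so [M] may depend on [z]; the resolvent estimate
    relies on this. The hypothesis on [F] concerns only the segment from 0 to [z]. *)
Theorem ray_growth G B n : 0 < G -> exists2 K, 0 <= K &
  forall (A F : C -> C) z M, (forall w, hasder A w (F w)) -> A 0 = 0 -> 0 <= M ->
  (forall t : R, 0 <= t <= 1 -> normc (F (t%:C * z)) <=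
     M * (growth G B n (t * normc z) * (1 + t * normc z))) ->
  normc (A z) <= K * M * growth G B n (normc z).
Proof.
move=> G0; have [K K0 KP] := growth_differential_bound B n G0.
set L := expR ((`|B| + `|n| + 1) ^+ 2 / (4 * G)).
exists (2 * (G^-1 + K * L)) => [|A F z M dA A0 M0 H].
  by rewrite mulr_ge0 // addr_ge0 ?invr_ge0 ?(ltW G0) // mulr_ge0 ?expR_ge0.
pose dg r := growth G B n r * (2 * G * r - B - n / (1 + r)).
(* The majorant comes from integrating [growth_differential_bound]; its summand [K * r] is absorbed
   afterwards through [le_growth]. *)
have dPhi r : 0 <= r ->
    hasder (fun r => M * (G^-1 * growth G B n r + K * r)) r (M * (G^-1 * dg r + K)).
  move=> r0; apply: hasderZ.
  rewrite -[X in _ + X]mulr1; apply: hasderD; apply: hasderZ; last exact: hasder_id.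
  exact: hasder_growth.
have := ray_comparison dA A0 dPhi (z := z); rewrite growth0 mulr1 mulr0 addr0.
have n0 := normc_ge0 z; have E0 := growth_gt0 G B n (normc z).
have B1 t : 0 <= t <= 1 -> normc (F (t%:C * z)) <=
    M * (G^-1 * dg (t * normc z) + K).
  move=> t01; have t0 : 0 <= t * normc z by case/andP: t01 => ? _; rewrite mulr_ge0.
  by rewrite (le_trans (H t t01)) // ler_wpM2l // [G^-1 * _]mulrC KP.
move=> /(_ B1) /le_trans; apply.
have rL := le_growth B n G0 n0; rewrite -/L in rL.
have -> : 2 * (G^-1 + K * L) * M * growth G B n (normc z) =
  2 * (M * (G^-1 * growth G B n (normc z) + K * (L * growth G B n (normc z)))) by ring.
rewrite ler_pM2l // -mulrBr ler_wpM2l // lerBlDr -[leLHS]addr0 -addrA addr0 -addrA.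
rewrite lerD2l; apply: (@le_trans _ _ (K * (L * growth G B n (normc z)))).
  by rewrite ler_wpM2l.
by rewrite lerDl invr_ge0 ltW.
Qed.

End RadialGrowth.

(** * The weight, its kernels, and local estimates *)

Section Weight.
Variable R : realType.
Local Notation C := R[i].
Local Notation Re := (@complex.Re R).
Local Notation Im := (@complex.Im R).
Variable m : nat.
Implicit Types (z w : C) (F : C -> C).

Definition wt z := expR (- psi m z).

Lemma wt_gt0 z : 0 < wt z. Proof. exact: expR_gt0. Qed.

Lemma wtE z : wt z = (1 + normc z) ^+ m * expR (- (normc z ^+ 2 / 2)).
Proof.
have n0 := normc_ge0 z; have p : 0 < 1 + normc z by lra.
rewrite -{1}[1 + normc z]lnK ?posrE // -expRM_natl -expRD /wt /psi.
by congr expR; ring.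
Qed.

Lemma wt_growth z : wt z * growth (1 / 2) 0 m%:R (normc z) = 1.
Proof.
rewrite /wt /growth /psi -expRD [X in expR X](_ : _ = 0) ?expR0 //.
by field.
Qed.

Lemma le_wt_growth z a M : (a * wt z <= M) = (a <= M * growth (1 / 2) 0 m%:R (normc z)).
Proof.
have W := wt_growth z; have W0 := wt_gt0 z.
have G0 := growth_gt0 (1 / 2) 0 m%:R (normc z).
by rewrite -(ler_pM2r G0) -mulrA W mulr1.
Qed.

Lemma normc_sqrB z w :
  normc (z - w) ^+ 2 = normc z ^+ 2 + normc w ^+ 2 - 2 * Re (conjc w * z).
Proof. by rewrite !normc_sqr; case: z => a b; case: w => c d /=; ring. Qed.

(** Completing the square in [normc (z - w) ^+ 2]. Both the size of [kern] and the flattening effect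
    of [gauge] are read off from this identity. *)
Lemma wt_shift z w : wt z * expR (Re (conjc w * z) - normc w ^+ 2) =
  wt w * (expR (- (normc (z - w) ^+ 2 / 2)) * ((1 + normc z) / (1 + normc w)) ^+ m).
Proof.
have n0 := normc_ge0 w; have p : 1 + normc w != 0 by rewrite gt_eqF //; lra.
rewrite !wtE exprMn exprVn normc_sqrB.
have -> : (1 + normc w) ^+ m * expR (- (normc w ^+ 2 / 2)) *
  (expR (- ((normc z ^+ 2 + normc w ^+ 2 - 2 * Re (conjc w * z)) / 2)) *
    ((1 + normc z) ^+ m / (1 + normc w) ^+ m)) =
  (1 + normc z) ^+ m * (expR (- (normc w ^+ 2 / 2)) *
  expR (- ((normc z ^+ 2 + normc w ^+ 2 - 2 * Re (conjc w * z)) / 2))).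
  by field; rewrite expf_neq0.
by rewrite -mulrA -!expRD; congr (_ * expR _); field.
Qed.

Lemma normc_ratio_le z w : (1 + normc z) / (1 + normc w) <= 1 + normc (z - w).
Proof.
have n0 := normc_ge0 w; have n1 := normc_ge0 (z - w).
rewrite ler_pdivrMr; last by lra.
have := le_normcD (z - w) w; rewrite subrK => H.
have := mulr_ge0 n1 n0; rewrite mulrDl mul1r mulrDr mulr1.
by move: (normc z) (normc w) (normc (z - w)) (_ * _) H => *; lra.
Qed.

Definition bump (d : R) := expR (- (d ^+ 2 / 2)) * (1 + d) ^+ m.

(* The normalised reproducing kernel of the classical Fock space. *)
Definition kern w z : C := cexp (conjc w * z) * (expR (- normc w ^+ 2) / wt w)%:C.

Lemma normc_kern_wt w z : normc (kern w z) * wt z =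
  expR (- (normc (z - w) ^+ 2 / 2)) * ((1 + normc z) / (1 + normc w)) ^+ m.
Proof.
have W0 := wt_gt0 w; rewrite /kern normcM normc_cexp normc_real.
rewrite ger0_norm; last by rewrite divr_ge0 ?expR_ge0 // ltW.
have := wt_shift z w; rewrite expRD; move: (_ * _ ^+ m) => X.
move=> E; apply: (mulfI (lt0r_neq0 W0)); rewrite -E.
by field; rewrite gt_eqF.
Qed.

Lemma kern_bound w z : normc (kern w z) * wt z <= bump (normc (z - w)).
Proof.
rewrite normc_kern_wt ler_wpM2l ?expR_ge0 // lerXn2r ?nnegrE //.
- by rewrite divr_ge0 // addr_ge0 ?normc_ge0.
- by rewrite addr_ge0 ?normc_ge0.
- exact: normc_ratio_le.
Qed.

Lemma kern_diag w : normc (kern w w) * wt w = 1.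
Proof.
rewrite normc_kern_wt subrr normc0 expr2 !mul0r oppr0 expR0 mul1r divff ?expr1n //.
by rewrite gt_eqF // ltr_pwDl ?normc_ge0.
Qed.

Lemma hasder_linear (k z : C) : hasder (fun z : C => k * z) z k.
Proof. by rewrite -[X in hasder _ _ X]mulr1; apply: hasderZ; exact: hasder_id. Qed.

Lemma entire_kern w : entire (kern w).
Proof.
have d z := hasderM (hasder_cexp_comp (hasder_linear (conjc w) z))
  (hasder_cst (expR (- normc w ^+ 2) / wt w)%:C z).
exact: (hasder_entire d).1.
Qed.

(* Multiplying by a character makes the weight almost constant near [w]. *)
Definition gauge F w z : C :=
  F z * cexp (- conjc w * z) * (expR (normc w ^+ 2) * wt w)%:C.

Lemma normc_gauge F w z : normc (F z) * wt z = normc (gauge F w z) *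
  (expR (- (normc (z - w) ^+ 2 / 2)) * ((1 + normc z) / (1 + normc w)) ^+ m).
Proof.
have W0 := wt_gt0 w; rewrite /gauge !normcM normc_cexp normc_real.
rewrite ger0_norm; last by rewrite mulr_ge0 ?expR_ge0 // ltW.
have := wt_shift z w; rewrite expRD; move: (_ * _ ^+ m) => X E.
transitivity (normc (F z) * expR (Re (- conjc w * z)) * expR (normc w ^+ 2) * (wt w * X));
  last by ring.
rewrite -E mulNr ReN !expRN.
have e1 := gt_eqF (expR_gt0 (Re (conjc w * z))).
have e2 := gt_eqF (expR_gt0 (normc w ^+ 2)).
by field; rewrite e1 e2.
Qed.

Lemma normc_gauge_diag F w : normc (gauge F w w) = normc (F w) * wt w.
Proof.
rewrite (normc_gauge F w w) subrr normc0 expr2 !mul0r oppr0 expR0 mul1r divff ?expr1n ?mulr1 //.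
by rewrite gt_eqF // ltr_pwDl ?normc_ge0.
Qed.

(** On the unit disc at [w] the Gaussian is at least [1 / 2], and the ratio of [1 + normc z] to
    [1 + normc w] lies between [1 / 2] and 2. *)
Definition gauge_cst : R := 2 * 2 ^+ m.

Lemma gauge_cst_ge1 : 1 <= gauge_cst.
Proof. by rewrite /gauge_cst -exprS exprn_ege1 // ler1n. Qed.

Lemma gauge_factor w z : normc (z - w) <= 1 -> gauge_cst^-1 <=
  expR (- (normc (z - w) ^+ 2 / 2)) * ((1 + normc z) / (1 + normc w)) ^+ m <= gauge_cst.
Proof.
move=> d1; have d0 := normc_ge0 (z - w); have w0 := normc_ge0 w; have z0 := normc_ge0 z.
have r1 := normc_ratio_le z w; have r2 := normc_ratio_le w z.
rewrite normc_distC in r2.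
have rp : 0 < (1 + normc z) / (1 + normc w) by rewrite divr_gt0 //; lra.
have q1 : (1 + normc z) / (1 + normc w) <= 2 by lra.
have q2 : 2^-1 <= (1 + normc z) / (1 + normc w).
  rewrite -[leRHS]invrK lef_pV2 ?posrE ?invr_gt0 // invf_div; lra.
have e1 : expR (- (normc (z - w) ^+ 2 / 2)) <= 1.
  by rewrite -expR0 ler_expR oppr_le0 divr_ge0 ?sqr_ge0.
have e2 : 2^-1 <= expR (- (normc (z - w) ^+ 2 / 2)).
  have dd : normc (z - w) ^+ 2 <= 1 by rewrite expr_le1.
  by apply: le_trans (expR_ge1Dx _); lra.
apply/andP; split.
  rewrite /gauge_cst invfM -exprVn ler_pM ?invr_ge0 // ?exprn_ge0 ?invr_ge0 //.
  by rewrite lerXn2r // nnegrE ?invr_ge0 // ltW.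
apply: (@le_trans _ _ (1 * 2 ^+ m)).
  rewrite ler_pM ?expR_ge0 ?exprn_ge0 ?(ltW rp) //.
  by rewrite lerXn2r // nnegrE // ltW.
by rewrite /gauge_cst ler_wpM2r ?exprn_ge0 // ler1n.
Qed.

Lemma le_gauge F w z : normc (z - w) <= 1 ->
  normc (gauge F w z) <= gauge_cst * (normc (F z) * wt z).
Proof.
move=> /gauge_factor /andP[H _]; rewrite (normc_gauge F w).
have g0 : 0 < gauge_cst by apply: lt_le_trans gauge_cst_ge1.
by rewrite mulrCA ler_peMr ?normc_ge0 // -ler_pdivrMl // mulr1.
Qed.

Lemma hasder_gauge F w z : entire F -> hasder (gauge F w) z
  ((cderiv F z - F z * conjc w) * cexp (- conjc w * z) * (expR (normc w ^+ 2) * wt w)%:C).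
Proof.
move=> eF; apply: hasder_eq (hasderM (hasderM (entire_hasder z eF)
  (hasder_cexp_comp (hasder_linear (- conjc w) z))) (hasder_cst _ z)) => //.
by ring.
Qed.

Lemma entire_gauge F w : entire F -> entire (gauge F w).
Proof. by move=> eF; exact: (hasder_entire (fun z => hasder_gauge w z eF)).1. Qed.

(** Cauchy's estimate for [gauge F w] on the unit disc controls [cderiv F w - F w * conjc w]; moving
    the second term to the other side is what costs [1 + normc w]. *)
Lemma derivative_weight_bound F w S : entire F ->
  (forall z, normc (z - w) <= 1 -> normc (F z) * wt z <= S) ->
  normc (cderiv F w) * wt w <= 16 * gauge_cst * S * (1 + normc w).
Proof.
move=> eF H; have g1 := gauge_cst_ge1.
have S0 : 0 <= S.
  apply: le_trans (H w _); last by rewrite subrr normc0.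
  by rewrite mulr_ge0 ?normc_ge0 // ltW // wt_gt0.
have g0 : 0 < gauge_cst by apply: lt_le_trans g1.
have dg : cderiv (gauge F w) w = (cderiv F w - F w * conjc w) *
    cexp (- conjc w * w) * (expR (normc w ^+ 2) * wt w)%:C.
  exact: (congr1 (@^~ w) (hasder_entire (fun z => hasder_gauge w z eF)).2).
have ndg : normc (cderiv (gauge F w) w) = normc (cderiv F w - F w * conjc w) * wt w.
  rewrite dg !normcM normc_cexp normc_real ger0_norm; last first.
    by rewrite mulr_ge0 ?expR_ge0 // ltW // wt_gt0.
  have -> : Re (- conjc w * w) = - normc w ^+ 2 by rewrite mulNr mulrC mulc_conj.
  move: (normc (_ - _)) (normc w ^+ 2) => X y.
  by rewrite expRN; field; rewrite gt_eqF // expR_gt0.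
have B : normc (cderiv F w - F w * conjc w) * wt w <= 16 * (gauge_cst * S).
  rewrite -ndg.
  have := cauchy_estimate (w := w) (M := gauge_cst * S) (entire_gauge (w := w) eF) ltr01.
  rewrite divr1; apply=> z zw.
  by apply: le_trans (le_gauge F zw) _; rewrite ler_pM2l //; exact: H.
have FS : normc (F w) * wt w <= S by apply: H; rewrite subrr normc0.
have := le_normcD (cderiv F w - F w * conjc w) (F w * conjc w).
rewrite subrK normcM normc_conj => T.
have := ler_wpM2r (ltW (wt_gt0 w)) T; rewrite mulrDl => /le_trans; apply.
have w0 := normc_ge0 w.
have X : normc (F w) * normc w * wt w <= 16 * gauge_cst * S * normc w.
  rewrite mulrAC ler_wpM2r // (le_trans FS) //.
  by rewrite ler_peMl // mulr_ege1 // ler1n.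
by rewrite [leRHS]mulrDr mulr1 lerD // -mulrA.
Qed.

(* Hardy and Littlewood's device: where [(1 - |z - w|)^(2/p) |gauge F w|] is
   nearly maximal, the function is comparable to a constant on a disc of radius
   proportional to the distance to the unit circle. *)
Theorem local_mass (p : R) : 0 < p -> exists2 c, 0 < c &
  forall F w, entire F -> exists z1 r l,
    [/\ 0 < r, normc (z1 - w) + 2 * r <= 1, 0 <= l,
        forall z, normc (z - z1) <= 2 * r -> l <= normc (F z) * wt z &
        c * (normc (F w) * wt w) `^ p <= l `^ p * r ^+ 2].
Proof.
move=> p0; have g1 := gauge_cst_ge1.
have g0 : 0 < gauge_cst by apply: lt_le_trans g1.
pose A : R := 2 * 2 `^ (2 / p).
have A0 : 0 < A by rewrite mulr_gt0 // powR_gt0.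
pose c := (2^-1 `^ p) * (2 * gauge_cst)^-1 `^ p * (32 * (16 * A)) ^- 2.
have A16 : 0 < 32 * (16 * A) by rewrite mulr_gt0 // mulr_gt0.
have cp : 0 < (2 * gauge_cst)^-1 `^ p * (32 * (16 * A)) ^- 2.
  by apply: mulr_gt0; [rewrite powR_gt0 // invr_gt0 mulr_gt0|rewrite invr_gt0 exprn_gt0].
have c0 : 0 < c.
  by rewrite /c -mulrA; apply: mulr_gt0 cp; rewrite powR_gt0 // invr_gt0.
exists c => // F w eF; set N := normc (F w) * wt w.
have N0 : 0 <= N by rewrite mulr_ge0 ?normc_ge0 // ltW // wt_gt0.
(* If [F] vanishes at [w], the level [l = 0] works on any disc inside the unit disc. *)
have [N00|Np] := leP N 0.
  exists w, (4^-1), 0; have -> : N = 0 by apply/eqP; rewrite eq_le N00.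
  rewrite subrr normc0; split => //; [by lra| |].
    by move=> z _; rewrite mulr_ge0 ?normc_ge0 // ltW // wt_gt0.
  by rewrite !powR0 ?gt_eqF // mulr0 mul0r.
pose H := gauge F w; have eH : entire H by exact: entire_gauge.
have HN : normc (H w) = N by exact: normc_gauge_diag.
(* The exponent [2 / p] is chosen so that the [p]-th power of the distance factor is a squared
   radius, that is, an area. *)
pose u z := (1 - normc (z - w)) `^ (2 / p) * normc (H z).
have [M M0 HM] := pcont_bounded (normc w + 1) (entire_pcontinuous eH).
pose D := [set z : C | normc (z - w) <= 1].
have uM z : D z -> u z <= M.
  move=> zw; rewrite -[M]mul1r ler_pM ?powR_ge0 ?normc_ge0 //.
    rewrite [leRHS](_ : 1 = 1 `^ (2 / p)) ?powR1 // -[leRHS](congr1 (@^~ (2 / p)) (powR1 R))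
      ge0_ler_powR ?nnegrE ?divr_ge0 ?(ltW p0) ?subr_ge0 //.
    by rewrite lerBlDr lerDl normc_ge0.
  apply: HM; have := le_normcD (z - w) w; rewrite subrK => /le_trans; apply.
  by rewrite addrC lerD2l.
have Dw : D w by rewrite /D /= subrr normc0.
have supE : has_sup (u @` D) by split; [exists (u w); exists w|exists M => _ [z /uM uz <-]].
set S := sup (u @` D).
have uS z : D z -> u z <= S by move=> Dz; apply: sup_upper_bound => //; exists z.
have uw : u w = N by rewrite /u subrr normc0 subr0 powR1 mul1r HN.
have SN : N <= S by rewrite -uw uS.
have S0 : 0 < S by apply: lt_le_trans SN.
have [_ [z0 Dz0 <-] z0S] : exists2 y, (u @` D) y & S / 2 < y.
  have := sup_adherent (divr_gt0 S0 (ltr0n R 2)) supE => -[y uy].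
  by rewrite -/S => yS; exists y => //; apply: le_lt_trans yS; lra.
set d := 1 - normc (z0 - w).
have d0 : 0 < d.
  rewrite lt_def subr_ge0 Dz0 andbT; apply/negP => /eqP d00.
  by move: z0S; rewrite /u -/d d00 powR0 ?mul0r ?gt_eqF ?divr_gt0 //; lra.
pose r0 := d / 2; have r00 : 0 < r0 by rewrite divr_gt0.
have H00 : 0 < normc (H z0).
  rewrite lt_def normc_ge0 andbT; apply/negP => /eqP h0.
  by move: z0S; rewrite /u h0 mulr0; lra.
have HA z : normc (z - z0) <= r0 -> normc (H z) <= A * normc (H z0).
  move=> zr; have zw : normc (z - w) <= 1 - r0.
    have := normc_triangle z0 z w; rewrite /r0 /d in zr *.
    by move: (normc (z - w)) (normc (z - z0)) (normc (z0 - w)) zr => *; lra.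
  have : r0 `^ (2 / p) * normc (H z) <= S.
    apply: (le_trans _ (uS z _)); last by rewrite /D /=; lra.
    rewrite ler_wpM2r ?normc_ge0 // ge0_ler_powR ?nnegrE ?divr_ge0 ?(ltW p0) ?(ltW r00) //; lra.
  have : S <= 2 * u z0 by lra.
  have E : 2 * u z0 = r0 `^ (2 / p) * (A * normc (H z0)).
    rewrite /u -/d; have -> : d = 2 * r0 by rewrite /r0; field.
    by rewrite powRM // ?(ltW r00) // /A; ring.
  by rewrite E => s1 s2; have := le_trans s2 s1; rewrite ler_pM2l // powR_gt0.
(* With this radius the mean value inequality and Cauchy's estimate on discs of radius [r0 / 2] let
   [H] vary by at most [normc (H z0) / 2] within [2 * r] of [z0]. *)
pose r := r0 / (16 * (16 * A)); have A2 : 2 <= A.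
  have : 2 `^ 0 <= 2 `^ (2 / p) :> R by rewrite ler_powR ?ler1n // divr_ge0 // ltW.
  by rewrite powRr0 => q1; rewrite /A ler_peMr.
have r_gt0 : 0 < r by rewrite divr_gt0 // mulr_gt0 // mulr_gt0.
have rr0 : 2 * r * (16 * (8 * A)) = r0 by rewrite /r; field; rewrite gt_eqF.
have r2 : 2 * r <= r0 / 2.
  have -> : r0 / 2 = 2 * r * (8 * (8 * A)) by rewrite -rr0; field.
  have tr : 0 <= 2 * r by rewrite mulr_ge0 // ltW.
  by rewrite ler_peMr //; move: A2; move: (A) => B; lra.
have near z : normc (z - z0) <= 2 * r -> normc (H z0) / 2 <= normc (H z).
  move=> zr; have B : normc (H z - H z0) <= 2 * (16 * (A * normc (H z0)) / (r0 / 2)) * normc (z - z0).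
    apply: (normc_mvt (fun v => entire_hasder v eH)) => t /andP[t0 t1].
    apply: cauchy_estimate => // [|v vz]; first by rewrite divr_gt0.
    apply: HA; apply: le_trans (normc_triangle (z0 + t%:C * (z - z0)) _ _) _.
    have -> : r0 = r0 / 2 + r0 / 2 by field.
    apply: lerD => //; rewrite addrAC subrr add0r normcM normc_real ger0_norm //.
    by rewrite (le_trans _ r2) // (le_trans _ zr) // ler_piMl ?normc_ge0.
  have : normc (H z - H z0) <= normc (H z0) / 2.
    apply: le_trans B _; apply: (@le_trans _ _ (2 * (16 * (A * normc (H z0)) / (r0 / 2)) * (2 * r))).
      apply: ler_wpM2l => //; apply: mulr_ge0 => //; apply: divr_ge0.
        by apply: mulr_ge0 => //; apply: mulr_ge0; [exact: ltW|exact: ltW].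
      by apply: divr_ge0 => //; exact: ltW.
    rewrite le_eqVlt; apply/orP; left; apply/eqP; rewrite -rr0.
    by field; rewrite !gt_eqF.
  have := le_normcD (H z) (H z0 - H z); rewrite addrC subrK normc_distC.
  by move: (normc (H z - H z0)) (normc (H z)) (normc (H z0)) => *; lra.
exists z0, r, (normc (H z0) / 2 / gauge_cst); split => //.
- have : normc (z0 - w) = 1 - 2 * r0 by rewrite /r0 /d; field.
  by move=> ->; lra.
- by rewrite divr_ge0 ?divr_ge0 ?normc_ge0 // ltW.
- move=> z zr; rewrite ler_pdivrMr // [leRHS]mulrC.
  have zw : normc (z - w) <= 1.
    apply: le_trans (normc_triangle z0 _ _) _.
    have : normc (z0 - w) = 1 - 2 * r0 by rewrite /r0 /d; field.
    by move=> ->; move: (normc (z - z0)) zr => *; lra.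
  by rewrite (le_trans (near z zr)) // le_gauge.
(* Near-maximality is compared with [u w = N]; what remains is arithmetic, [r] being a fixed
   fraction of [r0]. *)
have uP : (2^-1 * N) `^ p <= normc (H z0) `^ p * (2 * r0) ^+ 2.
  have -> : normc (H z0) `^ p * (2 * r0) ^+ 2 = u z0 `^ p.
    rewrite /u powRM ?powR_ge0 ?normc_ge0 // mulrC; congr (_ * _).
    rewrite -powRrM divfK ?gt_eqF // -[in RHS](_ : 2 * r0 = 1 - normc (z0 - w)).
      by rewrite powR_mulrn // mulr_ge0 // ltW.
    by rewrite /r0 /d; field.
  apply: ge0_ler_powR; [exact: ltW|by rewrite nnegrE mulr_ge0|
    by rewrite nnegrE mulr_ge0 ?powR_ge0 ?normc_ge0|].
  by apply: le_trans (ltW z0S); rewrite mulrC ler_pM2r.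
rewrite powRM ?invr_ge0 // in uP.
have -> : normc (H z0) / 2 / gauge_cst = (2 * gauge_cst)^-1 * normc (H z0).
  by field; rewrite gt_eqF.
have -> : ((2 * gauge_cst)^-1 * normc (H z0)) `^ p =
    (2 * gauge_cst)^-1 `^ p * normc (H z0) `^ p.
  by rewrite powRM ?normc_ge0 // invr_ge0 mulr_ge0 // ltW.
have -> : c * N `^ p = (2 * gauge_cst)^-1 `^ p * (32 * (16 * A)) ^- 2 * (2^-1 `^ p * N `^ p).
  by rewrite /c; ring.
have -> : (2 * gauge_cst)^-1 `^ p * normc (H z0) `^ p * r ^+ 2 =
   (2 * gauge_cst)^-1 `^ p * (32 * (16 * A)) ^- 2 * (normc (H z0) `^ p * (2 * r0) ^+ 2).
  by rewrite /r; field; rewrite gt_eqF.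
by rewrite ler_pM2l.
Qed.

End Weight.

(** * Locally uniform limits and Montel's theorem *)

Section LocallyUniformLimits.
Variable R : realType.
Local Notation C := R[i].
Local Notation Re := (@complex.Re R).
Local Notation Im := (@complex.Im R).
Implicit Types (u : nat -> C -> C) (f : C -> C) (z w : C) (r e : R).

Definition loc_unif u f := forall r e, 0 < e ->
  exists N, forall n, (N <= n)%N -> forall z, normc z <= r -> normc (u n z - f z) <= e.

Lemma entire_sub f g : entire f -> entire g -> entire (fun z => f z - g z) /\
  cderiv (fun z => f z - g z) = fun z => cderiv f z - cderiv g z.
Proof.
move=> ef eg.
exact: (hasder_entire (fun z => hasderB (entire_hasder z ef) (entire_hasder z eg))).
Qed.

(** Cauchy's estimate turns uniform closeness of [u n] and [u k] into closeness of derivatives, so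
    the derivatives at [z] have a limit, and [u n - f] is Lipschitz near [z] with a small
    constant. *)
Theorem loc_unif_entire u f : (forall n, entire (u n)) -> loc_unif u f -> entire f.
Proof.
move=> eu lu; suff H z : exists l, hasder f z l.
  by have [df dP] := choice H; exact: (hasder_entire dP).1.
pose good (p : nat * R) := 0 < p.2 /\ forall k, (p.1 <= k)%N ->
  forall w, normc w <= normc z + 2 -> normc (u k w - f w) <= p.2.
have goodE e : 0 < e -> exists n, good (n, e).
  by move=> e0; have [N NP] := lu (normc z + 2) e e0; exists N.
have near p q k w : good p -> good q -> (p.1 <= k)%N -> (q.1 <= k)%N ->
    normc w <= normc z + 2 -> normc (u p.1 w - u q.1 w) <= p.2 + q.2.
  move=> [p0 P] [q0 Q] _ _ wz; apply: le_trans (normc_triangle (f w) _ _) _.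
  by rewrite lerD ?P // normc_distC Q.
have sub k j := entire_sub (eu k) (eu j).
have dnear p q w : good p -> good q -> normc w <= normc z + 1 ->
    normc (cderiv (u p.1) w - cderiv (u q.1) w) <= 16 * p.2 + 16 * q.2.
  move=> gp gq wz; have [es ds] := sub p.1 q.1.
  have := cauchy_estimate (w := w) (M := p.2 + q.2) es ltr01.
  rewrite ds divr1 mulrDr; apply=> v vw; apply: (near _ _ (maxn p.1 q.1)) => //.
  - exact: leq_maxl.
  - exact: leq_maxr.
  - by have := le_normcD (v - w) w; rewrite subrK; lra.
have [n1 g1] := goodE 1 ltr01.
have zz : normc z <= normc z + 1 by rewrite lerDl.
have [x xP] : exists x, forall p, good p -> `|Re (cderiv (u p.1) z) - x| <= 16 * p.2.
  apply: squeeze_limit => [|p q gp gq]; first by exists (n1, 1).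
  apply: norm_le_sub; rewrite -ReN -ReD.
  exact: le_trans (Re_le_normc _) (dnear p q z gp gq zz).
have [y yP] : exists y, forall p, good p -> `|Im (cderiv (u p.1) z) - y| <= 16 * p.2.
  apply: squeeze_limit => [|p q gp gq]; first by exists (n1, 1).
  apply: norm_le_sub; rewrite -ImN -ImD.
  exact: le_trans (Im_le_normc _) (dnear p q z gp gq zz).
exists (x +i* y); apply/hasder_normcP => eta eta0.
(* The three errors below are [32 * e], [64 * e] and [e] times [normc h], less than [256 * e] in
   all. *)
pose e := eta / (16 * 16); have e0 : 0 < e by rewrite divr_gt0.
have [n gn] := goodE e e0.
have /hasder_normcP /(_ e e0)[d d0 dP] := entire_hasder z (eu n).
exists (Num.min d 1); first by rewrite lt_min d0 ltr01.
move=> w; rewrite lt_min => /andP[wd w1]; set h := w - z.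
have h1 : normc h <= 1 by exact: ltW.
have A1 : normc (cderiv (u n) z - (x +i* y)) <= 32 * e.
  apply: le_trans (normc_le_ReIm _) _; rewrite ReD ImD ReN ImN /=.
  apply: le_trans (lerD (xP _ gn) (yP _ gn)) _.
  by rewrite -mulrDl /=; apply: ler_wpM2r; [exact: ltW|lra].
(* As [f] is not yet known to be differentiable, it is replaced by some [u k], to which the mean
   value inequality applies, at an arbitrarily small cost [e1]. *)
have A2 : normc ((u n w - f w) - (u n z - f z)) <= 64 * e * normc h.
  apply/ler_addgt0Pl => e1 e10; have e2 : 0 < Num.min e (e1 / 2) by rewrite lt_min e0 divr_gt0.
  have [k gk] := goodE _ e2; have [es ds] := sub n k.
  have M1 : normc ((u n w - u k w) - (u n z - u k z)) <= 64 * e * normc h.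
    have -> : 64 * e * normc h = 2 * (32 * e) * normc h by ring.
    apply: (normc_mvt (fun v => entire_hasder v es)) => t t01; rewrite ds.
    have zt : normc (z + t%:C * (w - z)) <= normc z + 1 by apply: normc_segment.
    apply: le_trans (dnear _ _ _ gn gk zt) _ => /=.
    have : Num.min e (e1 / 2) <= e by rewrite ge_min lexx.
    by move: (Num.min _ _) => a; lra.
  have kf v : normc v <= normc z + 2 -> normc (u k v - f v) <= e1 / 2.
    move=> vz; apply: le_trans (gk.2 k (leqnn k) v vz) _ => /=.
    by rewrite ge_min lexx orbT.
  have wz : normc w <= normc z + 2.
    by have := le_normcD (w - z) z; rewrite subrK -/h; move: h1; lra.
  have zz2 : normc z <= normc z + 2 by rewrite lerDl.
  have -> : (u n w - f w) - (u n z - f z) = ((u n w - u k w) - (u n z - u k z)) +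
     ((u k w - f w) - (u k z - f z)) by ring.
  apply: le_trans (le_normcD _ _) _; rewrite addrC; apply: lerD => //.
  apply: le_trans (normcB _ _) _; rewrite [leRHS](_ : _ = e1 / 2 + e1 / 2); last by field.
  by apply: lerD; exact: kf.
have A3 := dP w wd; rewrite -/h in A3.
have -> : f w - f z - (x +i* y) * h = (u n w - u n z - cderiv (u n) z * h) -
   ((u n w - f w) - (u n z - f z)) + (cderiv (u n) z - (x +i* y)) * h by ring.
apply: le_trans (le_normcD _ _) _; rewrite normcM.
apply: le_trans (lerD (le_trans (normcB _ _) (lerD A3 A2)) (ler_wpM2r (normc_ge0 h) A1)) _.
rewrite -!mulrDl; apply: ler_wpM2r; first exact: normc_ge0.
have -> : eta = 16 * 16 * e by rewrite /e; field.
by move: (e) e0 => a a0; lra.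
Qed.

Lemma finite_net r e : 0 < e ->
  exists ps : seq C, forall z, normc z <= r -> exists2 p, p \in ps & normc (z - p) <= e.
Proof.
move=> e0; have [r0|r0] := ltP r 0.
  by exists [::] => z zr; have := le_lt_trans zr r0; rewrite ltNge normc_ge0.
have [ps psP] : exists ps : seq C, forall z, in_rect (square r) z ->
    exists2 p, p \in ps & normc (z - p) <= e.
  apply: (@rect_bisection _ (fun q => exists ps : seq C, forall z, in_rect q z ->
    exists2 p, p \in ps & normc (z - p) <= e)).
  - exact: wf_square.
  - move=> q _ H.
    have [s1 H1] := H _ (or_introl erefl).
    have [s2 H2] := H _ (or_intror (or_introl erefl)).
    have [s3 H3] := H _ (or_intror (or_intror (or_introl erefl))).
    have [s4 H4] := H _ (or_intror (or_intror (or_intror (or_introl erefl)))).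
    exists (s1 ++ s2 ++ s3 ++ s4) => z /andP[/andP[za zb] /andP[zc zd]].
    have [zx|zx] := leP (Re z) ((rl q + rr q) / 2);
      have [zy|zy] := leP (Im z) ((rb q + rt q) / 2).
    + have [|p ps pz] := H1 z; first by rewrite /in_rect /= za zx zc zy.
      by exists p => //; rewrite mem_cat ps.
    + have [|p ps pz] := H3 z; first by rewrite /in_rect /= za zx (ltW zy) zd.
      by exists p => //; rewrite !mem_cat ps !orbT.
    + have [|p ps pz] := H2 z; first by rewrite /in_rect /= (ltW zx) zb zc zy.
      by exists p => //; rewrite !mem_cat ps !orbT.
    + have [|p ps pz] := H4 z; first by rewrite /in_rect /= (ltW zx) zb (ltW zy) zd.
      by exists p => //; rewrite !mem_cat ps !orbT.
  - move=> p _; exists e => // q _ _ pq qe; exists [:: p] => z zq.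
    by exists p; rewrite ?mem_head // (le_trans (in_rect_dist zq pq)) // ltW.
exists ps => z zr; apply: psP; rewrite /in_rect /= -!ler_norml.
by rewrite !(le_trans _ zr) ?Re_le_normc ?Im_le_normc.
Qed.

(* A cluster point for the topology of pointwise convergence, from Tychonoff. *)
Lemma pointwise_cluster u (B : C -> R) : (forall n z, normc (u n z) <= B z) ->
  exists f, forall (ps : seq C) e N, 0 < e ->
    exists2 n, (N <= n)%N & forall p, p \in ps -> normc (u n p - f p) < e.
Proof.
move=> uB.
(* The Boolean selects the real or the imaginary part, so that each coordinate stays in a compact
   real interval. *)
pose x n : prod_topology (fun _ : C * bool => R) :=
  fun q => if q.2 then Re (u n q.1) else Im (u n q.1).
have cpt := @tychonoff (C * bool)%type (fun _ => R)
  (fun q => `[- B q.1, B q.1]%classic) (fun q => @segment_compact R _ _).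
have xA : (x @ \oo) [set f | forall q, `[- B q.1, B q.1]%classic (f q)].
  exists 0%N => // n _ -[z b] /=; rewrite in_itv /= -ler_norml /x /=.
  by case: b; apply: le_trans _ (uB n z); [exact: Re_le_normc|exact: Im_le_normc].
have [phi [_ phiP]] := cpt (x @ \oo) _ xA.
exists (fun z => phi (z, true) +i* phi (z, false)) => ps e N e0.
have nb : nbhs phi [set psi | forall p, p \in ps -> forall b, `|psi (p, b) - phi (p, b)| < e / 2].
  elim: ps => [|p ps IH]; first by apply: filterE => psi p; rewrite in_nil.
  have one b : nbhs phi [set psi : prod_topology (fun _ : C * bool => R) |
      `|psi (p, b) - phi (p, b)| < e / 2].
    have bn : nbhs (phi (p, b)) (ball (phi (p, b)) (e / 2)).
      exact: (nbhsx_ballx (phi (p, b) : R^o) (e / 2) (divr_gt0 e0 (ltr0n R 2))).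
    have pc := @proj_continuous (C * bool)%type (fun _ => R) (p, b) phi _ bn.
    apply: (@filterS _ (nbhs phi) (nbhs_filter phi) _ _ _ pc).
    move=> psi H.
    have H' : `|phi (p, b) - psi (p, b)| < e / 2 by exact: H.
    by rewrite /mkset distrC.
  apply: filterS (filterI (filterI (one true) (one false)) IH) => psi [[h1 h2] h3] q.
  by rewrite inE => /orP[/eqP -> [] //|/h3].
have xN : (x @ \oo) [set psi | exists2 n, (N <= n)%N & psi = x n].
  by exists N => // n /= Nn; exists n.
have [psi [[n Nn ->] H]] := phiP _ _ xN nb.
exists n => // p pps; apply: le_lt_trans (normc_le_ReIm _) _.
rewrite ReD ImD ReN ImN /=.
have := H p pps true; have := H p pps false; rewrite /x /=.
by move: (`|_|) (`|_|) => a b; lra.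
Qed.

(** Cauchy's estimate gives the [u n], hence also their pointwise cluster point [f], common
    Lipschitz constants on discs. A single choice then suffices: [u (s n)] is close to [f] on a
    finite net, of mesh [1 / (n + 1)], of the disc of radius [n]. *)
Theorem montel u (B : R -> R) : (forall n, entire (u n)) ->
  (forall n r z, normc z <= r -> normc (u n z) <= B r) ->
  exists (s : nat -> nat) f, {homo s : i j / (i < j)%N} /\ loc_unif (fun n => u (s n)) f.
Proof.
move=> eu uB.
have [f fP] := @pointwise_cluster u (fun z => B (normc z)) (fun n z => uB n _ z (lexx _)).
pose L r := 2 * (16 * B (r + 2) / 1).
have L0 r : 0 <= r -> 0 <= L r.
  move=> r0; rewrite /L divr1 !mulr_ge0 //; apply: le_trans (normc_ge0 _) (uB 0%N _ 0 _).
  by rewrite normc0 addr_ge0.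
have uL n r z w : normc z <= r -> normc (w - z) <= 1 ->
    normc (u n w - u n z) <= L r * normc (w - z).
  move=> zr wz; apply: (normc_mvt (fun v => entire_hasder v (eu n))) => t t01.
  apply: (cauchy_estimate (eu n) ltr01) => v vz; apply: uB.
  have zt : normc (z + t%:C * (w - z)) <= r + 1 by apply: normc_segment.
  have := le_normcD (v - (z + t%:C * (w - z))) (z + t%:C * (w - z)); rewrite subrK.
  by move: zt vz; move: (normc (_ + _)) (normc (_ - _)) (normc v) => a b c; lra.
have fL r z w : normc z <= r -> normc (w - z) <= 1 -> normc (f w - f z) <= L r * normc (w - z).
  move=> zr wz; apply/ler_addgt0Pl => e e0.
  have [n _ nP] := fP [:: z; w] (e / 2) 0%N (divr_gt0 e0 (ltr0n R 2)).
  have a1 := nP z (mem_head _ _); have a2 : normc (u n w - f w) < e / 2.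
    by apply: nP; rewrite !inE eqxx orbT.
  have -> : f w - f z = (u n w - u n z) - ((u n w - f w) - (u n z - f z)) by ring.
  apply: le_trans (normcB _ _) _; rewrite addrC; apply: lerD; last exact: uL.
  apply: le_trans (normcB _ _) _; rewrite [leRHS](_ : _ = e / 2 + e / 2); last by field.
  by apply: lerD; exact: ltW.
pose eps (n : nat) : R := n.+1%:R^-1; have eps0 n : 0 < eps n by rewrite invr_gt0.
have /choice[net netP] : forall n : nat, exists ps : seq C, forall z, normc z <= n%:R ->
    exists2 p, p \in ps & normc (z - p) <= eps n.
  by move=> n; exact: finite_net.
have /choice[G GP] : forall q : nat * nat, exists k, (q.2 <= k)%N /\
    forall p, p \in net q.1 -> normc (u k p - f p) < eps q.1.
  by move=> [n N]; have [k kN kP] := fP (net n) (eps n) N (eps0 n); exists k.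
(* Asking for an index of at least [(s n').+1] makes [s] strictly increasing. *)
pose s := fix s n := if n is n'.+1 then G (n, (s n').+1) else G (0%N, 0%N).
have sP n p : p \in net n -> normc (u (s n) p - f p) < eps n.
  by case: n => [|n] /=; [exact: (GP (0%N, 0%N)).2|exact: (GP (n.+1, (s n).+1)).2].
exists s, f; split.
  apply: homo_ltn => [y x z|n]; first exact: ltn_trans.
  exact: (GP (n.+1, (s n).+1)).1.
move=> r e e0; pose r' := `|r|; have r0 : 0 <= r' by rewrite /r' normr_ge0.
have L1 : 0 < 2 * L (r' + 1) + 1 by rewrite ltr_wpDl // mulr_ge0 // L0 // addr_ge0.
have [N1 HN1] : exists N : nat, r' < N%:R.
  by exists (Num.bound r'); exact: archi_boundP.
have [N2 HN2] : exists N : nat, (2 * L (r' + 1) + 1) / e < N%:R.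
  by exists (Num.bound ((2 * L (r' + 1) + 1) / e)); apply: archi_boundP; rewrite divr_ge0 // ltW.
exists (maxn N1 N2) => n; rewrite geq_max => /andP[nN1 nN2] z zr.
have zn : normc z <= n%:R.
  rewrite (le_trans zr) // (le_trans (ler_norm r)) // (le_trans (ltW HN1)) //.
  by rewrite ler_nat.
have [p pn zp] := netP n z zn.
have eps1 : eps n <= 1 by rewrite invf_le1 // ler1n.
have zr' : normc z <= r' by rewrite (le_trans zr) // ler_norm.
have pz1 : normc (z - p) <= 1 by exact: le_trans zp eps1.
have pr : normc p <= r' + 1.
  have := normcB z (z - p); rewrite opprB addrC subrK => /le_trans; apply.
  exact: lerD.
have -> : u (s n) z - f z = (u (s n) z - u (s n) p) + (u (s n) p - f p) - (f z - f p) by ring.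
have b1 := uL (s n) _ _ _ pr pz1; have b2 := ltW (sP n p pn); have b3 := fL _ _ _ pr pz1.
apply: le_trans (le_trans (normcB _ _) (lerD (le_trans (le_normcD _ _) (lerD b1 b2)) b3)) _.
have Lz : L (r' + 1) * normc (z - p) <= L (r' + 1) * eps n.
  by rewrite ler_wpM2l // L0 // addr_ge0.
apply: (@le_trans _ _ ((2 * L (r' + 1) + 1) * eps n)).
  apply: le_trans (lerD (lerD Lz (lexx (eps n))) Lz) _.
  by rewrite le_eqVlt; apply/orP; left; apply/eqP; ring.
rewrite /eps ler_pdivrMr // [leRHS]mulrC -ler_pdivrMr // ltW // (lt_le_trans HN2) //.
by rewrite ler_nat (leq_trans nN2).
Qed.

End LocallyUniformLimits.

(** * The operator [volterra g] under weighted sup bounds *)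

Section VolterraSup.
Variable R : realType.
Local Notation C := R[i].
Local Notation Re := (@complex.Re R).
Local Notation Im := (@complex.Im R).
Variable m : nat.
Implicit Types (z w : C) (f g h : C -> C) (M K S : R).

Local Notation wt := (wt m).
Local Notation kern := (kern m).

Definition wbound f M := forall z, normc (f z) * wt z <= M.

Lemma wbound_ge0 f M : wbound f M -> 0 <= M.
Proof.
by move=> /(_ 0); apply: le_trans; rewrite mulr_ge0 ?normc_ge0 // ltW // wt_gt0.
Qed.

Lemma wboundD f h M K : wbound f M -> wbound h K -> wbound (fun z => f z + h z) (M + K).
Proof.
move=> fM hK z; apply: le_trans (lerD (fM z) (hK z)); rewrite -mulrDl.
by apply: ler_wpM2r; [rewrite ltW // wt_gt0|exact: le_normcD].
Qed.

Lemma wboundZ (k : C) f M : wbound f M -> wbound (fun z => k * f z) (normc k * M).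
Proof. by move=> fM z; rewrite normcM -mulrA ler_wpM2l ?normc_ge0. Qed.

Lemma wboundB f h M K : wbound f M -> wbound h K -> wbound (fun z => f z - h z) (M + K).
Proof.
move=> fM hK; apply: wboundD => // z; rewrite normcN; exact: hK.
Qed.

(** The Gaussian beats every power, by completing the square; the exponents used are 0, 1, 4 and
    [3 / p]. *)
Lemma bump_decay (q : R) : exists2 K, 0 < K &
  forall d, 0 <= d -> bump m d <= K * (1 + d) `^ (- q).
Proof.
exists (expR ((m%:R + `|q|) ^+ 2 / 2)) => [|d d0]; first exact: expR_gt0.
have d1 : 0 < 1 + d by lra.
have /andP[l0 ld] := ln1D_bounds d0.
rewrite /bump -[in X in X ^+ m](lnK d1) -expRM_natl -expRD /powR gt_eqF // -expRD ler_expR.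
have a1 : m%:R * ln (1 + d) <= m%:R * d by rewrite ler_wpM2l.
have a2 : q * ln (1 + d) <= `|q| * d by rewrite mul_le_norm // l0.
have sq := sqr_ge0 (m%:R + `|q| - d).
have E : (m%:R + `|q| - d) ^+ 2 = (m%:R + `|q|) ^+ 2 + d ^+ 2 - 2 * (m%:R * d + `|q| * d) by ring.
rewrite E in sq; rewrite mulNr.
by move: (ln _) (m%:R * d) (`|q| * d) a1 a2 sq => l x y; lra.
Qed.

Lemma bump_bounded : exists2 K : R, 0 < K & forall d, 0 <= d -> bump m d <= K.
Proof.
have [K K0 KP] := bump_decay 0; exists K => // d d0.
by have := KP d d0; rewrite oppr0 powRr0 mulr1.
Qed.

Lemma wbound_kern : exists2 K : R, 0 < K & forall w, wbound (kern w) K.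
Proof.
have [K K0 KP] := bump_bounded; exists K => // w z.
exact: le_trans (kern_bound m w z) (KP _ (normc_ge0 _)).
Qed.

Lemma volterraB g f h : entire g -> entire f -> entire h ->
  volterra g (fun z => f z - h z) = fun z => volterra g f z - volterra g h z.
Proof.
move=> eg ef eh; apply: (eq_primitive (dA := fun z => (f z - h z) * cderiv g z)) => [z|z|].
- exact: (hasder_volterra z (entire_sub ef eh).1 eg).
- rewrite mulrBl; exact: hasderB (hasder_volterra z ef eg) (hasder_volterra z eh eg).
- rewrite volterra0 [X in _ = X - _]volterra0 [X in _ = _ - X]volterra0.
  by rewrite subrr.
Qed.

Lemma volterra_derivative_bound g f K z : entire g -> entire f ->
  (forall w, normc w <= normc z -> normc (f w * cderiv g w) <= K) ->
  normc (volterra g f z) <= 2 * K * normc z.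
Proof.
move=> eg ef H.
have := normc_mvt (z := 0) (w := z) (M := K) (fun u => hasder_volterra u ef eg).
rewrite volterra0 !subr0; apply=> t /andP[t0 t1]; apply: H.
by rewrite add0r normcM normc_real ger0_norm // ler_piMl ?normc_ge0.
Qed.

Lemma volterra_wbound g c : entire g -> 0 <= c ->
  (forall w, normc (cderiv g w) <= c * (1 + normc w)) ->
  exists2 K, 0 <= K & forall f M, entire f -> wbound f M -> wbound (volterra g f) (K * M).
Proof.
move=> eg c0 gc; have [K K0 KP] := @ray_growth R (1 / 2) 0 m%:R ltac:(by rewrite divr_gt0).
exists (K * c) => [|f M ef fM z]; first by rewrite mulr_ge0.
have M0 := wbound_ge0 fM.
rewrite le_wt_growth -(mulrA K).
apply: (KP _ _ z (c * M) (fun u => hasder_volterra u ef eg) (volterra0 g f)).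
  by rewrite mulr_ge0.
move=> t /andP[t0 t1].
have tz : t * normc z = normc (t%:C * z) by rewrite normcM normc_real ger0_norm.
rewrite tz normcM; have := fM (t%:C * z); rewrite le_wt_growth => F1.
apply: le_trans (ler_pM (normc_ge0 _) (normc_ge0 _) F1 (gc _)) _.
by rewrite le_eqVlt; apply/orP; left; apply/eqP; ring.
Qed.

(** [ray_growth] is applied with [m + 1] instead of [m]: by [growth_succ] the factor [1 + r] of its
    hypothesis is then already part of the weight, and the conclusion is better by that factor. *)
Lemma volterra_wdecay g c : entire g -> 0 <= c ->
  (forall w, normc (cderiv g w) <= c) ->
  exists2 K, 0 <= K & forall f M, entire f -> wbound f M ->
    forall z, normc (volterra g f z) * wt z <= K * M / (1 + normc z).
Proof.
move=> eg c0 gc; have [K K0 KP] := @ray_growth R (1 / 2) 0 (m%:R + 1) ltac:(by rewrite divr_gt0).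
exists (K * c) => [|f M ef fM z]; first by rewrite mulr_ge0.
have M0 := wbound_ge0 fM; have z0 := normc_ge0 z.
have z1 : 0 < 1 + normc z by lra.
rewrite ler_pdivlMr // mulrAC le_wt_growth -(growth_succ _ _ _ z0).
set G1 := growth _ _ _ _; have -> : K * c * M * (G1 * (1 + normc z)) = K * (c * M) * G1 * (1 + normc z).
  by ring.
rewrite (ler_pM2r z1) /G1.
apply: (KP _ _ z (c * M) (fun u => hasder_volterra u ef eg) (volterra0 g f)).
  by rewrite mulr_ge0.
move=> t /andP[t0 t1].
have tz : t * normc z = normc (t%:C * z) by rewrite normcM normc_real ger0_norm.
rewrite growth_succ ?mulr_ge0 //.
rewrite tz normcM; have := fM (t%:C * z); rewrite le_wt_growth => F1.
apply: le_trans (ler_pM (normc_ge0 _) (normc_ge0 _) F1 (gc _)) _.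
by rewrite le_eqVlt; apply/orP; left; apply/eqP; ring.
Qed.

Lemma wt_le z r : normc z <= r -> wt z <= (1 + r) ^+ m.
Proof.
move=> zr; have z0 := normc_ge0 z; rewrite wtE -[leRHS]mulr1 ler_pM ?expR_ge0 ?exprn_ge0 //.
- by lra.
- by rewrite lerXn2r ?nnegrE; lra.
- by rewrite -[leRHS]expR0 ler_expR oppr_le0 divr_ge0 ?sqr_ge0.
Qed.

Lemma loc_unif_pointwise (u : nat -> C -> C) f z e : loc_unif u f -> 0 < e ->
  exists N, forall n, (N <= n)%N -> normc (u n z - f z) <= e.
Proof.
by move=> lu e0; have [N NP] := lu (normc z) e e0; exists N => n nN; exact: NP.
Qed.

Lemma loc_unif_wbound (u : nat -> C -> C) f M : loc_unif u f ->
  (forall n, wbound (u n) M) -> wbound f M.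
Proof.
move=> lu uM z; apply/ler_addgt0Pl => e e0.
have W := wt_gt0 m z.
have [N /(_ N (leqnn N)) NP] := loc_unif_pointwise z lu (divr_gt0 e0 W).
have fE : f z = u N z - (u N z - f z) by ring.
have : normc (f z) <= normc (u N z) + normc (u N z - f z) by rewrite {1}fE; exact: normcB.
move=> H; have := ler_wpM2r (ltW W) H; rewrite mulrDl => /le_trans; apply.
rewrite addrC; apply: lerD; last exact: uM.
by rewrite -ler_pdivlMr.
Qed.

(** Far out the decay of [volterra_wdecay] is uniform over functions bounded by [M + M]; on the
    remaining disc the weight is bounded and locally uniform convergence of [u] is enough. *)
Lemma volterra_compact g c (u : nat -> C -> C) f M e : entire g -> 0 <= c ->
  (forall w, normc (cderiv g w) <= c) -> (forall n, entire (u n)) ->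
  (forall n, wbound (u n) M) -> loc_unif u f -> 0 < e ->
  exists N, forall n, (N <= n)%N -> wbound (fun z => volterra g (u n) z - volterra g f z) e.
Proof.
move=> eg c0 gc eu uM lu e0; have ef := loc_unif_entire eu lu.
have fM := loc_unif_wbound lu uM; have M0 := wbound_ge0 fM.
have [K K0 KP] := volterra_wdecay eg c0 gc.
(* Beyond this radius [K * (M + M) / (1 + normc z)] is at most [e]. *)
pose r := K * (M + M) / e; have r0 : 0 <= r by rewrite divr_ge0 ?mulr_ge0 ?addr_ge0 // ltW.
pose D := 2 * c * r * (1 + r) ^+ m + 1.
have D0' : 0 <= 2 * c * r * (1 + r) ^+ m.
  by rewrite mulr_ge0 ?exprn_ge0 ?addr_ge0 // mulr_ge0 // mulr_ge0.
have D0 : 0 < D by rewrite ltr_wpDl.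
have [N NP] := lu r (e / D) (divr_gt0 e0 D0).
exists N => n nN z; have := congr1 (@^~ z) (volterraB eg (eu n) ef); cbv beta => <-.
have ed := (entire_sub (eu n) ef).1.
have [zr|zr] := leP (normc z) r; last first.
  apply: le_trans (KP _ _ ed (wboundB (uM n) fM) z) _.
  have z1 : 0 < 1 + normc z by rewrite ltr_pwDl ?normc_ge0.
  rewrite ler_pdivrMr // [leRHS]mulrC -ler_pdivrMr // -/r.
  by rewrite (le_trans (ltW zr)) // lerDr.
have V : normc (volterra g (fun z => u n z - f z) z) <= 2 * (e / D * c) * normc z.
  apply: (volterra_derivative_bound eg ed) => w wz; rewrite normcM.
  by rewrite ler_pM ?normc_ge0 //; apply: NP => //; exact: le_trans zr.
apply: le_trans (ler_pM (normc_ge0 _) (ltW (wt_gt0 m z)) V (wt_le zr)) _.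
have eD : 0 <= e / D by rewrite divr_ge0 // ltW.
apply: (@le_trans _ _ (e / D * (2 * c * r * (1 + r) ^+ m))).
  have -> : e / D * (2 * c * r * (1 + r) ^+ m) = 2 * (e / D * c) * r * (1 + r) ^+ m by ring.
  rewrite ler_wpM2r ?exprn_ge0 ?addr_ge0 // ler_wpM2l // mulr_ge0 //.
  by rewrite mulr_ge0.
by rewrite mulrAC ler_pdivrMr // ler_wpM2l ?(ltW e0) // /D lerDl.
Qed.

Lemma volterra_kern_bound g w S : entire g -> wbound (volterra g (kern w)) S ->
  normc (cderiv g w) <= 16 * gauge_cst R m * S * (1 + normc w).
Proof.
move=> eg VS; have ek : entire (kern w) by exact: entire_kern.
 have eV := entire_volterra ek eg.
have := derivative_weight_bound (m := m) (w := w) eV (fun z _ => VS z).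
have -> : cderiv (volterra g (kern w)) w = kern w w * cderiv g w.
  exact: hasder_unique (entire_hasder w eV) (hasder_volterra w ek eg).
by rewrite normcM mulrAC kern_diag mul1r.
Qed.

(** The kernels at [n] tend to 0 uniformly on discs as [n] grows, hence so do their images. This
    identifies as 0 any norm limit of a subsequence of images. *)
Lemma volterra_kern_vanish g z e : entire g -> 0 < e ->
  exists N : nat, forall n, (N <= n)%N -> normc (volterra g (kern n%:R) z) <= e.
Proof.
move=> eg e0; have z0 := normc_ge0 z.
have [G G0 GP] := cderiv_bounded (normc z) eg.
have [K K0 KP] := bump_decay 1.
pose E := growth (1 / 2) 0 0 (normc z); have E0 : 0 < E := growth_gt0 _ _ _ _.
pose D := 2 * (K * E * G) * normc z; have D0 : 0 <= D.
  by do 4! [apply: mulr_ge0 => //]; exact: ltW.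
have [N NP] : exists N : nat, D / e + normc z < N%:R.
  exists (Num.bound (D / e + normc z)); apply: archi_boundP.
  by rewrite addr_ge0 // divr_ge0 // ltW.
exists N => n nN; have nn : D / e + normc z < n%:R by rewrite (lt_le_trans NP) // ler_nat.
have De : 0 <= D / e by rewrite divr_ge0 // ltW.
have d0 : 0 < 1 + (n%:R - normc z) by lra.
have V : normc (volterra g (kern n%:R) z) <= 2 * (K / (1 + (n%:R - normc z)) * E * G) * normc z.
  apply: (volterra_derivative_bound eg (@entire_kern R m n%:R)) => w wz.
  rewrite normcM ler_pM ?normc_ge0 ?GP //.
  have kb := le_trans (kern_bound m n%:R w) (KP _ (normc_ge0 _)).
  have dw : n%:R - normc z <= normc (w - n%:R).
    have := normc_dist_le n%:R w; rewrite normc_distC => /(le_trans (ler_norm _)).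
    have -> : normc (n%:R : C) = n%:R by rewrite -(rmorph_nat (real_complex R)) normc_real normr_nat.
    by move: wz; lra.
  have p1 : (1 + normc (w - n%:R)) `^ (- 1) <= (1 + (n%:R - normc z))^-1.
    rewrite powR_inv1; last by rewrite addr_ge0 ?normc_ge0.
    by rewrite lef_pV2 ?posrE ?lerD2l // ltr_pwDl ?normc_ge0.
  have {}kb := le_trans kb (ler_wpM2l (ltW K0) p1).
  rewrite le_wt_growth in kb; apply: le_trans kb _.
  apply: ler_wpM2l; first by rewrite divr_ge0 // ltW.
  rewrite ler_expR; have w0 := normc_ge0 w.
  have /andP[l0 _] := ln1D_bounds w0.
  have s1 : normc w ^+ 2 <= normc z ^+ 2 by rewrite lerXn2r // nnegrE.
  have s2 : 0 <= m%:R * ln (1 + normc w) by rewrite mulr_ge0.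
  by rewrite !mul0r !subr0; move: (m%:R * _) (normc w ^+ 2) (normc z ^+ 2) s1 s2 => x y v; lra.
apply: le_trans V _.
have -> : 2 * (K / (1 + (n%:R - normc z)) * E * G) * normc z = D / (1 + (n%:R - normc z)).
  by rewrite /D; ring.
rewrite ler_pdivrMr // [leRHS]mulrC -ler_pdivrMr //.
by lra.
Qed.

End VolterraSup.

Lemma hasder_val (K : numFieldType) (f : K -> K) x l l' :
  l = l' -> hasder f x l -> hasder f x l'.
Proof. by move=> ->. Qed.

(** * The sup space in terms of weighted bounds *)

Section FockSup.
Variable R : realType.
Local Notation C := R[i].
Variable m : nat.
Implicit Types (f g h : C -> C) (M K : R).

Lemma fock_norm_oo_le f M : (fock_norm m +oo%E f <= M%:E)%E <-> wbound m f M.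
Proof.
split=> [H z|H]; last by apply: ge_ereal_sup => _ [z _ <-]; rewrite lee_fin; exact: H.
by rewrite -lee_fin; apply: le_trans H; apply: ereal_sup_ubound; exists z.
Qed.

Lemma fock_norm_oo_ge0 f : (0 <= fock_norm m +oo%E f)%E.
Proof.
apply: (@le_trans _ _ (normc (f 0) * expR (- psi m 0))%:E).
  by rewrite lee_fin mulr_ge0 ?normc_ge0 ?expR_ge0.
by apply: ereal_sup_ubound; exists 0.
Qed.

Lemma fock_ooP f : fock m +oo%E f <-> entire f /\ exists M, wbound m f M.
Proof.
split=> [[ef H]|[ef [M fM]]]; split=> //; last first.
  by apply: le_lt_trans ((fock_norm_oo_le f M).2 fM) _; exact: ltry.
have := fock_norm_oo_ge0 f; move: H; case E : (fock_norm _ _ _) => [M||] // _ _.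
by exists M; apply/fock_norm_oo_le; rewrite E.
Qed.

Lemma fock_norm_oo_fin f : fock m +oo%E f ->
  exists2 M, fock_norm m +oo%E f = M%:E & wbound m f M.
Proof.
move=> [ef H]; have := fock_norm_oo_ge0 f; move: H.
case E : (fock_norm _ _ _) => [M||] // _ _.
by exists M => //; apply/fock_norm_oo_le; rewrite E.
Qed.

Lemma bounded_op_oo (T : (C -> C) -> C -> C) K :
  (forall f, entire f -> entire (T f)) ->
  (forall f M, entire f -> wbound m f M -> wbound m (T f) (K * M)) ->
  bounded_op m +oo%E +oo%E T.
Proof.
move=> eT bT; exists K => f fF; have [M fE fM] := fock_norm_oo_fin fF.
have TM := bT f M fF.1 fM; split; first by apply/fock_ooP; split; [exact: eT fF.1|exists (K * M)].
by rewrite fE -EFinM; apply/fock_norm_oo_le.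
Qed.

Lemma wbound_cst (k : C) : exists M, wbound m (fun=> k) M.
Proof.
have [K K0 KP] := bump_bounded R m; exists (normc k * K) => z.
rewrite ler_wpM2l ?normc_ge0 //; have := KP _ (normc_ge0 z).
by rewrite wtE /bump mulrC.
Qed.

Lemma entire_cst (k : C) : entire (fun=> k).
Proof. exact: (hasder_entire (fun z => hasder_cst k z)).1. Qed.

End FockSup.

(** * Resolvent and spectrum for a quadratic symbol *)

Section Spectrum.
Variable R : realType.
Local Notation C := R[i].
Local Notation Re := (@complex.Re R).
Local Notation Im := (@complex.Im R).
Variables (m : nat) (g : C -> C) (a b c : C).
Hypothesis gE : forall z, g z = a * z ^+ 2 + b * z + c.
Implicit Types (f h : C -> C) (l z : C).

Let dg z : hasder g z (2 * a * z + b).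
Proof. by apply: hasder_eq (hasder_quadratic a b c z) => // y; rewrite gE. Qed.

Let eg : entire g. Proof. exact: (hasder_entire dg).1. Qed.

Let dgE z : cderiv g z = 2 * a * z + b. Proof. exact: cderiv_quadratic gE z. Qed.

Lemma quadratic_cderiv_bound z : normc (cderiv g z) <= (2 * normc a + normc b) * (1 + normc z).
Proof.
rewrite dgE; apply: le_trans (le_normcD _ _) _; rewrite !normcM.
have -> : normc (2 : C) = 2 by rewrite -(rmorph_nat (real_complex R)) normc_real normr_nat.
have a0 := normc_ge0 a; have b0 := normc_ge0 b; have z0 := normc_ge0 z.
move: (normc a) (normc b) (normc z) a0 b0 z0 => x y r x0 y0 r0.
by have := mulr_ge0 y0 r0; lra.
Qed.

Definition expg l z : C := cexp (g z / l).

Lemma hasder_expg l z : hasder (expg l) z (expg l z * (cderiv g z / l)).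
Proof.
apply: hasder_cexp_comp; apply: hasder_eq (hasderM (entire_hasder z eg) (hasder_cst l^-1 z)) => //.
by rewrite mulr0 addr0.
Qed.

Lemma entire_expg l : entire (expg l).
Proof. exact: (hasder_entire (hasder_expg l)).1. Qed.

Lemma expg_neq0 l z : expg l z != 0. Proof. exact: cexp_neq0. Qed.

Lemma expgN l z : expg (- l) z = (expg l z)^-1.
Proof. by rewrite /expg invrN mulrN cexpN. Qed.

Lemma expg_mulN l z : expg l z * expg (- l) z = 1.
Proof. by rewrite expgN mulfV // expg_neq0. Qed.

Definition shifted l f z : C := l * f z - volterra g f z.

Lemma hasder_shifted l f z : entire f ->
  hasder (shifted l f) z (l * cderiv f z - f z * cderiv g z).
Proof.
by move=> ef; exact: hasderB (hasderZ l (entire_hasder z ef)) (hasder_volterra z ef eg).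
Qed.

Lemma shifted0 l f : shifted l f 0 = l * f 0.
Proof. by rewrite /shifted volterra0 subr0. Qed.

(* Variation of constants: [(f / exp (g / l))' = h' / (l exp (g / l))]. *)
Lemma hasder_quotient l f h z : l != 0 -> entire f -> entire h -> shifted l f = h ->
  hasder (fun z => f z * expg (- l) z) z (cderiv h z / l * expg (- l) z).
Proof.
move=> l0 ef eh E.
have dh : cderiv h z = l * cderiv f z - f z * cderiv g z.
  by apply: hasder_unique (entire_hasder z eh) _; rewrite -E; exact: hasder_shifted.
apply: hasder_val (hasderM (entire_hasder z ef) (hasder_expg (- l) z)).
by rewrite dh; move: (expg _ _) (f z) (cderiv f z) (cderiv g z) => x y u v; field.
Qed.

Lemma shifted_inj l f h : l != 0 -> entire f -> entire h ->
  shifted l f = shifted l h -> f = h.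
Proof.
move=> l0 ef eh E; apply/funext => z; apply/eqP; rewrite -subr_eq0; apply/eqP.
have [ed dd] := entire_sub ef eh.
have E0 : shifted l (fun z => f z - h z) = fun=> 0.
  apply/funext => u; rewrite /shifted (volterraB eg ef eh).
  have := congr1 (@^~ u) E; rewrite /shifted => Eu.
  transitivity ((l * f u - volterra g f u) - (l * h u - volterra g h u)); first by ring.
  by rewrite Eu subrr.
have dq u : hasder (fun z => (f z - h z) * expg (- l) z) u 0.
  have := hasder_quotient u l0 ed (entire_cst (k := 0)) E0.
  by rewrite (hasder_entire (fun z => hasder_cst (0 : C) z)).2 mul0r mul0r.
have f0 : f 0 = h 0.
  have := congr1 (@^~ 0) E; rewrite shifted0 [X in _ = X -> _]shifted0.
  exact: mulfI.
have := hasder0_cst dq z; rewrite f0 subrr mul0r => /eqP.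
by rewrite mulf_eq0 (negPf (expg_neq0 _ _)) orbF => /eqP.
Qed.

(** Variation of constants after an integration by parts, which removes [cderiv h]. The remaining
    integral of [h e^(-g/l) g'] is again a Volterra integral, with symbol [- l e^(-g/l)]. *)
Definition resolvent l h z : C :=
  l^-1 * h z + l ^- 2 * (expg l z * volterra (fun z => - l * expg (- l) z) h z).

Let kernel_der l z : l != 0 ->
  hasder (fun z => - l * expg (- l) z) z (expg (- l) z * cderiv g z).
Proof.
move=> l0; apply: hasder_val (hasderZ (- l) (hasder_expg (- l) z)).
by move: (expg _ _) (cderiv g z) => x y; field.
Qed.

Let hasder_kernel_int l h z : l != 0 -> entire h ->
  hasder (volterra (fun z => - l * expg (- l) z) h) z (h z * (expg (- l) z * cderiv g z)).
Proof.
move=> l0 eh; have [ek dk] := hasder_entire (fun z => kernel_der z l0).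
by have := hasder_volterra z eh ek; rewrite dk.
Qed.

Lemma hasder_resolvent l h z : l != 0 -> entire h -> hasder (resolvent l h) z
  (l^-1 * cderiv h z + l ^- 2 * (expg l z * (cderiv g z / l) *
     volterra (fun z => - l * expg (- l) z) h z +
   expg l z * (h z * (expg (- l) z * cderiv g z)))).
Proof.
move=> l0 eh; apply: hasderD; first by apply: hasderZ; exact: entire_hasder.
by apply: hasderZ; exact: hasderM (hasder_expg l z) (hasder_kernel_int z l0 eh).
Qed.

Lemma entire_resolvent l h : l != 0 -> entire h -> entire (resolvent l h).
Proof. by move=> l0 eh; exact: (hasder_entire (fun z => hasder_resolvent z l0 eh)).1. Qed.

Lemma shifted_resolvent l h : l != 0 -> entire h -> shifted l (resolvent l h) = h.
Proof.
move=> l0 eh; have er := entire_resolvent l0 eh.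
have dr z := (hasder_unique (entire_hasder z er) (hasder_resolvent z l0 eh)).
apply: (eq_primitive (dA := cderiv h)) => [z|z|].
- apply: hasder_val (hasder_shifted l z er); rewrite dr /resolvent.
  set V := volterra _ h z; have := expg_mulN l z; clearbody V.
  move: (expg l z) (expg (- l) z) (cderiv g z) (cderiv h z) (h z) => x y g1 h1 h0 xy.
  have -> : x * (h0 * (y * g1)) = x * y * (h0 * g1) by ring.
  by rewrite xy; field.
- exact: entire_hasder.
- by rewrite shifted0 /resolvent volterra0 !mulr0 addr0 mulrA mulfV // mul1r.
Qed.

Lemma normc_expg l z : normc (expg l z) = expR (Re (g z / l)).
Proof. exact: normc_cexp. Qed.

Lemma Re_le_norm (x : C) : Re x <= normc x.
Proof. exact: le_trans (ler_norm _) (Re_le_normc x). Qed.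

(** The factor [e^(g/l)] takes at most [A r^2 + B r], up to a constant, from the exponent [r^2 / 2].
    As [A < 1 / 2], what remains is a [growth] profile with [G = 1 / 2 - A > 0], to which
    [ray_growth] applies. *)
Lemma resolvent_wbound l : 2 * normc a < normc l -> exists K, forall h M,
  entire h -> wbound m h M -> wbound m (resolvent l h) (K * M).
Proof.
move=> la; have l1 : 0 < normc l by apply: le_lt_trans la; rewrite mulr_ge0 ?normc_ge0.
have l0 : l != 0 by rewrite -normc_gt0.
set A := normc a / normc l; set B := normc b / normc l.
have A2 : A < 1 / 2.
  rewrite /A ltr_pdivrMr //.
  by move: la; move: (normc a) (normc l) => x y; lra.
have G0 : 0 < 1 / 2 - A by rewrite subr_gt0.
have [K K0 KP] := ray_growth B m%:R G0.
pose c1 := 2 * normc a + normc b.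
have c10 : 0 <= c1 by rewrite addr_ge0 ?mulr_ge0 ?normc_ge0.
exists (normc l^-1 + normc (l ^- 2) * (K * c1)) => h M eh hM.
have M0 := wbound_ge0 hM.
suff P : wbound m (fun z => expg l z * volterra (fun z => - l * expg (- l) z) h z) (K * c1 * M).
  by rewrite mulrDl -(mulrA (normc _)); exact: wboundD (wboundZ _ hM) (wboundZ _ P).
move=> z; rewrite le_wt_growth; set r := normc z.
have r0 : 0 <= r by exact: normc_ge0.
have GE s : growth (1 / 2) 0 m%:R s = expR (A * s ^+ 2 + B * s) * growth (1 / 2 - A) B m%:R s.
  by rewrite /growth -expRD; congr expR; ring.
(* The factor [expg l z] is frozen at the endpoint while [w] moves along the ray; the constant
   passed to [ray_growth] therefore depends on [z]. *)
have dP w := hasderZ (expg l z) (hasder_kernel_int w l0 eh).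
have P0 : expg l z * volterra (fun z => - l * expg (- l) z) h 0 = 0.
  by rewrite volterra0 mulr0.
have := KP _ _ z (expR (A * r ^+ 2 + B * r) * (c1 * M)) dP P0.
rewrite -/r => /(_ _ _) H; rewrite GE.
have -> : K * c1 * M * (expR (A * r ^+ 2 + B * r) * growth (1 / 2 - A) B m%:R r) =
  K * (expR (A * r ^+ 2 + B * r) * (c1 * M)) * growth (1 / 2 - A) B m%:R r by ring.
apply: H => [|t /andP[t0 t1]]; first by rewrite !mulr_ge0 ?expR_ge0.
set w := t%:C * z; have wr : normc w = t * r by rewrite /w normcM normc_real ger0_norm.
have E1 : normc (expg l z) * normc (expg (- l) w) <=
    expR (A * r ^+ 2 + B * r) * expR (- (A * (t * r) ^+ 2 + B * (t * r))).
  rewrite !normc_expg -!expRD ler_expR -ReD.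
  (* The constant [c] cancels and [w = t z], so the exponent is at most [A r^2 + B r] minus the same
     expression at [t r]. *)
  have -> : g z / l + g w / - l =
      (a / l * (1 - t ^+ 2)%:C) * z ^+ 2 + (b / l * (1 - t)%:C) * z.
    by rewrite !gE /w !rmorphB rmorphXn /=; field.
  apply: le_trans (Re_le_norm _) _; apply: le_trans (le_normcD _ _) _.
  rewrite (normcM _ (z ^+ 2)) normcX (normcM _ z) !normcM !normcV !normc_real -/A -/B -/r.
  rewrite !ger0_norm; last 2 first.
  - by rewrite subr_ge0.
  - by rewrite subr_ge0 exprn_ile1.
  by rewrite le_eqVlt; apply/orP; left; apply/eqP; ring.
have H1 := hM w; rewrite le_wt_growth wr GE in H1.
have G1 := quadratic_cderiv_bound w; rewrite wr -/c1 in G1.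
rewrite !normcM.
have -> : normc (expg l z) * (normc (h w) * (normc (expg (- l) w) * normc (cderiv g w))) =
  (normc (expg l z) * normc (expg (- l) w)) * (normc (h w) * normc (cderiv g w)) by ring.
have n1 (x y : C) : 0 <= normc x * normc y by rewrite mulr_ge0 ?normc_ge0.
apply: le_trans (ler_pM (n1 _ _) (n1 _ _) E1 (ler_pM (normc_ge0 _) (normc_ge0 _) H1 G1)) _.
rewrite expRN; have := expR_gt0 (A * (t * r) ^+ 2 + B * (t * r)).
move: (expR (A * (t * r) ^+ 2 + B * (t * r))) (expR _) => x y x0.
by rewrite le_eqVlt; apply/orP; left; apply/eqP; field; rewrite gt_eqF.
Qed.

(* In the direction [u] the exponent [g / l] has real part [|a / l| r^2 + O(1)]. *)
Lemma ray_direction l : l != 0 -> a != 0 -> exists u : C, normc u = 1 /\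
  forall r, 0 <= r -> normc a / normc l * r ^+ 2 + Re (c / l) <= Re (g (r%:C * u) / l).
Proof.
move=> l0 a0; set q := a / l; have q0 : q != 0 by rewrite mulf_neq0 ?invr_eq0.
have nq : 0 < normc q by rewrite normc_gt0.
pose v : C := sqrtc (conjc q / (normc q)%:C).
have v2 : v ^+ 2 = conjc q / (normc q)%:C by exact: sqr_sqrtc.
have nv : normc v = 1.
  have : normc v ^+ 2 = 1.
    by rewrite -normcX v2 normcM normcV normc_conj normc_real ger0_norm ?normc_ge0 // mulfV // gt_eqF.
  by move/eqP; rewrite sqrf_eq1 => /orP[/eqP //|/eqP E]; have := normc_ge0 v; rewrite E; lra.
have [u [nu u2 ub]] : exists u, [/\ normc u = 1, u ^+ 2 = conjc q / (normc q)%:C & 0 <= Re (b / l * u)].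
  have [vb|vb] := leP 0 (Re (b / l * v)); first by exists v.
  by exists (- v); rewrite normcN sqrrN mulrN ReN oppr_ge0 ltW.
exists u; split=> // r r0.
have -> : g (r%:C * u) / l = (r ^+ 2)%:C * (q * u ^+ 2) + (r%:C * (b / l * u) + c / l).
  by rewrite gE rmorphXn /= /q; field.
have -> : q * u ^+ 2 = (normc q)%:C.
  rewrite u2 mulrA mulc_conj expr2 rmorphM /= mulfK //.
  by rewrite -normc_gt0 normc_real gtr0_norm.
rewrite !ReD !ReMl /= -normcV -normcM -/q mulrC lerD2l.
by rewrite lerDr mulr_ge0.
Qed.

Lemma expg_wt_ray l : l != 0 -> a != 0 -> exists u : C, normc u = 1 /\
  forall r, 0 <= r -> expR ((normc a / normc l - 1 / 2) * r ^+ 2 + Re (c / l)) <=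
     normc (expg l (r%:C * u)) * wt m (r%:C * u).
Proof.
move=> l0 a0; have [u [u1 uP]] := ray_direction l0 a0; exists u; split=> // r r0.
have nr : normc (r%:C * u) = r by rewrite normcM u1 mulr1 normc_real ger0_norm.
rewrite wtE nr normc_expg [leRHS]mulrCA -expRD -[leLHS]mul1r ler_pM ?expR_ge0 //.
  by rewrite exprn_ege1 // lerDl.
rewrite ler_expR; apply: le_trans _ (lerD (uP r r0) (lexx _)).
by rewrite le_eqVlt; apply/orP; left; apply/eqP; move: (normc a / _) (Re _) => x y; field.
Qed.

Lemma unbounded_sqr (x y M : R) : 0 < x -> exists r, 1 <= r /\ M < x * r ^+ 2 - y * r.
Proof.
move=> x0; pose r := (`|y| + `|M| + 1) / x + 1.
have p : 0 <= (`|y| + `|M| + 1) / x by rewrite divr_ge0 ?addr_ge0 // ltW.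
have r1 : 1 <= r by rewrite /r lerDr.
exists r; split => //.
have xr : `|y| + `|M| + 1 < x * r by rewrite /r mulrDr mulr1 mulrCA mulfV ?gt_eqF // mulr1 ltrDl.
have M1 := ler_norm M; have y1 := ler_norm y.
have : (`|M| + 1) * 1 <= (x * r - y) * r by apply: ler_pM => //; rewrite ?addr_ge0 //; lra.
by rewrite mulr1 mulrBl expr2 mulrA; lra.
Qed.

Lemma expg_fock l : 2 * normc a < normc l -> fock m +oo%E (expg l).
Proof.
move=> la; have l1 : 0 < normc l by apply: le_lt_trans la; rewrite mulr_ge0 ?normc_ge0.
have l0 : l != 0 by rewrite -normc_gt0.
set A := normc a / normc l; set B := normc b / normc l.
have A2 : A < 1 / 2.
  rewrite /A ltr_pdivrMr //.
  by move: la; move: (normc a) (normc l) => x y; lra.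
have G0 : 0 < 1 / 2 - A by rewrite subr_gt0.
apply/fock_ooP; split; first exact: entire_expg.
exists (expR ((B + m%:R) ^+ 2 / (4 * (1 / 2 - A)) + normc (c / l))) => z.
have z0 := normc_ge0 z; set r := normc z in z0 *.
have /andP[_ lr] := ln1D_bounds z0.
have r1 : 0 < 1 + r by lra.
rewrite wtE normc_expg -/r -[in X in X ^+ m](lnK r1) -expRM_natl -!expRD ler_expR.
have E1 : Re (g z / l) <= A * r ^+ 2 + B * r + normc (c / l).
  have -> : g z / l = a / l * z ^+ 2 + b / l * z + c / l by rewrite gE; field.
  apply: le_trans (Re_le_norm _) _; apply: le_trans (le_normcD _ _) _; rewrite lerD2r.
  by apply: le_trans (le_normcD _ _) _; rewrite (normcM _ (z ^+ 2)) normcX !normcM !normcV.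
have ml : m%:R * ln (1 + r) <= m%:R * r by rewrite ler_wpM2l.
have sq : 0 <= (2 * (1 / 2 - A) * r - (B + m%:R)) ^+ 2 / (4 * (1 / 2 - A)).
  by rewrite divr_ge0 ?sqr_ge0 // mulr_ge0 // ltW.
have E : (2 * (1 / 2 - A) * r - (B + m%:R)) ^+ 2 / (4 * (1 / 2 - A)) =
   (1 / 2 - A) * r ^+ 2 - (B + m%:R) * r + (B + m%:R) ^+ 2 / (4 * (1 / 2 - A)).
  by move: (1 / 2 - A) G0 => G G0'; field; rewrite gt_eqF.
move: sq; rewrite E; move: (_ ^+ 2 / _) => q.
rewrite !mulrBl !mulrDl.
move: (normc (c / l)) (A * r ^+ 2) (r ^+ 2) (B * r) (m%:R * r) (m%:R * ln _) (Re _) E1 ml => *; lra.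
Qed.

Lemma expg_not_fock l : l != 0 -> normc l < 2 * normc a -> ~ fock m +oo%E (expg l).
Proof.
move=> l0 la /fock_ooP[_ [M HM]].
have l1 : 0 < normc l by rewrite normc_gt0.
have a1 : 0 < normc a by lra.
have [u [u1 uP]] := expg_wt_ray l0 (ltac:(by rewrite -normc_gt0)).
have x0 : 0 < normc a / normc l - 1 / 2.
  by rewrite subr_gt0 ltr_pdivlMr // mulrC; lra.
have [r [r1 rP]] := unbounded_sqr 0 (M - Re (c / l)) x0.
have := le_trans (uP r (le_trans ler01 r1)) (HM (r%:C * u)); apply/negP; rewrite -ltNge.
apply: lt_le_trans (expR_ge1Dx _); move: rP; rewrite mul0r subr0.
by move: (_ * r ^+ 2) (Re _) => *; lra.
Qed.

(** For [l != 0] a preimage of 1 is a nonzero multiple of [e^(g/l)], which settles the case where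
    [e^(g/l)] is not in the space. Otherwise, which can only happen on the circle [|l| = 2 |a|], a
    preimage of [e^(g/l)] is [e^(g/l) (l^-2 g + k)]: along the ray of [expg_wt_ray] the weighted
    exponential stays away from 0 while the quadratic factor is unbounded. For [l = 0] every image
    vanishes at 0. *)
Lemma shifted_not_invertible l : normc l <= 2 * normc a ->
  ~ invertible_op m +oo%E (shifted l).
Proof.
move=> la [S [K bS] inv].
have F1 : fock m +oo%E (fun=> 1 : C).
  by apply/fock_ooP; split; [exact: entire_cst|exact: wbound_cst].
have [l0|l0] := eqVneq l 0.
  have := congr1 (@^~ 0) (inv _ F1).2; rewrite l0 shifted0 mul0r => /eqP.
  by rewrite eq_sym oner_eq0.
have l1 : 0 < normc l by rewrite normc_gt0.
have a1 : 0 < normc a by lra.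
have a0 : a != 0 by rewrite -normc_gt0.
have [EF|EF] := pselect (fock m +oo%E (expg l)); last first.
  apply: EF; have [/fock_ooP[eS [M SM]] _] := bS _ F1.
  have dq u : hasder (fun z => S (fun=> 1) z * expg (- l) z) u 0.
    have := hasder_quotient u l0 eS (entire_cst (k := 1)) (inv _ F1).2.
    by rewrite (hasder_entire (fun z => hasder_cst (1 : C) z)).2 mul0r mul0r.
  pose k := S (fun=> 1) 0 * expg (- l) 0.
  have k0 : k != 0.
    apply: mulf_neq0; last exact: expg_neq0.
    have := congr1 (@^~ 0) (inv _ F1).2; rewrite shifted0 => E.
    by apply/eqP => s0; move/eqP: E; rewrite s0 mulr0 eq_sym oner_eq0.
  apply/fock_ooP; split; first exact: entire_expg.
  exists (normc k^-1 * M).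
  have -> : expg l = fun z => k^-1 * S (fun=> 1) z.
    apply/funext => z; have := hasder0_cst dq z; rewrite -/k => E.
    apply: (mulfI k0); rewrite mulrA mulfV // mul1r -E -mulrA [expg (- l) z * _]mulrC.
    by rewrite expg_mulN mulr1.
  exact: wboundZ.
have [/fock_ooP[eS [M SM]] _] := bS _ EF.
set f := S (expg l) in eS SM.
have fE := (inv _ EF).2; rewrite -/f in fE.
(* With right-hand side [e^(g/l)] the exponentials cancel, so the quotient is [l^-2 g] up to a
   constant. *)
have quot z : hasder (fun z => f z * expg (- l) z) z (l ^- 2 * cderiv g z).
  have := hasder_quotient z l0 eS (entire_expg (l := l)) fE.
  rewrite (hasder_entire (hasder_expg l)).2 => H.
  apply: hasder_val H.
  transitivity (expg l z * expg (- l) z * (cderiv g z / l / l)); first by ring.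
  by rewrite expg_mulN mul1r; field.
pose k := f 0 * expg (- l) 0 - l ^- 2 * g 0.
have quotE : (fun z => f z * expg (- l) z) = fun z => l ^- 2 * g z + k.
  apply: (eq_primitive quot) => [z|]; last by rewrite /k addrC subrK.
  rewrite -[X in hasder _ _ X]addr0; apply: hasderD (hasderZ _ (entire_hasder z eg)) (hasder_cst k z).
have fq z : f z = expg l z * (l ^- 2 * g z + k).
  have := congr1 (@^~ z) quotE; cbv beta => <-.
  by rewrite mulrCA expg_mulN mulr1.
have [u [u1 uP]] := expg_wt_ray l0 a0.
set D := normc (l ^- 2).
have D0 : 0 < D by rewrite normc_gt0 invr_eq0 expf_neq0.
set e := expR (Re (c / l)); have e0 : 0 < e by exact: expR_gt0.
set k1 := normc (l ^- 2 * c + k); have k10 : 0 <= k1 by exact: normc_ge0.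
have [r [r1 rP]] := unbounded_sqr (D * normc b) (M / e + k1) (mulr_gt0 D0 a1).
have r0 : 0 <= r by apply: le_trans r1.
set z := r%:C * u; have zr : normc z = r by rewrite /z normcM u1 mulr1 normc_real ger0_norm.
have ez : e <= normc (expg l z) * wt m z.
  apply: le_trans (uP r r0); rewrite ler_expR lerDr mulr_ge0 ?sqr_ge0 //.
  by rewrite subr_ge0 ler_pdivlMr // mulrC; lra.
have lb : D * normc a * r ^+ 2 - D * normc b * r - k1 <= normc (l ^- 2 * g z + k).
  have -> : l ^- 2 * g z + k = l ^- 2 * (a * z ^+ 2) - (- (l ^- 2 * (b * z)) - (l ^- 2 * c + k)).
    by rewrite gE; ring.
  have := normc_dist_le (l ^- 2 * (a * z ^+ 2)) (- (l ^- 2 * (b * z)) - (l ^- 2 * c + k)).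
  have := normcB (- (l ^- 2 * (b * z))) (l ^- 2 * c + k).
  rewrite normcN !(normcM (l ^- 2)) (normcM _ (z ^+ 2)) normcX (normcM b) zr
    -/D -/k1 !mulrA => t1 /(le_trans (ler_norm _)) t2.
  by move: t1 t2; move: (normc (_ - _)) (normc (_ - _)) (D * normc a * _) (D * normc b * _) => *; lra.
have := SM z; rewrite fq normcM mulrAC; apply/negP; rewrite -ltNge.
have X : M / e < normc (l ^- 2 * g z + k).
  apply: lt_le_trans lb; move: rP.
  by move: (M / e) (D * normc a * _) (D * normc b * _) => *; lra.
have M0 : 0 <= M := wbound_ge0 SM.
rewrite -(ltr_pM2l e0) mulrCA mulfV ?gt_eqF // mulr1 in X.
by apply: lt_le_trans X _; rewrite ler_wpM2r ?normc_ge0.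
Qed.

Theorem spectrum_volterra :
  spectrum m +oo%E (volterra g) = [set l | normc l <= 2 * normc a].
Proof.
apply/seteqP; split=> l /=; last exact: shifted_not_invertible.
rewrite /spectrum /= => ninv; rewrite leNgt; apply/negP => la; apply: ninv.
have l0 : l != 0 by rewrite -normc_gt0; apply: le_lt_trans la; rewrite mulr_ge0 ?normc_ge0.
have [K KP] := resolvent_wbound la.
have [K' K'0 K'P] := @volterra_wbound R m g (2 * normc a + normc b) eg
  ltac:(by rewrite addr_ge0 ?mulr_ge0 ?normc_ge0) quadratic_cderiv_bound.
exists (resolvent l).
  by apply: (@bounded_op_oo _ _ _ K) => f; [exact: entire_resolvent|exact: KP].
move=> f [ef _]; split; last exact: shifted_resolvent.
have es : entire (shifted l f) by exact: (hasder_entire (fun z => hasder_shifted l z ef)).1.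
(* Injectivity turns the right inverse into a left inverse. *)
by apply: (shifted_inj l0 (entire_resolvent l0 es) ef); exact: shifted_resolvent.
Qed.

Lemma nbhs_normcP (l : C) (A : set C) :
  nbhs (l : C^o) A <-> exists2 d : R, 0 < d & forall w, normc (w - l) < d -> A w.
Proof.
split=> [/nbhs_ballP[d /= d0 dP]|[d d0 dP]].
  have dE : d = (complex.Re d)%:C.
    by move: d0; rewrite ltcE => /andP[/eqP /= d0 _]; case: (d) d0 => x y /= ->.
  exists (complex.Re d); first by move: d0; rewrite dE ltcR.
  by move=> w wl; apply: dP; rewrite /ball /= norm_normc dE ltcR normc_distC.
apply/nbhs_ballP; exists d%:C => /=; first by rewrite ltcR.
by move=> w; rewrite /ball /= norm_normc ltcR normc_distC; exact: dP.
Qed.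

(** The exceptional set lies between the punctured open disc and the closed disc, so its trace on
    the circle does not affect the closure. Points of the circle are approached radially by
    [(1 - t) * l]; for [a = 0] the exceptional set is empty and only the added point 0 remains. *)
Theorem disc_closure : [set l : C^o | normc l <= 2 * normc a] =
  [set 0] `|` closure [set l : C^o | l != 0 /\ ~ fock m +oo%E (expg l)].
Proof.
have a0 : 0 <= 2 * normc a by rewrite mulr_ge0 ?normc_ge0.
apply/seteqP; split=> l /=.
  move=> la; have [->|l0] := eqVneq l 0; first by left.
  right=> A /nbhs_normcP[d d0 dP]; have l1 : 0 < normc l by rewrite normc_gt0.
  pose t := Num.min (2^-1) (d / (2 * normc l)).
  have t0 : 0 < t by rewrite lt_min invr_gt0 ltr0n divr_gt0 // mulr_gt0.
  have t1 : t <= 2^-1 by rewrite ge_min lexx.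
  have t2 : t * normc l <= d / 2.
    rewrite -ler_pdivlMr // (le_trans (_ : _ <= d / (2 * normc l))) ?ge_min ?lexx ?orbT //.
    by rewrite invfM mulrA.
  have n1 : normc ((1 - t)%:C * l) = (1 - t) * normc l.
    by rewrite normcM normc_real ger0_norm //; move: t1; lra.
  exists ((1 - t)%:C * l); split; last first.
    apply: dP; have -> : (1 - t)%:C * l - l = (- t)%:C * l by rewrite rmorphB rmorphN /=; ring.
    rewrite normcM normc_real normrN gtr0_norm //; apply: le_lt_trans t2 _.
    by move: d0; lra.
  split.
    rewrite -normc_gt0 n1 mulr_gt0 //; move: t1; lra.
  apply: expg_not_fock; first by rewrite -normc_gt0 n1 mulr_gt0 //; move: t1; lra.
  rewrite n1; apply: lt_le_trans la; rewrite mulrBl mul1r ltrBlDr ltrDl.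
  by rewrite mulr_gt0.
case=> [->|cl]; first by rewrite normc0.
rewrite leNgt; apply/negP => la.
have [|l' [[l'0 nf] dl]] := cl [set w | normc (w - l) < normc l - 2 * normc a].
  by apply/nbhs_normcP; exists (normc l - 2 * normc a) => //; rewrite subr_gt0.
apply: nf; apply: expg_fock.
have := normcB l' (l' - l); rewrite opprB addrC subrK => H.
by move: dl => /=; lra.
Qed.

End Spectrum.

(** * Area integrals by comparison with boxes *)

Section PlaneIntegral.
Variable R : realType.
Local Notation C := R[i].
Local Notation Re := (@complex.Re R).
Local Notation Im := (@complex.Im R).
Local Notation mu := (@lebesgue_measure R \x @lebesgue_measure R)%E.
Local Notation T2 := (measurableTypeR R * measurableTypeR R)%type.
Implicit Types (z w : C) (r M q : R).

Definition plane_integral (phi : C -> R) : \bar R :=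
  (\int[mu]_u (phi (u.1 +i* u.2))%:E)%E.

(* The integral of a nonnegative function is a supremum over simple functions,
   so that monotonicity requires no measurability. *)
Lemma integral_mono (f1 f2 : T2 -> \bar R) : (forall x, 0 <= f1 x)%E ->
  (forall x, f1 x <= f2 x)%E -> (\int[mu]_x f1 x <= \int[mu]_x f2 x)%E.
Proof.
move=> f10 f12; have f20 x : (0 <= f2 x)%E by exact: le_trans (f12 x).
rewrite !ge0_integralTE //; apply: ereal_sup_le => _ [h hf <-]; exists h => // x.
exact: le_trans (hf x) (f12 x).
Qed.

(** Squares have an immediate area under the product measure, and this one lies between the discs of
    radius [r] and [2 * r]. *)
Definition box z r : set T2 :=
  `[Re z - r, Re z + r]%classic `*` `[Im z - r, Im z + r]%classic.

Lemma measurable_box z r : measurable (box z r).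
Proof. by apply: measurableX; exact: measurable_itv. Qed.

Lemma box_measure z r : 0 < r -> mu (box z r) = (4 * r ^+ 2)%:E.
Proof.
move=> r0; rewrite /box product_measure1E; [|exact: measurable_itv..].
have len x : lebesgue_measure `[x - r, x + r]%classic = (2 * r)%:E :> \bar R.
  rewrite lebesgue_measure_itv /= lte_fin ifT; last by lra.
  by rewrite -EFinB; congr (_%:E); ring.
transitivity ((2 * r)%:E * (2 * r)%:E)%E.
  by congr (_ * _)%E; exact: len.
by rewrite -EFinM; congr (_%:E); ring.
Qed.

Lemma box_norm z r u : box z r u -> normc (u.1 +i* u.2 - z) <= 2 * r.
Proof.
case: u => x y [] /=; rewrite !in_itv /= => /andP[a b] /andP[c d].
apply: le_trans (normc_le_ReIm _) _; rewrite ReD ImD ReN ImN /= mulr_natl mulr2n.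
by apply: lerD; rewrite ler_norml; apply/andP; split; lra.
Qed.

Lemma norm_box z r u : normc (u.1 +i* u.2 - z) <= r -> box z r u.
Proof.
move=> H; have := le_trans (Re_le_normc _) H; have := le_trans (Im_le_normc _) H.
case: u H => x y _; rewrite ReD ImD ReN ImN /= !ler_norml => /andP[a b] /andP[c d].
by split; rewrite /= in_itv /=; apply/andP; split; lra.
Qed.

Definition bfun (l : R) z r (u : T2) : \bar R := (l%:E * (\1_(box z r) u)%:E)%E.

Lemma bfun_ge0 l z r u : 0 <= l -> (0 <= bfun l z r u)%E.
Proof. by move=> l0; rewrite mule_ge0 // lee_fin. Qed.

Lemma measurable_bfun l z r : measurable_fun [set: T2] (bfun l z r).
Proof.
apply: measurable_funeM; apply/measurable_EFinP.
by apply: measurable_indic; exact: measurable_box.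
Qed.

Lemma integral_bfun l z r : 0 <= l -> 0 < r ->
  (\int[mu]_u bfun l z r u = (l * (4 * r ^+ 2))%:E)%E.
Proof.
move=> l0 r0; rewrite /bfun ge0_integralZl_EFin.
- rewrite integral_indic //; last exact: measurable_box.
  by rewrite setIT EFinM; congr (_ * _)%E; exact: box_measure.
- exact: measurableT.
- by move=> x _; rewrite lee_fin.
- by apply/measurable_EFinP; apply: measurable_indic; exact: measurable_box.
- exact: l0.
Qed.

Lemma bfun_in l z r u : box z r u -> bfun l z r u = l%:E.
Proof. by move=> bu; rewrite /bfun indicE mem_set // mule1. Qed.

Lemma bfun_out l z r u : ~ box z r u -> bfun l z r u = 0%E.
Proof. by move=> bu; rewrite /bfun indicE memNset // mule0. Qed.

(** Disjointness puts the sum of the step functions [bfun] pointwise below [phi]; that sum is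
    integrated exactly and compared through [integral_mono]. *)
Lemma boxes_le_integral (T : eqType) (s : seq T) (l r : T -> R) (z : T -> C) (phi : C -> R) :
  uniq s -> (forall w, 0 <= phi w) ->
  (forall i, 0 <= l i) -> (forall i, 0 < r i) ->
  (forall i u, box (z i) (r i) u -> l i <= phi (u.1 +i* u.2)) ->
  (forall i j u, i \in s -> j \in s -> i != j -> box (z i) (r i) u -> ~ box (z j) (r j) u) ->
  ((\sum_(i <- s) l i * (4 * r i ^+ 2))%:E <= plane_integral phi)%E.
Proof.
move=> us phi0 l0 r0 lphi disj.
have -> : (\sum_(i <- s) l i * (4 * r i ^+ 2))%:E =
    (\int[mu]_u \sum_(i <- s) bfun (l i) (z i) (r i) u)%E.
  rewrite ge0_integral_sum //.
  - by rewrite -sumEFin; apply: eq_bigr => i _; rewrite integral_bfun.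
  - by move=> i; exact: measurable_bfun.
  - by move=> i x _; exact: bfun_ge0.
apply: integral_mono => u; first by apply: sume_ge0 => i _; exact: bfun_ge0.
have [[i si bi]|nob] := pselect (exists2 i, i \in s & box (z i) (r i) u).
  rewrite (bigD1_seq i) //= big1_seq => [|j /andP[ji sj]].
    by rewrite adde0 bfun_in // lee_fin; exact: lphi.
  by rewrite bfun_out //; apply: (disj i j) => //; rewrite eq_sym.
rewrite big1_seq ?lee_fin // => j /andP[_ sj].
by rewrite bfun_out // => bj; apply: nob; exists j.
Qed.

Lemma dyadic_scale (d : R) : 0 <= d -> exists n, d <= 2 ^+ n /\ 2 ^+ n <= 2 * (1 + d).
Proof.
move=> d0; have ex : exists n, d <= 2 ^+ n.
  have [n dn] : exists n : nat, d < n%:R by exists (Num.bound d); exact: archi_boundP.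
  exists n; rewrite (le_trans (ltW dn)) // -natrX ler_nat.
  by rewrite ltnW // ltn_expl.
case: (ex_minnP ex) => n dn nmin; exists n; split => //.
case: n dn nmin => [|n] dn nmin; first by rewrite expr0; lra.
have : 2 ^+ n < d by rewrite ltNge; apply/negP => /nmin; rewrite ltnn.
by rewrite exprS; move: (2 ^+ n) => x; lra.
Qed.

Lemma geometric_nneseries (a x : R) : 0 <= a -> 0 <= x < 1 ->
  (\sum_(0 <= n <oo) (a * x ^+ n)%:E <= (a / (1 - x))%:E)%E.
Proof.
move=> a0 /andP[x0 x1].
have u0 n : (0 <= (a * x ^+ n)%:E)%E by rewrite lee_fin mulr_ge0 // exprn_ge0.
apply: lime_le; first by apply: is_cvg_nneseries => n _ _; exact: u0.
apply: nearW => n; rewrite sumEFin lee_fin.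
have -> : \sum_(0 <= i < n) a * x ^+ i = series (geometric a x) n by [].
rewrite geometric_seriesE ?lt_eqF //= ler_pM2r ?invr_gt0 ?subr_gt0 //.
by rewrite ler_piMr // lerBlDr lerDl exprn_ge0.
Qed.

(* Comparison with a sum over the dyadic boxes centred at [z0]. *)
Theorem tail_integral q : 2 < q -> exists2 B, 0 <= B &
  forall (phi : C -> R) z0 M, 0 <= M -> (forall z, 0 <= phi z) ->
  (forall z, phi z <= M * (1 + normc (z - z0)) `^ (- q)) ->
  (plane_integral phi <= (M * B)%:E)%E.
Proof.
(* From one dyadic box to the next the area is multiplied by 4 and the decay by [1 / K]; the ratio
   [x] is less than 1 because [q > 2]. *)
move=> q2; pose K : R := 2 `^ q; pose x := 4 / K.
have K4 : 4 < K.
  have -> : 4 = 2 `^ 2 :> R by rewrite powR_mulrn // expr2 -natrM.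
  by rewrite /K /powR gt_eqF // ltr_expR ltr_pM2r // ln_gt0 // ltr1n.
have K0 : 0 < K by apply: lt_trans K4.
have x01 : 0 <= x < 1.
  by rewrite /x divr_ge0 ?(ltW K0) //= ltr_pdivrMr // mul1r.
have B0 : 0 <= 4 * K / (1 - x).
  by case/andP: x01 => _ x1; rewrite divr_ge0 ?mulr_ge0 ?(ltW K0) // subr_ge0 ltW.
exists (4 * K / (1 - x)) => // phi z0 M M0 phi0 phiM.
(* The additional [K] pays for the factor 2 in [2 ^+ n <= 2 * (1 + d)]. *)
pose c n := M * (K / K ^+ n).
have c0 n : 0 <= c n by rewrite mulr_ge0 // divr_ge0 ?exprn_ge0 // ltW.
have r0 n : 0 < 2 ^+ n :> R by rewrite exprn_gt0.
have decay n d : 0 <= d -> 2 ^+ n <= 2 * (1 + d) -> M * (1 + d) `^ (- q) <= c n.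
  move=> d0 nd; rewrite ler_wpM2l // powRN ler_pdivlMr ?exprn_gt0 // mulrC.
  have d1 : 0 < 1 + d by lra.
  rewrite ler_pdivrMr ?powR_gt0 // -powRM ?(ltW d1) //.
  have -> : K ^+ n = (2 ^+ n) `^ q.
    by rewrite -powR_mulrn ?powR_ge0 // -powRrM mulrC powRrM powR_mulrn.
  by rewrite ge0_ler_powR ?nnegrE ?(ltW (r0 n)) ?mulr_ge0 ?(ltW d1) //; lra.
apply: (@le_trans _ _ (\int[mu]_u \sum_(0 <= n <oo) bfun (c n) z0 (2 ^+ n) u)%E).
  apply: integral_mono => u; first by rewrite lee_fin.
  set z := u.1 +i* u.2.
  have [n [dn nd]] := dyadic_scale (normc_ge0 (z - z0)).
  apply: le_trans (nneseries_lim_ge n.+1 _); last by move=> i _ _; exact: bfun_ge0.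
  rewrite big_nat_recr //=; apply: (@le_trans _ _ (bfun (c n) z0 (2 ^+ n) u)).
    rewrite bfun_in; last exact: norm_box.
    by rewrite lee_fin (le_trans (phiM z)) // decay ?normc_ge0.
  by rewrite leeDr // sume_ge0 // => i _; exact: bfun_ge0.
rewrite integral_nneseries //; first last.
- by move=> n u _; exact: bfun_ge0.
- by move=> n; exact: measurable_bfun.
apply: (@le_trans _ _ (\sum_(0 <= n <oo) (4 * M * K * x ^+ n)%:E)%E).
  apply: lee_nneseries => [n _ _|n _].
    by apply: integral_ge0 => u _; exact: bfun_ge0.
  rewrite integral_bfun // lee_fin le_eqVlt; apply/orP; left; apply/eqP.
  have -> : (2 ^+ n) ^+ 2 = 4 ^+ n :> R by rewrite exprAC expr2 -natrM.
  by rewrite /c /x exprMn exprVn; field; rewrite expf_neq0 // gt_eqF.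
apply: le_trans (geometric_nneseries _ x01) _.
  by rewrite !mulr_ge0 // ltW.
by rewrite lee_fin le_eqVlt; apply/orP; left; apply/eqP; ring.
Qed.

End PlaneIntegral.

(** * The spaces with finite exponent *)

Section FockLp.
Variable R : realType.
Local Notation C := R[i].
Variables (m : nat) (p : R).
Hypothesis p0 : 0 < p.
Implicit Types (f g h F : C -> C) (z w : C) (K M : R).

Local Notation wt := (wt m).

Lemma powR_le_inv (x y : R) : 0 <= x -> 0 <= y -> x `^ p <= y `^ p -> x <= y.
Proof.
move=> x0 y0 H.
have := ge0_ler_powR (r := p^-1) (ltac:(by rewrite invr_ge0 ltW)) _ _ H.
rewrite -!powRrM mulfV ?gt_eqF // !powRr1 //; apply; rewrite nnegrE powR_ge0 //.
Qed.

(** The [p]-th power of the norm, the form in which boxes and sums can be compared for every [p],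
    also below 1. *)
Definition mass f : \bar R := plane_integral (fun z => (normc (f z) * wt z) `^ p).

Lemma mass_ge0 f : (0 <= mass f)%E.
Proof. by apply: integral_ge0 => u _; rewrite lee_fin powR_ge0. Qed.

Lemma fock_norm_mass f : fock_norm m p%:E f = (mass f `^ p^-1)%E.
Proof.
rewrite /fock_norm /mass /plane_integral; congr (_ `^ _)%E; apply: eq_integral => u _.
congr (_%:E); rewrite powRM ?normc_ge0 ?(ltW (wt_gt0 m _)) //; congr (_ * _).
by rewrite /wt -expRM; congr expR; rewrite mulNr mulrC.
Qed.

Lemma fock_norm_ge0 f : (0 <= fock_norm m p%:E f)%E.
Proof. by rewrite fock_norm_mass poweR_ge0. Qed.

Lemma mass_of_norm f K : (fock_norm m p%:E f <= K%:E)%E -> (mass f <= (K `^ p)%:E)%E.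
Proof.
rewrite fock_norm_mass => H; have K0 : 0 <= K by rewrite -lee_fin (le_trans _ H) // poweR_ge0.
have := gt0_ler_poweR (ltW p0) _ _ H; rewrite -poweRrM mulVf ?gt_eqF // poweRe1 ?mass_ge0 //.
by rewrite poweR_EFin; apply; rewrite in_itv /= ?leey ?andbT ?poweR_ge0 // lee_fin.
Qed.

Lemma norm_of_mass f M : (mass f <= M%:E)%E -> (fock_norm m p%:E f <= (M `^ p^-1)%:E)%E.
Proof.
move=> H; have M0 : (0 <= M%:E)%E by exact: le_trans (mass_ge0 f) H.
rewrite fock_norm_mass -poweR_EFin; apply: gt0_ler_poweR H.
- by rewrite invr_ge0 ltW.
- by rewrite in_itv /= leey andbT mass_ge0.
- by rewrite in_itv /= leey andbT.
Qed.

Lemma fock_lpP f : fock m p%:E f <-> entire f /\ exists M, (mass f <= M%:E)%E.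
Proof.
split=> [[ef H]|[ef [M fM]]]; split=> //; last first.
  by apply: le_lt_trans (norm_of_mass fM) _; exact: ltry.
have := fock_norm_ge0 f; move: H; case E : (fock_norm _ _ _) => [K||] // _ _.
by exists (K `^ p); apply: mass_of_norm; rewrite E.
Qed.

Lemma box_mass f z1 r l : 0 < r -> 0 <= l ->
  (forall z, normc (z - z1) <= 2 * r -> l <= normc (f z) * wt z) ->
  ((l `^ p * (4 * r ^+ 2))%:E <= mass f)%E.
Proof.
move=> r0 l0 H.
have := @boxes_le_integral R unit [:: tt] (fun=> l `^ p) (fun=> r) (fun=> z1)
  (fun z => (normc (f z) * wt z) `^ p).
rewrite big_seq1; apply.
- by [].
- by move=> w; exact: powR_ge0.
- by move=> _; exact: powR_ge0.
- by [].
- move=> _ u /box_norm /H lu.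
  by apply: ge0_ler_powR; rewrite ?(ltW p0) ?nnegrE // (le_trans l0).
- by move=> [] [].
Qed.

(** [local_mass] finds near [z] a box whose mass is at least a fixed multiple of the [p]-th power of
    the weighted value at [z]. *)
Lemma mass_pointwise : exists2 A, 0 <= A &
  forall f z K, entire f -> (mass f <= (K `^ p)%:E)%E -> 0 <= K ->
  normc (f z) * wt z <= A * K.
Proof.
have [c c0 cP] := local_mass m p0.
have c40 : 0 < (4 * c)^-1 by rewrite invr_gt0 mulr_gt0.
exists ((4 * c)^-1 `^ p^-1) => [|f z K ef fK K0]; first exact: powR_ge0.
have [z1 [r [l [r0 _ l0 lP cl]]]] := cP f z ef.
have := le_trans (box_mass r0 l0 lP) fK; rewrite lee_fin => H.
apply: powR_le_inv; rewrite ?mulr_ge0 ?powR_ge0 ?normc_ge0 ?(ltW (wt_gt0 m z)) //.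
have -> : ((4 * c)^-1 `^ p^-1 * K) `^ p = (4 * c)^-1 * K `^ p.
  by rewrite powRM ?powR_ge0 // -powRrM mulVf ?gt_eqF // powRr1 // ltW.
rewrite ler_pdivlMl ?mulr_gt0 //; apply: le_trans H.
have -> : l `^ p * (4 * r ^+ 2) = 4 * (l `^ p * r ^+ 2) by ring.
by rewrite -mulrA ler_pM2l.
Qed.

(** For [F = volterra g f] this is the weighted value of [f] at [w] times [|g'(w)| / (1 + |w|)]. *)
Definition dnorm F w := normc (cderiv F w) * wt w / (1 + normc w).

Lemma dnorm_ge0 F w : 0 <= dnorm F w.
Proof.
by rewrite /dnorm divr_ge0 ?mulr_ge0 ?normc_ge0 ?(ltW (wt_gt0 m w)) // addr_ge0 ?normc_ge0.
Qed.

(** If every value on the disc were smaller, [derivative_weight_bound] would give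
    [dnorm F w <= dnorm F w / 2], so [dnorm F w = 0], and [w] itself would do. The factor 2 avoids
    attaining a supremum. *)
Lemma dnorm_witness F w : entire F -> exists2 z, normc (z - w) <= 1 &
  dnorm F w <= 2 * (16 * gauge_cst R m) * (normc (F z) * wt z).
Proof.
move=> eF; set K := 16 * gauge_cst R m.
have K0 : 0 < K by rewrite mulr_gt0 // (lt_le_trans ltr01) // gauge_cst_ge1.
have w1 : 0 < 1 + normc w by rewrite ltr_pwDl ?normc_ge0.
have D0 := dnorm_ge0 F w.
apply: contrapT => H.
have small z : normc (z - w) <= 1 -> normc (F z) * wt z <= dnorm F w / (2 * K).
  move=> zw; rewrite leNgt; apply/negP => lt; apply: H; exists z => //.
  by move: lt; rewrite ltr_pdivrMr ?mulr_gt0 // mulrC => /ltW.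
have := derivative_weight_bound eF small; rewrite -/K -ler_pdivrMr // -/(dnorm F w).
have -> : K * (dnorm F w / (2 * K)) = dnorm F w / 2 by field; rewrite gt_eqF.
move=> H2; have D00 : dnorm F w = 0 by apply/eqP; rewrite eq_le D0 andbT; lra.
apply: H; exists w; first by rewrite subrr normc0.
by rewrite D00 !mulr_ge0 ?normc_ge0 ?(ltW K0) ?(ltW (wt_gt0 m w)).
Qed.

(** Each point has a witness within 1, and each witness a box within a further 1; points more than 4
    apart therefore have disjoint boxes, and the masses add up. *)
Lemma lattice_mass : exists2 c, 0 < c & forall F (T : eqType) (s : seq T) (w : T -> C),
  entire F -> uniq s ->
  (forall i j, i \in s -> j \in s -> i != j -> 4 < normc (w i - w j)) ->
  ((c * \sum_(i <- s) dnorm F (w i) `^ p)%:E <= mass F)%E.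
Proof.
have [c c0 cP] := local_mass m p0.
set K := 2 * (16 * gauge_cst R m).
have K0 : 0 < K.
  by rewrite mulr_gt0 // mulr_gt0 // (lt_le_trans ltr01) // gauge_cst_ge1.
exists (4 * c * K^-1 `^ p) => [|F T s w eF us sep].
  by rewrite !mulr_gt0 // powR_gt0 // invr_gt0.
have /choice[y yP] : forall i, exists y : C * R * R,
    [/\ 0 < y.1.2, normc (y.1.1 - w i) + 2 * y.1.2 <= 2, 0 <= y.2,
      forall z, normc (z - y.1.1) <= 2 * y.1.2 -> y.2 <= normc (F z) * wt z &
      c * K^-1 `^ p * dnorm F (w i) `^ p <= y.2 `^ p * y.1.2 ^+ 2].
  move=> i; have [z zw zD] := dnorm_witness (w i) eF.
  have [z1 [r [l [r0 z1r l0 lP cl]]]] := cP F z eF.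
  exists (z1, r, l); split=> //=.
    by have := normc_triangle z z1 (w i); move: z1r zw; move: (normc _) (normc _) (normc _) => *; lra.
  apply: le_trans cl; rewrite -mulrA ler_pM2l // -powRM ?invr_ge0 ?(ltW K0) ?dnorm_ge0 //.
  apply: ge0_ler_powR; rewrite ?(ltW p0) ?nnegrE //.
  - by rewrite mulr_ge0 ?invr_ge0 ?(ltW K0) ?dnorm_ge0.
  - by rewrite mulr_ge0 ?normc_ge0 ?(ltW (wt_gt0 m _)).
  - by rewrite ler_pdivrMl.
apply: le_trans (boxes_le_integral (l := fun i => (y i).2 `^ p) (r := fun i => (y i).1.2)
  (z := fun i => (y i).1.1) us _ _ _ _ _).
- rewrite lee_fin mulr_sumr; apply: ler_sum => i _; have [_ _ _ _ H] := yP i.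
  have -> : 4 * c * K^-1 `^ p * dnorm F (w i) `^ p = 4 * (c * K^-1 `^ p * dnorm F (w i) `^ p) by ring.
  by rewrite [leRHS]mulrCA ler_pM2l.
- by move=> z; exact: powR_ge0.
- by move=> i; exact: powR_ge0.
- by move=> i; have [] := yP i.
- move=> i u /box_norm bu; have [_ _ l0 lP _] := yP i.
  have lu := lP _ bu.
  by apply: ge0_ler_powR; rewrite ?(ltW p0) ?nnegrE // (le_trans l0).
- move=> i j u si sj ij /box_norm bi /box_norm bj.
  have [_ wi _ _ _] := yP i; have [_ wj _ _ _] := yP j.
  have := sep i j si sj ij; apply/negP; rewrite -leNgt.
  set v := u.1 +i* u.2 in bi bj.
  apply: le_trans (normc_triangle v _ _) _.
  have t1 : normc (w i - v) <= 2.
    rewrite normc_distC; apply: le_trans (normc_triangle (y i).1.1 _ _) _.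
    by move: bi wi; move: (normc _) (normc _) => *; lra.
  have t2 : normc (v - w j) <= 2.
    apply: le_trans (normc_triangle (y j).1.1 _ _) _.
    by move: bj wj; move: (normc _) (normc _) => *; lra.
  by move: t1 t2; move: (normc _) (normc _) => *; lra.
Qed.

Lemma mass_upper (s : R) : 0 < s -> 2 < s * p -> exists2 B, 0 <= B & forall f M z0, 0 <= M ->
  (forall z, normc (f z) * wt z <= M * (1 + normc (z - z0)) `^ (- s)) ->
  (mass f <= (M `^ p * B)%:E)%E.
Proof.
move=> s0 sp; have [B B0 BP] := tail_integral sp; exists B => // f M z0 M0 H.
apply: (BP _ z0) => [|z|z]; [exact: powR_ge0|exact: powR_ge0|].
have -> : M `^ p * (1 + normc (z - z0)) `^ (- (s * p)) =
    (M * (1 + normc (z - z0)) `^ (- s)) `^ p.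
  by rewrite powRM ?powR_ge0 // -powRrM mulNr.
apply: ge0_ler_powR; rewrite ?(ltW p0) ?nnegrE //.
- by rewrite mulr_ge0 ?normc_ge0 ?(ltW (wt_gt0 m z)).
- by rewrite mulr_ge0 ?powR_ge0.
Qed.

Lemma mass_kern : exists M, forall w, (mass (kern m w) <= M%:E)%E.
Proof.
(* Any decay exponent with [s * p > 2] would do; here [s * p = 3]. *)
have s0 : 0 < 3 / p by rewrite divr_gt0.
have [B B0 BP] := mass_upper s0 (ltac:(by rewrite divfK ?gt_eqF // ltr_nat)).
have [K K0 KP] := bump_decay m (3 / p).
exists (K `^ p * B) => w; apply: (BP _ _ w) => [|z]; first exact: ltW.
exact: le_trans (kern_bound m w z) (KP _ (normc_ge0 _)).
Qed.

End FockLp.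

(** * Sums of kernels over a sparse lattice *)

Section LatticeSums.
Variable R : realType.
Local Notation C := R[i].
Local Notation Re := (@complex.Re R).
Local Notation Im := (@complex.Im R).
Implicit Types (z w : C) (L t x : R) (N : nat).

(** A bounded primitive of [(1 + |x|)^-2], used to sum this function over integer translates by
    telescoping. *)
Definition saturate x : R := x / (1 + `|x|).

Lemma saturate_step x : ((1 + `|x|) ^+ 2)^-1 <= 2 * (saturate (x + 1) - saturate x).
Proof.
have p : 0 < (1 + `|x|) ^+ 2 by rewrite exprn_gt0 // ltr_pwDl.
rewrite /saturate; have [x0|x0] := leP 0 x.
  rewrite !ger0_norm; [|by lra|by []].
  rewrite ger0_norm // in p; have q1 : 0 < 1 + x by lra.
  have q2 : 0 < 1 + (x + 1) by lra.
  have -> : (x + 1) / (1 + (x + 1)) - x / (1 + x) = ((1 + (x + 1)) * (1 + x))^-1.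
    by field; rewrite !gt_eqF //; lra.
  rewrite -(@invrK _ 2) -invfM lef_pV2 ?posrE //; last by rewrite !mulr_gt0 // invr_gt0.
  by rewrite expr2 mulrA ler_pM2r // mulrC ler_pdivrMr //; lra.
have [x1|x1] := leP 0 (x + 1).
  rewrite (ger0_norm x1) ltr0_norm //; rewrite ltr0_norm // in p.
  have q1 : 0 < 1 - x by lra.
  have q2 : 0 < 1 + (x + 1) by lra.
  apply: (@le_trans _ _ (((1 - x)^-1))).
    by rewrite lef_pV2 ?posrE // expr2 ler_peMr ?(ltW q1) //; lra.
  have -> : 2 * ((x + 1) / (1 + (x + 1)) - x / (1 - x)) =
     (1 - x)^-1 * (2 * ((x + 1) * (1 - x) - x * (1 + (x + 1))) / (1 + (x + 1))).
    by field; rewrite !gt_eqF //; lra.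
  rewrite ler_peMr ?invr_ge0 ?(ltW q1) // ler_pdivlMr //.
  have : 0 <= (x + 1) * - x by rewrite mulr_ge0 //; lra.
  by move=> h; nra.
rewrite !ltr0_norm //; rewrite ltr0_norm // in p.
have q1 : 0 < 1 - x by lra.
have q2 : 0 < - x by lra.
have xn : x != 0 by rewrite lt_eqF //; lra.
have q1n : 1 - x != 0 by rewrite gt_eqF.
have -> : (x + 1) / (1 + - (x + 1)) - x / (1 - x) = (- x * (1 - x))^-1.
  have -> : 1 + - (x + 1) = - x by ring.
  by field; rewrite q1n xn.
rewrite -(@invrK _ 2) -invfM lef_pV2 ?posrE //; last by rewrite !mulr_gt0 // invr_gt0.
by rewrite expr2 mulrA ler_pM2r // mulrC ler_pdivrMr //; lra.
Qed.

Lemma saturate_bound x : `|saturate x| <= 1.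
Proof.
have p : 0 < 1 + `|x| by rewrite ltr_pwDl.
by rewrite /saturate normrM normfV (gtr0_norm p) ler_pdivrMr // mul1r lerDr.
Qed.

(** The terms are dominated by twice the increments of [saturate], whose total variation is at most
    2. *)
Lemma sum_inv_sqr t N : \sum_(j < N) ((1 + `|j%:R - t|) ^+ 2)^-1 <= 4.
Proof.
rewrite -(big_mkord xpredT (fun j => ((1 + `|j%:R - t|) ^+ 2)^-1)).
apply: (@le_trans _ _ (\sum_(0 <= j < N) 2 * (saturate (j.+1%:R - t) - saturate (j%:R - t)))).
  apply: ler_sum => j _; apply: le_trans (saturate_step _) _.
  by rewrite -[j.+1]addn1 natrD addrAC.
rewrite -mulr_sumr telescope_sumr //.
have := saturate_bound (N%:R - t); have := saturate_bound (0 - t).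
by rewrite !ler_norml; move: (saturate _) (saturate _) => *; lra.
Qed.

Definition lpoint L N (i : 'I_N * 'I_N) : C := (L * i.1%:R) +i* (L * i.2%:R).

(** The exponent 4 is split as 2 + 2 between the coordinates, so the double sum is dominated by a
    product of two sums bounded by 4. *)
Lemma lattice_sum_inv L N z : 1 <= L ->
  \sum_(i : 'I_N * 'I_N) ((1 + normc (z - lpoint L i)) ^+ 4)^-1 <= 16.
Proof.
move=> L1; have L0 : 0 < L by lra.
pose a (t : R) (j : 'I_N) := ((1 + `|j%:R - t / L|) ^+ 2)^-1.
have dist (t : R) (j : 'I_N) : `|j%:R - t / L| <= `|t - L * j%:R|.
  have -> : t - L * j%:R = - L * (j%:R - t / L) by field; rewrite gt_eqF.
  by rewrite normrM normrN (gtr0_norm L0) ler_peMl.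
apply: (@le_trans _ _ (\sum_(i : 'I_N * 'I_N) a (Re z) i.1 * a (Im z) i.2)).
  apply: ler_sum => i _; rewrite /a -invfM.
  have n0 := normc_ge0 (z - lpoint L i).
  have d1 := le_trans (dist (Re z) i.1) (_ : _ <= normc (z - lpoint L i)).
  have d2 := le_trans (dist (Im z) i.2) (_ : _ <= normc (z - lpoint L i)).
  have {}d1 : `|i.1%:R - Re z / L| <= normc (z - lpoint L i).
    by apply: d1; rewrite -[L * _]/(Re (lpoint L i)) -ReN -ReD; exact: Re_le_normc.
  have {}d2 : `|i.2%:R - Im z / L| <= normc (z - lpoint L i).
    by apply: d2; rewrite -[L * _]/(Im (lpoint L i)) -ImN -ImD; exact: Im_le_normc.
  have p (x : R) : 0 < 1 + `|x| by rewrite ltr_pwDl.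
  have pn : 0 < 1 + normc (z - lpoint L i) by lra.
  rewrite lef_pV2 ?posrE ?mulr_gt0 ?exprn_gt0 ?p ?pn //.
  rewrite -[4%N]/(2 + 2)%N exprD.
  by rewrite ler_pM ?sqr_ge0 // lerXn2r ?nnegrE ?(ltW (p _)) ?(ltW pn) ?lerD2l.
rewrite [leLHS](_ : _ = (\sum_j a (Re z) j) * (\sum_j a (Im z) j)); last first.
  by rewrite big_distrlr /= pair_big.
have a0 t j : 0 <= a t j by rewrite invr_ge0 exprn_ge0 // addr_ge0.
have -> : 16 = 4 * 4 :> R by rewrite -natrM.
by rewrite ler_pM ?sumr_ge0 // sum_inv_sqr.
Qed.

Lemma lpoint_scale L N (i j : 'I_N * 'I_N) : 0 < L ->
  normc (lpoint L i - lpoint L j) = L * normc (lpoint 1 i - lpoint 1 j).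
Proof.
move=> L0; have -> : lpoint L i - lpoint L j = L%:C * (lpoint 1 i - lpoint 1 j).
  by apply: complex_eq => /=; ring.
by rewrite normcM normc_real gtr0_norm.
Qed.

Lemma natr_dist_ge1 (j k : nat) : j != k -> 1 <= `|j%:R - k%:R : R|.
Proof.
wlog jk : j k / (j < k)%N => [H jk|_].
  have [lt|lt|eq] := ltngtP j k; [exact: H|by rewrite distrC H // eq_sym|by rewrite eq eqxx in jk].
rewrite distrC ger0_norm ?subr_ge0 ?ler_nat 1?ltnW //.
by rewrite lerBrDr -(natrD _ 1%N) ler_nat.
Qed.

Lemma lpoint1_dist N (i j : 'I_N * 'I_N) : i != j -> 1 <= normc (lpoint 1 i - lpoint 1 j).
Proof.
case: i j => [i1 i2] [j1 j2]; rewrite xpair_eqE negb_and => /orP[] ne.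
  apply: le_trans (Re_le_normc _); rewrite ReD ReN /= !mul1r.
  exact: natr_dist_ge1.
apply: le_trans (Im_le_normc _); rewrite ImD ImN /= !mul1r.
exact: natr_dist_ge1.
Qed.

(** Off the diagonal the distance [d] at scale 1 is at least 1, so [1 + L * d >= (L / 2) * (1 + d)];
    this produces the small factor [(2 / L) ^+ 4]. *)
Lemma lattice_offdiag L N (i0 : 'I_N * 'I_N) : 1 <= L ->
  \sum_(i | i != i0) ((1 + normc (lpoint L i0 - lpoint L i)) ^+ 4)^-1 <= (2 / L) ^+ 4 * 16.
Proof.
move=> L1; have L0 : 0 < L by lra.
apply: (@le_trans _ _ ((2 / L) ^+ 4 * \sum_(i | i != i0)
    ((1 + normc (lpoint 1 i0 - lpoint 1 i)) ^+ 4)^-1)).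
  rewrite mulr_sumr; apply: ler_sum => i ii0.
  rewrite lpoint_scale //; have := lpoint1_dist (i := i0) (j := i); rewrite eq_sym => /(_ ii0) d1.
  move: (normc _) d1 => d d1; have q1 : 0 < 1 + d by lra.
  have q2 : 0 < 1 + L * d by rewrite addr_gt0 // mulr_gt0 //; lra.
  rewrite -exprVn -[in leRHS]exprVn -exprMn lerXn2r ?nnegrE ?invr_ge0 ?(ltW q2) //.
    by rewrite mulr_ge0 ?divr_ge0 ?invr_ge0 ?(ltW L0) ?(ltW q1).
  have -> : 2 / L * (1 + d)^-1 = ((L / 2) * (1 + d))^-1 by field; rewrite !gt_eqF.
  rewrite lef_pV2 ?posrE ?mulr_gt0 ?divr_gt0 //.
  have : L * 1 <= L * d by rewrite ler_pM2l.
  by rewrite mulr1 mulrDr mulr1 mulrAC; move: (L * d) => x; lra.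
rewrite ler_pM2l ?exprn_gt0 ?divr_gt0 //.
apply: le_trans (lattice_sum_inv (L := 1) N (lpoint 1 i0) (lexx 1)).
rewrite [leRHS](bigD1 i0) //= lerDr invr_ge0 exprn_ge0 // addr_ge0 ?normc_ge0 //.
Qed.

Lemma normc_sum (I : Type) (s : seq I) (P : pred I) (F : I -> C) :
  normc (\sum_(i <- s | P i) F i) <= \sum_(i <- s | P i) normc (F i).
Proof.
elim/big_ind2: _ => [|x y u v xy uv|//]; first by rewrite normc0.
by apply: le_trans (le_normcD _ _) _; exact: lerD.
Qed.

Variable m : nat.
Local Notation wt := (wt m).

Definition lkern L N z : C := \sum_(i : 'I_N * 'I_N) kern m (lpoint L i) z.

Lemma entire_lkern L N : entire (lkern L N).
Proof.
have H (s : seq ('I_N * 'I_N)) : exists df, forall z, hasder (fun z => \sum_(i <- s) kern m (lpoint L i) z) z (df z).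
  elim: s => [|i s [df IH]].
    by exists (fun=> 0) => z; apply: hasder_eq (hasder_cst 0 z) => // y; rewrite big_nil.
  exists (fun z => cderiv (kern m (lpoint L i)) z + df z) => z.
  apply: hasder_eq (hasderD (entire_hasder z (@entire_kern R m (lpoint L i))) (IH z)) => // y.
  by rewrite big_cons.
by have [df dP] := H (index_enum _); exact: (hasder_entire dP).1.
Qed.

(** Diagonal dominance: at a lattice point its own kernel has weighted size 1, and a coarse mesh
    makes all the others together at most [1 / 2]. *)
Theorem lkern_bounds : exists L B, 5 <= L /\ forall N, wbound m (lkern L N) B /\
  forall i : 'I_N * 'I_N, 2^-1 <= normc (lkern L N (lpoint L i)) * wt (lpoint L i).
Proof.
have [K K0 KP] := bump_decay m (4 : R).
have decay w z : normc (kern m w z) * wt z <= K * ((1 + normc (z - w)) ^+ 4)^-1.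
  apply: le_trans (kern_bound m w z) _; apply: le_trans (KP _ (normc_ge0 _)) _.
  by rewrite powRN powR_mulrn // addr_ge0 ?normc_ge0.
(* Then [2 / L] and [K * (2 / L)] are both at most [1 / 8], which is ample for the off-diagonal
   sum. *)
pose L := 16 * (K + 1); have L16 : 16 <= L by rewrite /L ler_peMr //; lra.
have L1 : 1 <= L by move: L16; move: (L) => x; lra.
have L0 : 0 < L by apply: lt_le_trans L1.
exists L, (K * 16); split; first by move: L16; move: (L) => x; lra.
move=> N; split=> [z|i0].
  have W := ltW (wt_gt0 m z).
  apply: le_trans (ler_wpM2r W (normc_sum _ _ _)) _; rewrite mulr_suml.
  apply: (@le_trans _ _ (\sum_(i : 'I_N * 'I_N) K * ((1 + normc (z - lpoint L i)) ^+ 4)^-1)).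
    by apply: ler_sum => i _; exact: decay.
  by rewrite -mulr_sumr ler_pM2l // lattice_sum_inv.
set z := lpoint L i0; have W := ltW (wt_gt0 m z).
rewrite /lkern (bigD1 i0) //= -/z.
set S := \sum_(i | _) _.
have S1 : normc S * wt z <= 2^-1.
  apply: le_trans (ler_wpM2r W (normc_sum _ _ _)) _; rewrite mulr_suml.
  apply: (@le_trans _ _ (\sum_(i | i != i0) K * ((1 + normc (z - lpoint L i)) ^+ 4)^-1)).
    by apply: ler_sum => i _; exact: decay.
  rewrite -mulr_sumr; apply: le_trans (ler_wpM2l (ltW K0) (lattice_offdiag i0 L1)) _.
  have l8 : 2 / L <= 8^-1.
    rewrite ler_pdivrMr // ler_pdivlMl //; move: L16; move: (L) => x; lra.
  have lK : K * (2 / L) <= 8^-1.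
    rewrite mulrA ler_pdivrMr // /L ler_pdivlMl //; move: K0; move: (K) => x; lra.
  have l0 : 0 <= 2 / L by rewrite divr_ge0 // ltW.
  have -> : K * ((2 / L) ^+ 4 * 16) = K * (2 / L) * ((2 / L) * (2 / L) * (2 / L) * 16) by ring.
  apply: (@le_trans _ _ (8^-1 * (8^-1 * 8^-1 * 8^-1 * 16))); last by lra.
  have a0 : 0 <= K * (2 / L) by rewrite mulr_ge0 // ltW.
  move: (K * (2 / L)) (2 / L) a0 l0 l8 lK => a b a0 b0 b8 a8.
  have bb : b * b <= 8^-1 * 8^-1 by apply: ler_pM.
  have bbb : b * b * b <= 8^-1 * 8^-1 * 8^-1 by apply: ler_pM => //; apply: mulr_ge0.
  by apply: ler_pM => //; [do 3! apply: mulr_ge0 => //|rewrite ler_pM2r].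
have := normcB (kern m z z + S) S; rewrite addrK => H.
have := ler_wpM2r W H; rewrite kern_diag mulrDl => H2.
by move: H2 S1; move: (normc S * _) (_ * _) => *; lra.
Qed.

End LatticeSums.

(** * Operators into the sup space *)

Section FockGeneral.
Variable R : realType.
Local Notation C := R[i].
Variable m : nat.
Implicit Types (f g h : C -> C) (K M e : R) (p q : \bar R).

Local Notation wt := (wt m).

Lemma norm_cvg0P (x : nat -> \bar R) : (forall n, 0 <= x n)%E ->
  x n @[n --> \oo] --> 0%E <->
  (forall e, 0 < e -> exists N, forall n, (N <= n)%N -> (x n <= e%:E)%E).
Proof.
move=> x0; split=> [cx e e0|H].
  have e1 : (0 < e%:E)%E by rewrite lte_fin.
  have [N _ NP] := cx _ (open_ereal_lt' e1).
  by exists N => n nN; apply: ltW; exact: NP.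
have x_fin e n : (x n <= e%:E)%E -> x n \is a fin_num.
  move=> xe; rewrite ge0_fin_numE //; exact: le_lt_trans xe (ltry _).
apply/fine_cvgP; split.
  by have [N NP] := H 1 ltr01; exists N => // n /= nN; apply: x_fin (NP n nN).
apply/cvgrPdist_le => e e0; have [N NP] := H e e0; exists N => // n /= nN.
have xe := NP n nN; rewrite sub0r normrN /= ger0_norm ?fine_ge0 //.
by rewrite -lee_fin fineK // (x_fin _ _ xe).
Qed.

Lemma fock_norm_pos p f : (0 < p)%E -> (0 <= fock_norm m p f)%E.
Proof.
by case: p => [r||] // p0; [exact: fock_norm_ge0|exact: fock_norm_oo_ge0].
Qed.

Lemma fock_norm_fin p f : (0 < p)%E -> fock m p f ->
  exists2 K, 0 <= K & fock_norm m p f = K%:E.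
Proof.
move=> p0 [_ fin]; have := fock_norm_pos f p0; move: fin.
by case: (fock_norm m p f) => [K||] // _ K0; exists K.
Qed.

(** Every space embeds in the sup space, so operators out of the [p]-space can be estimated from sup
    bounds alone. *)
Lemma fock_pointwise p : (0 < p)%E -> exists2 A, 0 <= A &
  forall f K, entire f -> (fock_norm m p f <= K%:E)%E -> wbound m f (A * K).
Proof.
case: p => [r||] // p0; last first.
  by exists 1 => // f K _ H; rewrite mul1r; apply/fock_norm_oo_le.
have r0 : 0 < r by rewrite -lte_fin.
have [A A0 AP] := mass_pointwise m r0; exists A => // f K ef H z.
apply: AP => //; first exact: mass_of_norm.
by rewrite -lee_fin (le_trans _ H) // fock_norm_ge0.
Qed.

Lemma fock_kern p : (0 < p)%E -> exists K, forall w,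
  fock m p (kern m w) /\ (fock_norm m p (kern m w) <= K%:E)%E.
Proof.
move=> p0; suff [K KP] : exists K, forall w, (fock_norm m p (kern m w) <= K%:E)%E.
  exists K => w; split => //; split; first exact: entire_kern.
  exact: le_lt_trans (KP w) (ltry _).
case: p p0 => [r||] // p0; last first.
  have [K _ KP] := wbound_kern R m; exists K => w; exact/fock_norm_oo_le.
have r0 : 0 < r by rewrite -lte_fin.
have [M MP] := mass_kern m r0; exists (M `^ r^-1) => w; exact: norm_of_mass.
Qed.

Lemma norm_nat (n : nat) : normc (n%:R : C) = n%:R.
Proof. by rewrite -(rmorph_nat (real_complex R)) normc_real normr_nat. Qed.

(* What boundedness and compactness into any of the spaces have in common. *)
Definition subseq_wbounded p (T : (C -> C) -> C -> C) := forall (u : nat -> C -> C) K,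
  (forall n, fock m p (u n) /\ (fock_norm m p (u n) <= K%:E)%E) ->
  exists (s : nat -> nat) S, (forall n, n <= s n)%N /\ forall n, wbound m (T (u (s n))) S.

Lemma bounded_subseq_wbounded p q T : (0 < p)%E -> (0 < q)%E ->
  bounded_op m p q T -> subseq_wbounded p T.
Proof.
move=> p0 q0 [B HB] u K uK; have [A A0 AP] := fock_pointwise q0.
exists id, (A * (`|B| * K)); split=> // n; have [un nK] := uK n.
have [Tu TB] := HB _ un; apply: AP; first exact: Tu.1.
have [k k0 kE] := fock_norm_fin p0 un; rewrite kE lee_fin in nK.
apply: le_trans TB _; rewrite kE -EFinM lee_fin.
apply: (@le_trans _ _ (`|B| * k)); first by rewrite ler_wpM2r // ler_norm.
by rewrite ler_wpM2l.
Qed.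

Lemma homo_ltn_ge (s : nat -> nat) : {homo s : i j / (i < j)%N} -> forall n, (n <= s n)%N.
Proof. by move=> hs; elim=> // n /leq_ltn_trans; apply; apply: hs. Qed.

(** From some index [N] on, the images along the subsequence are within 1 of the limit [h] in norm;
    the two resulting sup bounds are added. *)
Lemma compact_subseq_wbounded p q T : (0 < p)%E -> (0 < q)%E ->
  compact_op m p q T -> subseq_wbounded p T.
Proof.
move=> p0 q0 [TF Tc] u K uK; have [A A0 AP] := fock_pointwise q0.
have [s [h [hs hF cv]]] := Tc u K uK.
have [N NP] := (norm_cvg0P (fun n => fock_norm_pos _ q0)).1 cv 1 ltr01.
have [k k0 kE] := fock_norm_fin q0 hF.
exists (fun n => s (n + N)%N), (A * 1 + A * k); split=> n.
  by rewrite (leq_trans (leq_addr N n)) // homo_ltn_ge.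
have eT : entire (T (u (s (n + N)%N))) by exact: (TF _ (uK _).1).1.
have b1 := AP _ 1 (entire_sub eT hF.1).1 (NP _ (leq_addl n N)).
have b2 : wbound m h (A * k) by apply: AP hF.1 _; rewrite kE.
by have := wboundD b1 b2; congr (wbound m _ _); apply/funext => z; rewrite subrK.
Qed.

Variable g : C -> C.
Hypothesis eg : entire g.

(** A bound along a subsequence is enough: if [|g'|] exceeded [n (1 + |w_n|)] at points [w_n], the
    kernels at these points would contradict it, since [s n >= n]. *)
Lemma linear_growth p : (0 < p)%E -> subseq_wbounded p (volterra g) ->
  exists K, forall w, normc (cderiv g w) <= K * (1 + normc w).
Proof.
move=> p0 H; apply: contrapT => nK.
have /choice[w wP] : forall n : nat, exists w, n%:R * (1 + normc w) < normc (cderiv g w).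
  move=> n; apply: contrapT => H1; apply: nK; exists n%:R => w; rewrite leNgt.
  by apply/negP => lt; apply: H1; exists w.
have [K KP] := fock_kern p0.
have [s [S [sn sS]]] := H (fun n => kern m (w n)) K (fun n => KP (w n)).
have [n nS] : exists n : nat, `|16 * gauge_cst R m * S| < n%:R.
  by exists (Num.bound `|16 * gauge_cst R m * S|); exact: archi_boundP.
have := lt_le_trans (wP (s n)) (volterra_kern_bound eg (sS n)).
rewrite ltr_pM2r; last by rewrite ltr_pwDl ?normc_ge0.
apply/negP; rewrite -leNgt (le_trans (ler_norm _)) // (le_trans (ltW nS)) //.
by rewrite ler_nat.
Qed.

Lemma quadratic_of_growth K : (forall w, normc (cderiv g w) <= K * (1 + normc w)) ->
  exists a b c, forall z, g z = a * z ^+ 2 + b * z + c.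
Proof.
move=> H; have [a [b ab]] := liouville_affine (entire_cderiv eg) H.
exists (a / 2), b, (g 0); apply: primitive_affine => // z.
by rewrite ab; field.
Qed.

Lemma volterra_fock_oo c f M : 0 <= c -> (forall w, normc (cderiv g w) <= c * (1 + normc w)) ->
  entire f -> wbound m f M -> fock m +oo%E (volterra g f).
Proof.
move=> c0 gc ef fM; have [K K0 KP] := volterra_wbound m eg c0 gc.
by apply/fock_ooP; split; [exact: entire_volterra|exists (K * M); exact: KP].
Qed.

Lemma wbound_loc_bounded (u : nat -> C -> C) M : (forall n, wbound m (u n) M) ->
  forall n (r : R) z, normc z <= r ->
    normc (u n z) <= M * expR (1 / 2 * r ^+ 2 + (`|0 : R| + `|m%:R : R|) * r).
Proof.
move=> uM n r z zr; have M0 := wbound_ge0 (uM n).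
have := uM n z; rewrite le_wt_growth => /le_trans; apply; apply: ler_wpM2l => //.
by apply: growth_le_exp; rewrite ?normc_ge0.
Qed.

(** Montel gives only locally uniform convergence of the functions; their images converge in the sup
    norm, which both compactness proofs need. *)
Lemma volterra_convergent_subseq c (u : nat -> C -> C) M : 0 <= c ->
  (forall w, normc (cderiv g w) <= c) -> (forall n, entire (u n)) ->
  (forall n, wbound m (u n) M) ->
  exists (s : nat -> nat) f, [/\ {homo s : i j / (i < j)%N}, entire f, wbound m f M &
    forall e, 0 < e -> exists N, forall n, (N <= n)%N ->
      wbound m (fun z => volterra g (u (s n)) z - volterra g f z) e].
Proof.
move=> c0 gc eu uM.
have [s [f [hs lu]]] := montel eu (wbound_loc_bounded uM).
have ef := loc_unif_entire (fun n => eu (s n)) lu.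
exists s, f; split => // [|e e0].
  exact: loc_unif_wbound lu (fun n => uM (s n)).
exact: (volterra_compact eg c0 gc (fun n => eu (s n)) (fun n => uM (s n)) lu e0).
Qed.

Theorem bounded_to_oo p : (0 < p)%E ->
  bounded_op m p +oo%E (volterra g) <->
  exists a b c, forall z, g z = a * z ^+ 2 + b * z + c.
Proof.
move=> p0; split=> [B|[a [b [c gE]]]].
  have [K] := linear_growth p0 (bounded_subseq_wbounded p0 (ltry 0) B).
  exact: quadratic_of_growth.
have [A A0 AP] := fock_pointwise p0.
have c0 : 0 <= 2 * normc a + normc b by rewrite addr_ge0 ?mulr_ge0 ?normc_ge0.
have gc := quadratic_cderiv_bound gE.
have [K K0 KP] := volterra_wbound m eg c0 gc.
exists (K * A) => f fF; have [k k0 kE] := fock_norm_fin p0 fF.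
have fk : wbound m f (A * k) by apply: AP fF.1 _; rewrite kE.
split; first exact: volterra_fock_oo gc fF.1 fk.
by rewrite kE -EFinM; apply/fock_norm_oo_le; rewrite -mulrA; exact: KP fF.1 fk.
Qed.

Lemma affine_cderiv a b : (forall z, g z = a * z + b) -> forall z, cderiv g z = a.
Proof.
by move=> /funext ->; have [_ ->] := hasder_entire (fun z => hasder_affine a b z).
Qed.

(** For necessity, images of the kernels at the integers have a norm-convergent subsequence, whose
    limit is 0 by [volterra_kern_vanish]. So [|g'(k)| = o(1 + k)] along it, which a leading
    coefficient [a != 0] forbids. *)
Theorem compact_to_oo p : (0 < p)%E ->
  compact_op m p +oo%E (volterra g) <-> exists a b, forall z, g z = a * z + b.
Proof.
move=> p0; split=> [Cp|[a [b gE]]]; last first.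
  have [A A0 AP] := fock_pointwise p0.
  have gc w : normc (cderiv g w) <= normc a by rewrite (affine_cderiv gE).
  have gc' w : normc (cderiv g w) <= normc a * (1 + normc w).
    by rewrite (le_trans (gc w)) // ler_peMr ?normc_ge0 // lerDl normc_ge0.
  have toF := volterra_fock_oo (normc_ge0 a) gc'.
  split=> [f fF|u K uK].
    have [k k0 kE] := fock_norm_fin p0 fF.
    by apply: (toF f (A * k)) fF.1 _; apply: AP fF.1 _; rewrite kE.
  have eu n : entire (u n) := (uK n).1.1.
  have uM n : wbound m (u n) (A * K) := AP _ _ (eu n) (uK n).2.
  have [s [f [hs ef fM cv]]] := volterra_convergent_subseq (normc_ge0 a) gc eu uM.
  exists s, (volterra g f); split; [exact: hs|exact: (toF _ _ ef fM)|].
  apply/norm_cvg0P => [n|e /cv[N NP]]; first exact: fock_norm_oo_ge0.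
  by exists N => n /NP H; apply/fock_norm_oo_le.
have [K] := linear_growth p0 (compact_subseq_wbounded p0 (ltry 0) Cp).
move=> /quadratic_of_growth[a [b [c gE]]].
suff a0 : a = 0 by exists b, c => z; rewrite gE a0 mul0r add0r.
apply/eqP; apply: contraT => an; have a0 : 0 < normc a by rewrite normc_gt0.
have [B BP] := fock_kern p0.
have [s [h [hs hF cv]]] := Cp.2 (fun n => kern m n%:R) B (fun n => BP n%:R).
have {}cv := (norm_cvg0P (fun n => fock_norm_oo_ge0 m _)).1 cv.
have h0 z : h z = 0.
  apply: eq0_normc; apply/eqP; rewrite eq_le normc_ge0 andbT.
  have W := wt_gt0 m z; rewrite -(pmulr_lle0 _ W).
  apply/ler_addgt0Pl => e e0; rewrite addr0; have e2 : 0 < e / 2 by rewrite divr_gt0.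
  have [N1 NP1] := cv _ e2.
  have [N2 NP2] := volterra_kern_vanish m z eg (divr_gt0 e2 W).
  pose n := maxn N1 N2.
  have b1 := (fock_norm_oo_le m _ _).1 (NP1 n (leq_maxl _ _)) z.
  have b2 := NP2 (s n) (leq_trans (leq_maxr _ _) (homo_ltn_ge hs n)).
  rewrite ler_pdivlMr // in b2.
  have -> : h z = volterra g (kern m (s n)%:R) z - (volterra g (kern m (s n)%:R) z - h z) by ring.
  apply: le_trans (ler_wpM2r (ltW W) (normcB _ _)) _; rewrite mulrDl.
  by rewrite [leRHS](_ : _ = e / 2 + e / 2); [exact: lerD|field].
pose G := 16 * gauge_cst R m.
have G0 : 0 < G by rewrite mulr_gt0 // (lt_le_trans ltr01) // gauge_cst_ge1.
(* With the tolerance [normc a / G], [volterra_kern_bound] yields [|g'(k)| <= |a| (1 + k)]. *)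
have [N NP] := cv _ (divr_gt0 a0 G0).
(* For [k >= n] one has [2 |a| k - |b| > |a| (1 + k)]. *)
have [n nP] : exists n : nat, (normc a + normc b) / normc a < n%:R.
  exists (Num.bound ((normc a + normc b) / normc a)); apply: archi_boundP.
  by rewrite divr_ge0 ?addr_ge0 ?normc_ge0.
pose k := s (maxn N n).
have nk : (n <= k)%N by rewrite (leq_trans (leq_maxr N n)) // homo_ltn_ge.
have vb : wbound m (volterra g (kern m k%:R)) (normc a / G).
  have := (fock_norm_oo_le m _ _).1 (NP (maxn N n) (leq_maxl _ _)).
  by congr (wbound m _ _); apply/funext => z; rewrite /= h0 subr0.
have := volterra_kern_bound eg vb; rewrite -/G mulrCA mulfV ?gt_eqF // mulr1 norm_nat.
rewrite (cderiv_quadratic gE) => up.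
have low : 2 * normc a * k%:R - normc b <= normc (2 * a * k%:R + b).
  have := normcB (2 * a * k%:R + b) b; rewrite addrK !normcM !norm_nat.
  by move: (normc (_ + _)) (2 * normc a * _) => *; lra.
have nk' : (normc a + normc b) / normc a < (k%:R : R) by rewrite (lt_le_trans nP) // ler_nat.
rewrite ltr_pdivrMr // in nk'.
exfalso; have := le_trans low up; move: nk'.
by move: (normc a) (normc b) (k%:R : R) => x y v; lra.
Qed.

End FockGeneral.

(** * Operators from the sup space to finite exponents *)

Section FromSupToLp.
Variable R : realType.
Local Notation C := R[i].
Variables (m : nat) (p : R).
Hypothesis p0 : 0 < p.
Variable g : C -> C.
Hypothesis eg : entire g.
Implicit Types (f h u : C -> C) (K M e L S : R).

Local Notation wt := (wt m).

Let pE : (0 < p%:E)%E. Proof. by rewrite lte_fin. Qed.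

(** Indexing by natural numbers makes lattices of different sizes comparable, which the pairs of
    ordinals in [lpoint] do not allow. *)
Definition dsum (A : nat -> nat -> R) N := \sum_(0 <= j < N) \sum_(0 <= k < N) A j k.

Lemma sum_nat_mono (f : nat -> R) N N' : (forall j, 0 <= f j) -> (N <= N')%N ->
  \sum_(0 <= j < N) f j <= \sum_(0 <= j < N') f j.
Proof. by move=> f0 NN'; rewrite [leRHS](@big_cat_nat _ _ _ N) ?leq0n //= lerDl sumr_ge0. Qed.

Lemma dsum_mono (A : nat -> nat -> R) N N' : (forall j k, 0 <= A j k) -> (N <= N')%N -> dsum A N <= dsum A N'.
Proof.
move=> A0 NN'; apply: le_trans (sum_nat_mono _ NN') => [|j]; last by rewrite sumr_ge0.
by apply: ler_sum => j _; exact: sum_nat_mono.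
Qed.

Lemma dsum_pair (A : nat -> nat -> R) N : \sum_(i : 'I_N * 'I_N) A i.1 i.2 = dsum A N.
Proof.
rewrite /dsum big_mkord; under [RHS]eq_bigr do rewrite big_mkord.
by rewrite pair_big.
Qed.

(** The division by 2 reflects the lower bound [2^-1] for the weighted size of [lkern] at lattice
    points. *)
Definition amplitude L j k : R :=
  let w := (L * j%:R) +i* (L * k%:R) in (normc (cderiv g w) / (1 + normc w) / 2) `^ p.

Lemma amplitude_ge0 L j k : 0 <= amplitude L j k. Proof. exact: powR_ge0. Qed.

Lemma dnorm_volterra u w : entire u ->
  dnorm m (volterra g u) w = normc (u w) * wt w * (normc (cderiv g w) / (1 + normc w)).
Proof.
move=> eu; have eV := entire_volterra eu eg.
have dV := hasder_unique (entire_hasder w eV) (hasder_volterra w eu eg).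
by rewrite /dnorm dV normcM; ring.
Qed.

Lemma dnormD F h w : entire F -> entire h ->
  dnorm m F w <= dnorm m (fun z => F z - h z) w + dnorm m h w.
Proof.
move=> eF eh; rewrite /dnorm (entire_sub eF eh).2 -!mulrDl.
rewrite !ler_pM2r ?wt_gt0 // ?invr_gt0 ?ltr_pwDl ?normc_ge0 //.
by have := le_normcD (cderiv F w - cderiv h w) (cderiv h w); rewrite subrK.
Qed.

(** A substitute for convexity, valid also for [p < 1]: the sum is at most twice the larger term. *)
Lemma powRD_le (x y z : R) : 0 <= x -> 0 <= y -> 0 <= z -> x <= y + z ->
  x `^ p <= 2 `^ p * (y `^ p + z `^ p).
Proof.
move=> x0 y0 z0 xyz.
wlog yz : y z y0 z0 xyz / y <= z => [H|].
  have [yz|/ltW zy] := leP y z; first exact: H.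
  by rewrite [y `^ p + _]addrC; apply: H => //; rewrite addrC.
apply: (@le_trans _ _ ((2 * z) `^ p)).
  by apply: ge0_ler_powR; rewrite ?(ltW p0) ?nnegrE ?mulr_ge0 //; lra.
by rewrite powRM // ler_wpM2l ?powR_ge0 // lerDr powR_ge0.
Qed.

(** The test functions are bounded in the sup space uniformly in [N]. In the compact case the images
    are compared with the limit [h]: the difference has norm at most 1, and [h] contributes a fixed
    mass. *)
Lemma lattice_dnorm_bounded L B : 5 <= L -> (forall N, wbound m (lkern m L N) B) ->
  bounded_op m +oo%E p%:E (volterra g) \/ compact_op m +oo%E p%:E (volterra g) ->
  exists (s : nat -> nat) S, (forall n, n <= s n)%N /\ forall n,
    \sum_(i : 'I_(s n) * 'I_(s n)) dnorm m (volterra g (lkern m L (s n))) (lpoint L i) `^ p <= S.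
Proof.
move=> L5 uB hyp; have L0 : 0 < L by lra.
have [c c0 cP] := lattice_mass m p0.
have sep N (i j : 'I_N * 'I_N) : i \in index_enum _ -> j \in index_enum _ -> i != j ->
    4 < normc (lpoint L i - lpoint L j).
  move=> _ _ ij; rewrite lpoint_scale //.
  have : L * 1 <= L * normc (lpoint 1 i - lpoint 1 j) by rewrite ler_pM2l // lpoint1_dist.
  by move: (L * normc _) => d; lra.
have lat F N M : entire F -> (mass m p F <= M%:E)%E ->
    \sum_(i : 'I_N * 'I_N) dnorm m F (lpoint L i) `^ p <= M / c.
  move=> eF FM; rewrite ler_pdivlMr // mulrC -lee_fin; apply: le_trans FM.
  exact: (cP F _ _ (@lpoint R L N) eF (index_enum_uniq _) (@sep N)).
have uF N : fock m +oo%E (lkern m L N).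
  by apply/fock_ooP; split; [exact: entire_lkern|exists B].
have uN N : (fock_norm m +oo%E (lkern m L N) <= B%:E)%E by apply/fock_norm_oo_le.
case: hyp => [[K HB]|[TF Tc]].
  exists id, ((`|K| * B) `^ p / c); split=> // n.
  have [Vu VK] := HB _ (uF n); apply: lat; first exact: Vu.1.
  apply: (mass_of_norm p0); apply: le_trans VK _.
  have [k k0 kE] := fock_norm_fin (ltry 0) (uF n); have := uN n; rewrite kE lee_fin => kB.
  rewrite -EFinM lee_fin; apply: (@le_trans _ _ (`|K| * k)).
    by rewrite ler_wpM2r // ler_norm.
  by rewrite ler_wpM2l.
have [s [h [hs hF cv]]] := Tc (fun N => lkern m L N) B (fun N => conj (uF N) (uN N)).
have [N NP] := (norm_cvg0P (fun n => fock_norm_pos m _ pE)).1 cv 1 ltr01.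
have [M hM] := ((fock_lpP m p0 h).1 hF).2.
exists (fun n => s (n + N)%N), (2 `^ p * (1 `^ p / c + M / c)); split=> n.
  by rewrite (leq_trans (leq_addr N n)) // homo_ltn_ge.
set k := s (n + N)%N.
have eV : entire (volterra g (lkern m L k)) by exact: (entire_volterra (@entire_lkern R m L k) eg).
have eD := (entire_sub eV hF.1).1.
have b1 := lat _ k _ eD (mass_of_norm p0 (NP _ (leq_addl n N))).
have b2 := lat _ k _ hF.1 hM.
apply: le_trans (ler_wpM2l (powR_ge0 2 p) (lerD b1 b2)).
rewrite -big_split /= mulr_sumr; apply: ler_sum => i _.
by apply: powRD_le; rewrite ?dnorm_ge0 //; exact: dnormD eV hF.1.
Qed.

Lemma amplitude_bounded :
  bounded_op m +oo%E p%:E (volterra g) \/ compact_op m +oo%E p%:E (volterra g) ->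
  exists L S, 5 <= L /\ forall N, dsum (amplitude L) N <= S.
Proof.
move=> hyp; have [L [B [L5 LB]]] := lkern_bounds R m.
have [s [S [sn sS]]] := lattice_dnorm_bounded L5 (fun N => (LB N).1) hyp.
exists L, S; split => // N; apply: le_trans (dsum_mono (amplitude_ge0 L) (sn N)) _.
apply: le_trans (sS N); rewrite -dsum_pair; apply: ler_sum => i _.
rewrite /amplitude -/(lpoint L i); set w := lpoint L i.
have q0 : 0 <= normc (cderiv g w) / (1 + normc w) by rewrite divr_ge0 ?addr_ge0 ?normc_ge0.
apply: ge0_ler_powR; rewrite ?(ltW p0) ?nnegrE ?dnorm_ge0 //.
  exact: divr_ge0 q0 (ler0n R 2).
rewrite dnorm_volterra; last exact: entire_lkern.
by rewrite [leLHS]mulrC ler_wpM2r //; exact: (LB _).2.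
Qed.

(** If [a != 0], the terms of the row [k = 0] stay above a positive constant from some index on, so
    the sums grow at least linearly. *)
Lemma affine_of_amplitude L S a b : 5 <= L -> (forall N, dsum (amplitude L) N <= S) ->
  (forall z, cderiv g z = 2 * a * z + b) -> a = 0.
Proof.
move=> L5 AS dg; apply/eqP; apply: contraT => an.
have a0 : 0 < normc a by rewrite normc_gt0.
have [j0 j0P] : exists j0 : nat, normc b / normc a < j0%:R.
  by exists (Num.bound (normc b / normc a)); apply: archi_boundP; rewrite divr_ge0 ?normc_ge0.
(* For [j >= j0] the derivative is at least [|a| |w|], and [|w| >= 1] gives
   [|w| / (1 + |w|) >= 1 / 2]; the other 2 belongs to [amplitude]. *)
pose d := (normc a / 4) `^ p; have d0 : 0 < d by rewrite powR_gt0 // divr_gt0.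
have low j : (j0 <= j)%N -> (0 < j)%N -> d <= amplitude L j 0.
  move=> jj0 jp; rewrite /amplitude; set w := _ +i* _.
  have nw : normc w = L * j%:R.
    have -> : w = (L * j%:R)%:C by apply: complex_eq => //=; rewrite mulr0.
    by rewrite normc_real ger0_norm // mulr_ge0 //; lra.
  have j1 : 1 <= j%:R :> R by rewrite ler1n.
  have wj : j%:R <= normc w by rewrite nw ler_peMl //; lra.
  have aw : normc b <= normc a * normc w.
    rewrite mulrC -ler_pdivrMr // (le_trans (ltW j0P)) // (le_trans _ wj) //.
    by rewrite ler_nat.
  have lowg : normc a * normc w <= normc (cderiv g w).
    rewrite dg; have := normcB (2 * a * w + b) b; rewrite addrK !normcM norm_nat.
    by move: aw; rewrite -mulrA; move: (normc (_ + _)) (normc a * normc w) => *; lra.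
  have w1 : 0 < 1 + normc w by rewrite ltr_pwDl ?normc_ge0.
  apply: ge0_ler_powR; rewrite ?(ltW p0) ?nnegrE ?divr_ge0 ?normc_ge0 ?(ltW w1) //.
  rewrite ler_pdivlMr // ler_pdivlMr //; apply: le_trans lowg.
  have : normc a * 1 <= normc a * normc w by rewrite ler_pM2l // (le_trans j1).
  have -> : normc a / 4 * 2 * (1 + normc w) = normc a / 2 + normc a * normc w / 2 by field.
  by rewrite mulr1; move: (normc a * normc w) => x; lra.
have [M MP] : exists M : nat, `|S| / d < M%:R.
  by exists (Num.bound (`|S| / d)); apply: archi_boundP; rewrite divr_ge0 // ltW.
suff : S < dsum (amplitude L) (j0.+1 + M)%N by rewrite ltNge AS.
rewrite ltr_pdivrMr // in MP; apply: le_lt_trans (ler_norm S) _; apply: lt_le_trans MP _.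
rewrite /dsum; apply: (@le_trans _ _ (\sum_(j0.+1 <= j < j0.+1 + M) d)).
  by rewrite sumr_const_nat addKn mulr_natl.
apply: (@le_trans _ _ (\sum_(j0.+1 <= j < j0.+1 + M)
    \sum_(0 <= k < j0.+1 + M) amplitude L j k)).
  rewrite big_nat_cond [leRHS]big_nat_cond; apply: ler_sum => j /andP[/andP[jj _] _].
  rewrite addSn big_nat_recl // (le_trans (low j (ltnW jj) (leq_ltn_trans (leq0n _) jj))) //.
  by rewrite lerDl sumr_ge0 // => k _; exact: amplitude_ge0.
rewrite [leRHS](@big_cat_nat _ _ _ j0.+1) ?leq_addr //= lerDr.
by apply: sumr_ge0 => j _; apply: sumr_ge0 => k _; exact: amplitude_ge0.
Qed.

(* [1 + |w| <= L (1 + j + k)] makes the lattice sum dominate the harmonic series. *)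
Lemma const_of_amplitude L S b : 5 <= L -> p <= 2 -> (forall N, dsum (amplitude L) N <= S) ->
  (forall z, cderiv g z = b) -> b = 0.
Proof.
move=> L5 p2 AS dg; apply/eqP; apply: contraT => bn.
have L0 : 0 < L by lra.
have b0 : 0 < normc b by rewrite normc_gt0.
pose d := (normc b / L / 2) `^ p; have d0 : 0 < d by rewrite powR_gt0 // !divr_gt0.
have low j k : d * ((1 + j%:R + k%:R) ^+ 2)^-1 <= amplitude L j k.
  rewrite /amplitude; set w := _ +i* _; rewrite dg.
  have j0 : 0 <= j%:R :> R by []. have k0 : 0 <= k%:R :> R by [].
  have n1 : 1 <= 1 + j%:R + k%:R :> R by lra.
  have n0 : 0 < 1 + j%:R + k%:R :> R by lra.
  have nw : normc w <= L * j%:R + L * k%:R.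
    by apply: le_trans (normc_le_ReIm w) _; rewrite /= !ger0_norm // mulr_ge0 // ltW.
  have w1 : 0 < 1 + normc w by rewrite ltr_pwDl ?normc_ge0.
  have wL : 1 + normc w <= L * (1 + j%:R + k%:R).
    by move: nw; rewrite !mulrDr mulr1; move: (L * j%:R) (L * k%:R) => *; lra.
  apply: (@le_trans _ _ ((normc b / L / 2 * (1 + j%:R + k%:R)^-1) `^ p)).
    rewrite powRM ?invr_ge0 ?(ltW n0) ?divr_ge0 ?normc_ge0 ?(ltW L0) // ler_pM2l //.
    rewrite -exprVn -powR_mulrn ?invr_ge0 ?(ltW n0) //.
    (* Here [p <= 2] enters: the base is at most 1, so the smaller exponent gives the larger
       power. *)
    by apply: ger_powR => //; rewrite invr_gt0 n0 invf_le1.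
  apply: ge0_ler_powR; rewrite ?(ltW p0) ?nnegrE ?mulr_ge0 ?invr_ge0 ?normc_ge0 ?(ltW w1) ?(ltW n0) ?(ltW L0) //.
  have -> : normc b / L / 2 * (1 + j%:R + k%:R)^-1 = normc b / (L * (1 + j%:R + k%:R)) / 2.
    by field; rewrite !gt_eqF.
  by rewrite ler_pM2r // ler_pM2l // lef_pV2 // posrE mulr_gt0.
have har N : d / 4 * series harmonic N <= S.
  apply: le_trans (AS N); rewrite /series /= mulr_sumr.
  rewrite big_nat_cond /dsum [leRHS]big_nat_cond; apply: ler_sum => j /andP[/andP[_ jN] _].
  (* In row [j] only [k <= j] is kept: [j + 1] terms, each at least [d / (4 (j + 1)^2)], give a
     multiple of [1 / (j + 1)]. *)
  apply: (@le_trans _ _ (\sum_(0 <= k < j.+1) d * ((2 * j.+1%:R) ^+ 2)^-1)).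
    rewrite sumr_const_nat subn0 -mulr_natr.
    have jn : j.+1%:R != 0 :> R by rewrite pnatr_eq0.
    by rewrite le_eqVlt; apply/orP; left; apply/eqP; rewrite /harmonic /=; field; rewrite addrC -natr1 in jn *.
  apply: (@le_trans _ _ (\sum_(0 <= k < j.+1) amplitude L j k)); last first.
    by apply: sum_nat_mono => // k; exact: amplitude_ge0.
  rewrite big_nat_cond [leRHS]big_nat_cond; apply: ler_sum => k /andP[/andP[_ kj] _].
  apply: le_trans (low j k); rewrite ler_pM2l //.
  have n0 : 0 < 1 + j%:R + k%:R :> R by rewrite ltr_wpDr // ltr_wpDr.
  rewrite lef_pV2 ?posrE ?exprn_gt0 ?mulr_gt0 ?ltr0n //.
  rewrite lerXn2r ?nnegrE ?(ltW n0) ?mulr_ge0 //.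
  have : k%:R <= j%:R :> R by rewrite ler_nat -ltnS.
  by rewrite -natr1; lra.
exfalso; apply: (@dvg_harmonic R); apply: nondecreasing_is_cvgn.
  move=> n n' nn'; apply: sum_nat_mono => // j.
  by rewrite invr_ge0.
exists (S / (d / 4)) => _ [n _ <-]; rewrite ler_pdivlMr ?divr_gt0 // mulrC.
exact: har.
Qed.

Lemma volterra_cst f : entire f -> (forall z, cderiv g z = 0) -> volterra g f = fun=> 0.
Proof.
move=> ef dg; apply: (eq_primitive (dA := fun=> 0)) => [z|z|].
- by have := hasder_volterra z ef eg; rewrite dg mulr0.
- exact: hasder_cst.
- exact: volterra0.
Qed.

Lemma fock_norm_zero : (fock_norm m p%:E (fun=> 0%R) <= 0)%E.
Proof.
have H : (mass m p (fun=> 0%R) <= 0%:E)%E.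
  rewrite /mass /plane_integral integral0_eq // => u _.
  by rewrite normc0 mul0r powR0 // gt_eqF.
by have := norm_of_mass p0 H; rewrite powR0 // invr_neq0 // gt_eqF.
Qed.

Lemma fock_zero : fock m p%:E (fun=> 0 : C).
Proof.
split; first exact: entire_cst.
exact: le_lt_trans fock_norm_zero (ltry _).
Qed.

(** The decay [1 / (1 + |z|)] of the weighted image has an integrable [p]-th power in the plane, as
    [p > 2]. *)
Lemma volterra_norm_decay c : 2 < p -> 0 <= c -> (forall w, normc (cderiv g w) <= c) ->
  exists2 K, 0 <= K & forall f M, entire f -> wbound m f M ->
    (fock_norm m p%:E (volterra g f) <= (K * M)%:E)%E.
Proof.
move=> p2 c0 gc; have [K K0 KP] := volterra_wdecay m eg c0 gc.
have [B B0 BP] := mass_upper m p0 ltr01 (ltac:(by rewrite mul1r)).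
exists (K * B `^ p^-1) => [|f M ef fM]; first by rewrite mulr_ge0 // powR_ge0.
have M0 := wbound_ge0 fM; have KM : 0 <= K * M by rewrite mulr_ge0.
have H : (mass m p (volterra g f) <= ((K * M) `^ p * B)%:E)%E.
  apply: (BP _ _ 0) => // z; rewrite subr0 powR_inv1; last by rewrite addr_ge0 ?normc_ge0.
  exact: KP ef fM z.
apply: le_trans (norm_of_mass p0 H) _.
rewrite lee_fin powRM ?powR_ge0 // -powRrM mulfV ?gt_eqF // powRr1 // mulrAC.
by rewrite -mulrA [B `^ _ * _]mulrC mulrA.
Qed.

(** Interpolation: with [2 < q < p], the power [x^p] is split as [x^(p-q) x^q]. The first factor is
    small by the sup bound [d], the second integrable by the decay. It upgrades sup convergence to
    convergence in the [p]-norm. *)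
Lemma small_norm c M e : 2 < p -> 0 <= c -> (forall w, normc (cderiv g w) <= c) -> 0 <= M -> 0 < e ->
  exists2 d, 0 < d & forall f, entire f -> wbound m f M -> wbound m (volterra g f) d ->
    (fock_norm m p%:E (volterra g f) <= e%:E)%E.
Proof.
move=> p2 c0 gc M0 e0; have [K K0 KP] := volterra_wdecay m eg c0 gc.
pose q := (p + 2) / 2; have q2 : 2 < q by rewrite /q; lra.
have qp : 0 < p - q by rewrite /q; lra.
have q0 : 0 < q by apply: lt_trans q2.
have [B B0 BP] := tail_integral q2.
pose D := (K * M) `^ q * B + 1; have D0 : 0 < D by rewrite ltr_wpDl // mulr_ge0 // powR_ge0.
have KM : 0 <= K * M by rewrite mulr_ge0.
pose d := (e `^ p / D) `^ (p - q)^-1.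
have ep : 0 < e `^ p / D by rewrite divr_gt0 // powR_gt0.
have d0 : 0 < d by rewrite powR_gt0.
exists d => // f ef fM Vd.
have H : (mass m p (volterra g f) <= (e `^ p)%:E)%E.
  have dM : 0 <= d `^ (p - q) * (K * M) `^ q by rewrite mulr_ge0 ?powR_ge0.
  apply: (@le_trans _ _ (d `^ (p - q) * (K * M) `^ q * B)%:E).
    apply: (BP _ 0) => // [z|z]; first exact: powR_ge0.
    rewrite subr0; set x := normc _ * _.
    have x0 : 0 <= x by rewrite mulr_ge0 ?normc_ge0 ?(ltW (wt_gt0 m z)).
    have z1 : 0 < 1 + normc z by rewrite ltr_pwDl ?normc_ge0.
    have [->|xn] := eqVneq x 0; first by rewrite powR0 ?gt_eqF // mulr_ge0 ?powR_ge0.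
    have -> : x `^ p = x `^ (p - q) * x `^ q.
      by rewrite -powRD ?subrK // xn implybT.
    rewrite -[leRHS]mulrA ler_pM ?powR_ge0 //.
      apply: ge0_ler_powR; rewrite ?(ltW qp) ?nnegrE ?(ltW d0) //; exact: Vd.
    have -> : (K * M) `^ q * (1 + normc z) `^ (- q) = (K * M / (1 + normc z)) `^ q.
      rewrite [RHS]powRM ?invr_ge0 ?(ltW z1) // powRN; congr (_ * _).
      by rewrite -[(1 + normc z)^-1]powR_inv1 ?(ltW z1) // -powRrM mulN1r powRN.
    apply: ge0_ler_powR; rewrite ?(ltW q0) ?nnegrE ?divr_ge0 ?(ltW z1) //.
    exact: KP ef fM z.
  rewrite lee_fin /d -powRrM mulVf ?gt_eqF // powRr1 ?(ltW ep) //.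
  rewrite -mulrA mulrAC ler_pdivrMr // ler_wpM2l ?powR_ge0 //.
  by rewrite /D lerDl.
by have := norm_of_mass p0 H; rewrite -powRrM mulfV ?gt_eqF // powRr1 // ltW.
Qed.

Definition symbol_condition :=
  ((2%:E < p%:E)%E -> exists a b, forall z, g z = a * z + b) /\
  ((p%:E <= 2%:E)%E -> exists c, forall z, g z = c).

Lemma symbol_of_operator :
  bounded_op m +oo%E p%:E (volterra g) \/ compact_op m +oo%E p%:E (volterra g) ->
  symbol_condition.
Proof.
move=> hyp.
have [K] : exists K, forall w, normc (cderiv g w) <= K * (1 + normc w).
  case: hyp => [H|H]; apply: (@linear_growth R m g eg +oo%E (ltry 0)).
    exact: bounded_subseq_wbounded (ltry 0) pE H.
  exact: compact_subseq_wbounded (ltry 0) pE H.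
move=> /(quadratic_of_growth eg)[a [b [c gE]]].
have dg := cderiv_quadratic gE.
have [L [S [L5 LS]]] := amplitude_bounded hyp.
have a0 := affine_of_amplitude L5 LS dg.
split=> [_|p2]; first by exists b, c => z; rewrite gE a0 mul0r add0r.
have dg' z : cderiv g z = b by rewrite dg a0 mulr0 mul0r add0r.
rewrite lee_fin in p2.
have b0 := const_of_amplitude L5 p2 LS dg'.
by exists c => z; rewrite gE a0 b0 !mul0r !add0r.
Qed.

Lemma symbol_cases : symbol_condition ->
  (2 < p /\ exists c, 0 <= c /\ forall w, normc (cderiv g w) <= c) \/
  (forall z, cderiv g z = 0).
Proof.
move=> [H1 H2]; have [p2|p2] := leP p 2.
  right => z; have [c gE] := H2 (ltac:(by rewrite lee_fin)).
  by apply: (@affine_cderiv R g 0 c) => u; rewrite gE mul0r add0r.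
left; split=> //; have [a [b gE]] := H1 (ltac:(by rewrite lte_fin)).
by exists (normc a); split=> [|w]; [exact: normc_ge0|rewrite (affine_cderiv gE)].
Qed.

Lemma bounded_of_symbol : symbol_condition -> bounded_op m +oo%E p%:E (volterra g).
Proof.
move=> /symbol_cases[[p2 [c [c0 gc]]]|dg].
  have [K K0 KP] := volterra_norm_decay p2 c0 gc.
  exists K => f fF; have [M fE fM] := fock_norm_oo_fin fF.
  have H := KP f M fF.1 fM; split; last by rewrite fE -EFinM.
  split; first exact: entire_volterra fF.1 eg.
  exact: le_lt_trans H (ltry _).
exists 0 => f fF; rewrite (volterra_cst fF.1 dg); split; first exact: fock_zero.
by rewrite mul0e; exact: fock_norm_zero.
Qed.

(** The images converge in the sup norm along a subsequence; by linearity [small_norm] applies to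
    the differences [u (s n) - f], which are bounded by [K + K]. *)
Lemma compact_of_symbol : symbol_condition -> compact_op m +oo%E p%:E (volterra g).
Proof.
move=> sc; split=> [f fF|u K uK].
  by have [B HB] := bounded_of_symbol sc; exact: (HB f fF).1.
have eu n : entire (u n) := (uK n).1.1.
have [[p2 [c [c0 gc]]]|dg] := symbol_cases sc; last first.
  exists id, (fun=> 0); split; [by []|exact: fock_zero|].
  apply/norm_cvg0P => [n|e e0]; first exact: fock_norm_pos.
  exists 0%N => n _; have -> : volterra g (u n) \- (fun=> 0) = fun=> 0.
    by apply/funext => z; rewrite /= (volterra_cst (eu n) dg) subr0.
  by apply: le_trans fock_norm_zero _; rewrite lee_fin ltW.
have uM n : wbound m (u n) K by apply/fock_norm_oo_le; exact: (uK n).2.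
have [s [f [hs ef fM cv]]] := volterra_convergent_subseq eg c0 gc eu uM.
have K0 := wbound_ge0 fM.
have [D D0 DP] := volterra_norm_decay p2 c0 gc.
exists s, (volterra g f); split; [exact: hs| |].
  split; first exact: entire_volterra ef eg.
  exact: le_lt_trans (DP f K ef fM) (ltry _).
apply/norm_cvg0P => [n|e e0]; first exact: fock_norm_pos.
have [d d0 dP] := small_norm p2 c0 gc (addr_ge0 K0 K0) e0.
have [N NP] := cv d d0; exists N => n nN.
have E := volterraB eg (eu (s n)) ef.
have -> : volterra g (u (s n)) \- volterra g f = volterra g (fun z => u (s n) z - f z).
  by rewrite E.
apply: dP; [exact: (entire_sub (eu (s n)) ef).1|exact: wboundB (uM (s n)) fM|].
by rewrite E; exact: NP.
Qed.

End FromSupToLp.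

Theorem theorem1p1 (R : realType) (m : nat) (g : R[i] -> R[i])
    (p : \bar R) (g_entire : entire g) (p_gt0 : (0 < p)%E) :
  ((bounded_op m p +oo%E (volterra g) <->
    exists a b c : R[i], forall z, g z = a * z ^+ 2 + b * z + c) /\
   (compact_op m p +oo%E (volterra g) <->
    exists a b : R[i], forall z, g z = a * z + b)) /\
  ((p < +oo)%E ->
   (bounded_op m +oo%E p (volterra g) <-> compact_op m +oo%E p (volterra g)) /\
   (compact_op m +oo%E p (volterra g) <->
    ((2%:E < p)%E -> exists a b : R[i], forall z, g z = a * z + b) /\
    ((p <= 2%:E)%E -> exists c : R[i], forall z, g z = c))) /\
  (bounded_op m +oo%E +oo%E (volterra g) ->
   forall a b c : R[i], (forall z, g z = a * z ^+ 2 + b * z + c) ->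
   spectrum m +oo%E (volterra g) = [set l | normc l <= 2 * normc a] /\
   [set l : R[i]^o | normc l <= 2 * normc a] =
     [set 0] `|` closure [set l : R[i]^o | l != 0 /\
        ~ fock m +oo%E (fun z => cexp (g z / l))]).
Proof.
split.
  split.
    exact: (bounded_to_oo m g_entire p_gt0).
  exact: (compact_to_oo m g_entire p_gt0).
split=> [p_fin|_ a b c gE].
  move: p p_gt0 p_fin => [r| |] r0 p_fin.
  - rewrite lte_fin in r0.
    have sO := @symbol_of_operator R m r r0 g g_entire.
    have bS := bounded_of_symbol m r0 g_entire.
    have cS := compact_of_symbol m r0 g_entire.
    split; split=> H.
    + exact: (cS (sO (or_introl H))).
    + exact: (bS (sO (or_intror H))).
    + exact: (sO (or_intror H)).
    + exact: (cS H).
  - by rewrite ltxx in p_fin.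
  - by rewrite ltNge leNye in r0.
split.
  exact: (spectrum_volterra m gE).
exact: (disc_closure m gE).
Qed.
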